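(* Let $D$ be a linear differential operator of order $k\ge0$, and let $K(\mathbf{x},\mathbf{y})=\Phi_{\mathrm{TPS},n}(\mathbf{x}-\mathbf{y})$, $\mathbf{x},\mathbf{y}\in\mathbb{R}^d$, where $\Phi_{\mathrm{TPS},n}(\mathbf{x}):=(-1)^{n+1}\|\mathbf{x}\|_2^{2n}\log\|\mathbf{x}\|_2$ (with value $0$ at $\mathbf{x}=0$) for some integer $n\ge k+1$, and let $s\ge n+1$ be an integer. Let $\mathbf{z}\in\mathbb{R}^d$ and let $\mathbf{X}=\{\mathbf{x}_1,\ldots,\mathbf{x}_N\}\subset\mathbb{R}^d$ be a finite set of (distinct) points, and assume that there is at least one $w\in\mathbb{R}^N$ with $\sum_{j=1}^Nw_jp(\mathbf{x}_j)=Dp(\mathbf{z})$ for all $p\in\Pi^d_s$. Let $w^*$ be the weight vector of the kernel-based numerical differentiation formula for $D$, $K$, $s$, $\mathbf{z}$, $\mathbf{X}$. Then for all $f\in\mathcal{F}_K$ and any $0<\gamma<1$, $$\Big|Df(\mathbf{z})-\sum_{j=1}^Nw_j^*f(\mathbf{x}_j)\Big|\le\rho_{s,D}\big(\mathbf{z},\mathbf{X},n-\tfrac{1-\gamma}{2}\big)\,C_{d,2n-1}^{1/2}\,|\Phi_{\mathrm{TPS},n}|_{C^{2n-1,\gamma}(B_{\mathbf{z},\mathbf{X}})}^{1/2}\,\|f\|_K,$$ where $$C_{d,2n-1}=\frac{d^{(2n-1)/2}}{((1+\gamma)/2+1)^2\cdots((1+\gamma)/2+n-1)^2}$$ (an empty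 product being $1$).
   Context: Notation. $\Pi^d_q$ is the space of $d$-variate real polynomials of total degree at most $q-1$. $S_{\mathbf{z},\mathbf{X}}:=\bigcup_{i=1}^N[\mathbf{z},\mathbf{x}_i]$ is the union of closed line segments, and $B_{\mathbf{z},\mathbf{X}}$ is the closed ball in $\mathbb{R}^d$ centered at the origin with radius equal to the diameter of $S_{\mathbf{z},\mathbf{X}}$. Differential operator: $Df=\sum_{|\alpha|\le k}a_\alpha\partial^\alpha f$ with real variable coefficients $a_\alpha$ (functions). $D'K$ denotes $D$ applied to the first $d$-dimensional argument of $K$. Hölder space. For an integer $r\ge0$ and $0<\gamma\le1$, $C^{r,\gamma}(\Omega)$ consists of all $r$ times continuously differentiable functions $f$ on $\Omega\subset\mathbb{R}^d$ with $|f|_{C^{r,\gamma}(\Omega)}:=\max_{|\alpha|=r}|\partial^\alpha f|_{C^{0,\gamma}(\Omega)}<\infty$, where $|g|_{C^{0,\gamma}(\Omega)}:=\sup_{\mathbf{x},\mathbf{y}\in\Omega,\,\mathbf{x}\ne\mathbf{y}}|g(\mathbf{x})-g(\mathbf{y})|/\|\mathbf{x}-\mathbf{y}\|_2^\gamma$. Known fact: for $s\ge n+1$ the kernel $K$ is conditionally positive definite of order $s$ on $\mathbb{R}^d$, i.e. $\sum_{i,j=1}^ma_ia_jK(\mathbf{y}_i,\mathbf{y}_j)>0$ for all pairwise distinct $\mathbf{y}_1,\ldots,\mathbf{y}_m\in\mathbb{R}^d$ and all $a\in\mathbb{R}^m\setminus\{0\}$ with $\sum_ja_jp(\mathbf{y}_j)=0$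 for all $p\in\Pi^d_s$. Kernel-based formula. Let $p_1,\ldots,p_M$ be a basis of $\Pi^d_s$, $M=\binom{d+s-1}{d}$. The weight vector $w^*$ is the $w$-part of a solution $(w,v)\in\mathbb{R}^N\times\mathbb{R}^M$ of $$\sum_{j=1}^N w_jK(\mathbf{x}_i,\mathbf{x}_j)+\sum_{j=1}^M v_jp_j(\mathbf{x}_i)=D'K(\mathbf{z},\mathbf{x}_i)\ (1\le i\le N),\qquad \sum_{j=1}^N w_jp_i(\mathbf{x}_j)=Dp_i(\mathbf{z})\ (1\le i\le M).$$ It is known that if the second group of equations is consistent, then the whole system is solvable and $w^*$ is uniquely determined ($v$ may be non-unique). Native space. $\mathcal{F}_K$ (for the chosen order $s$) is the semi-Hilbert space of real-valued functions on $\mathbb{R}^d$ obtained as completion of the space of functions $\sum_ia_iK(\cdot,\mathbf{y}_i)+p$ (finite sums, $p\in\Pi^d_s$, $\sum_ia_iq(\mathbf{y}_i)=0$ for all $q\in\Pi^d_s$) with squared semi-norm $\|\sum_ia_iK(\cdot,\mathbf{y}_i)+p\|_K^2=\sum_{i,j}a_ia_jK(\mathbf{y}_i,\mathbf{y}_j)$; polynomials in $\Pi^d_s$ have semi-norm zero. Equivalently, $f:\mathbb{R}^d\to\mathbb{R}$ belongs to $\mathcal{F}_K$ with $\|f\|_K\le C$ iff $|\sum_ia_if(\mathbf{y}_i)|\le C(\sum_{i,j}a_ia_jK(\mathbf{y}_i,\mathbf{y}_j))^{1/2}$ for all finite sets of points $\mathbf{y}_i$ and coefficients $a_i$ with $\sum_ia_iq(\mathbf{y}_i)=0$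 for all $q\in\Pi^d_s$. Growth function. For $\mu\ge0$, $\rho_{q,D}(\mathbf{z},\mathbf{X},\mu):=\sup\{Dp(\mathbf{z}):p\in\Pi^d_q,\ |p(\mathbf{x}_j)|\le\|\mathbf{x}_j-\mathbf{z}\|_2^\mu,\ j=1,\ldots,N\}\in[0,\infty]$; if it equals $\infty$ the bound is void. *)

(* Defs.v *)
From HB Require Import structures.
From mathcomp Require Import all_boot all_order all_algebra.
From mathcomp Require Import all_classical all_reals all_analysis.
(* The notations of mpoly clash with those of MathComp-Analysis, hence the
   qualified names below. *)
From mathcomp Require mpoly.
Export (canonicals, coercions) mpoly.

Set Implicit Arguments.
Unset Strict Implicit.
Unset Printing Implicit Defensive.

Import Order.TTheory GRing.Theory Num.Theory.
Import numFieldNormedType.Exports.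

Local Open Scope classical_set_scope.
Local Open Scope ring_scope.

(* The library norm on 'rV[R]_d is the sup norm; it is only used below as the
   (equivalent) topology underlying the directional derivative 'D_v. *)
Definition enorm (R : realType) (d : nat) (x : 'rV[R]_d) : R :=
  Num.sqrt (\sum_(i < d) x 0 i ^+ 2).

Definition diameter (R : realType) (d : nat) (A : set 'rV[R]_d) : R :=
  sup [set enorm (x - y) | x in A & y in A].

Definition star (R : realType) (d N : nat) (z : 'rV[R]_d)
    (x : 'I_N -> 'rV[R]_d) : set 'rV[R]_d :=
  [set y | exists (i : 'I_N) (t : R),
     0 <= t <= 1 /\ y = (1 - t) *: z + t *: x i].

(* Centred at the origin, not at z: it contains the differences of points of the
   star. *)
Definition star_ball (R : realType) (d N : nat) (z : 'rV[R]_d)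
    (x : 'I_N -> 'rV[R]_d) : set 'rV[R]_d :=
  [set y | enorm y <= diameter (star z x)].

Definition partial (R : realType) (d : nat) (i : 'I_d) (f : 'rV[R]_d -> R) :
    'rV[R]_d -> R :=
  fun x => 'D_(delta_mx 0 i) f x.

(* \partial_0^{al_0} ... \partial_{d-1}^{al_{d-1}} f, the derivatives in the
   last coordinate being taken first *)
Definition mpartial (R : realType) (d : nat) (al : mpoly.multinom d)
    (f : 'rV[R]_d -> R) : 'rV[R]_d -> R :=
  foldr (fun i g => iter (al i) (partial i) g) f (enum 'I_d).

(* mpoly.bmultinom d k.+1 is the finite type of multi-indices of degree
   less than k.+1. *)
Definition diffop (R : realType) (d k : nat)
    (a : mpoly.bmultinom d k.+1 -> 'rV[R]_d -> R)
    (f : 'rV[R]_d -> R) (z : 'rV[R]_d) : R :=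
  \sum_(al : mpoly.bmultinom d k.+1) a al z * mpartial al f z.

Definition peval (R : realType) (d : nat) (p : mpoly.mpoly d R)
    (x : 'rV[R]_d) : R :=
  mpoly.meval (fun i => x 0 i) p.

(* \Pi^d_q: msize p is 1 plus the total degree of p, and msize 0 = 0. *)
Definition Pi (R : realType) (d q : nat) : set (mpoly.mpoly d R) :=
  [set p | (mpoly.msize p <= q)%N].

Definition is_Pi_basis (R : realType) (d q M : nat)
    (p : 'I_M -> mpoly.mpoly d R) : Prop :=
  (forall i, Pi q (p i)) /\
  (forall P, Pi q P ->
     exists! c : {ffun 'I_M -> R}, P = \sum_(i < M) c i *: p i).

(* Valued in [0, +oo]: the zero polynomial is always admissible. *)
Definition growth (R : realType) (d k N q : nat)
    (a : mpoly.bmultinom d k.+1 -> 'rV[R]_d -> R)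
    (z : 'rV[R]_d) (x : 'I_N -> 'rV[R]_d) (mu : R) : \bar R :=
  ereal_sup [set (diffop a (peval p) z)%:E | p in
    [set p | Pi q p /\
             forall j, `|peval p (x j)| <= enorm (x j - z) `^ mu]].

Definition holder0_seminorm (R : realType) (d : nat) (g : R)
    (Om : set 'rV[R]_d) (f : 'rV[R]_d -> R) : \bar R :=
  ereal_sup [set e | exists x y, [/\ Om x, Om y, x != y &
    e = (`|f x - f y| / enorm (x - y) `^ g)%:E]].

(* |f|_{C^{r,g}(Om)}, valued in [0, +oo]. Starting the maximum from 0 gives the
   value 0 when Om has at most one point, where holder0_seminorm is -oo. *)
Definition holder_seminorm (R : realType) (d r : nat) (g : R)
    (Om : set 'rV[R]_d) (f : 'rV[R]_d -> R) : \bar R :=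
  \big[maxe/0%E]_(al : mpoly.bmultinom d r.+1 | mpoly.mdeg al == r)
    holder0_seminorm g Om (mpartial al f).

(* For n >= 1 the value at 0 is 0, because of the factor 0 ^+ (2 * n). *)
Definition tps (R : realType) (d n : nat) (x : 'rV[R]_d) : R :=
  (-1) ^+ n.+1 * enorm x ^+ (2 * n) * ln (enorm x).

Definition tps_kernel (R : realType) (d n : nat) (x y : 'rV[R]_d) : R :=
  tps n (x - y).

Definition is_kernel_weight (R : realType) (d k N M : nat)
    (a : mpoly.bmultinom d k.+1 -> 'rV[R]_d -> R)
    (K : 'rV[R]_d -> 'rV[R]_d -> R) (p : 'I_M -> mpoly.mpoly d R)
    (z : 'rV[R]_d) (x : 'I_N -> 'rV[R]_d) (w : 'I_N -> R) : Prop :=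
  exists v : 'I_M -> R,
    (forall i : 'I_N,
       \sum_(j < N) w j * K (x i) (x j) + \sum_(j < M) v j * peval (p j) (x i)
       = diffop a (fun y => K y (x i)) z) /\
    (forall i : 'I_M,
       \sum_(j < N) w j * peval (p i) (x j) = diffop a (peval (p i)) z).

(* A relation, read: f belongs to the space to be completed and has semi-norm c.
   The y i need not be distinct, since equal points can be merged. *)
Definition pre_native (R : realType) (d s : nat)
    (K : 'rV[R]_d -> 'rV[R]_d -> R) (f : 'rV[R]_d -> R) (c : R) : Prop :=
  exists (m : nat) (b : 'I_m -> R) (y : 'I_m -> 'rV[R]_d) (p : mpoly.mpoly d R),
    [/\ Pi s p,
        forall q, Pi s q -> \sum_(i < m) b i * peval q (y i) = 0,
        f = (fun x => \sum_(i < m) b i * K x (y i) + peval p x) &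
        c = Num.sqrt (\sum_(i < m) \sum_(j < m) b i * b j * K (y i) (y j))].

(* Completion of the pre-native space as a space of functions: f is the
   pointwise limit of a sequence that is Cauchy for the semi-norm, and c is the
   limit of the semi-norms. *)
Definition native_seminorm_is (R : realType) (d s : nat)
    (K : 'rV[R]_d -> 'rV[R]_d -> R) (f : 'rV[R]_d -> R) (c : R) : Prop :=
  exists (h : nat -> 'rV[R]_d -> R) (e : nat -> R),
    [/\ forall m, pre_native s K (h m) (e m),
        forall eps : R, 0 < eps -> exists m0 : nat, forall m l : nat,
          (m0 <= m)%N -> (m0 <= l)%N ->
          exists2 t, pre_native s K (fun x => h m x - h l x) t & t < eps,
        forall x, (fun m => h m x) @ \oo --> f x &
        e @ \oo --> c].

Definition native_space (R : realType) (d s : nat)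
    (K : 'rV[R]_d -> 'rV[R]_d -> R) : set ('rV[R]_d -> R) :=
  [set f | exists c, native_seminorm_is s K f c].

(* For a conditionally positive definite K of order s, the c such that
   native_seminorm_is s K f c is unique: if h is Cauchy and converges pointwise
   to 0, then <h m, h l> tends to 0 as l grows, for every m, whence the
   semi-norms tend to 0. *)
Definition native_seminorm (R : realType) (d s : nat)
    (K : 'rV[R]_d -> 'rV[R]_d -> R) (f : 'rV[R]_d -> R) : R :=
  xget 0 [set c | native_seminorm_is s K f c].

Definition tps_const (R : realType) (d n : nat) (g : R) : R :=
  d%:R `^ ((2 * n - 1)%:R / 2)
    / \prod_(1 <= i < n) ((1 + g) / 2 + i%:R) ^+ 2.

(* Main.v *)
(** The error functional lambda = D_z - sum_j w_j delta_(x_j) annihilates Pi_s, so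
    |lambda f|^2 <= (lambda lambda K) |f|_K^2, and the kernel-based weights minimise
    lambda lambda K among the weights that are exact on Pi_s. It remains to estimate
    this form for a well chosen exact w: by linear programming duality one can take
    sum_j |w_j| |x_j - z|^mu at most the growth function, and subtracting the Taylor
    polynomials of degree n - 1 in both arguments of K leaves a remainder bounded by
    C_(d,2n-1) |Phi|_(C^(2n-1,gamma)) |x_i - z|^mu |x_j - z|^mu.

    The conditional positive definiteness of K comes from that of 1 / (|x - y|^2 + e),
    by integrating n + 1 times in e. Functionals with derivatives are reached as limits
    of difference stencils that are exact on Pi_s; applied to differences of a Cauchy
    sequence in the native space they also show that the derivatives converge locally
    uniformly, so that D may be applied to the pointwise limit f. *)

Require Import Defs.
From mathcomp Require Import all_boot all_order all_algebra.
From mathcomp Require Import all_classical all_reals all_analysis.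
From mathcomp Require mpoly.
From mathcomp Require Import zify ring lra.
Set Implicit Arguments.
Unset Strict Implicit.
Unset Printing Implicit Defensive.
Import Order.TTheory GRing.Theory Num.Theory.
Import numFieldNormedType.Exports.
Local Open Scope classical_set_scope.
Local Open Scope ring_scope.

(** * One-variable calculus *)

(** The numbers in the bound come from one estimate. Taking n - 1 derivatives in each argument of K
    leaves a second difference of partials of order 2n - 2, with step a in one argument and b in the
    other. One more derivative and the Hölder condition bound it by a * b^g and, with the roles
    exchanged, by b * a^g; the geometric mean (a b)^((1 + g) / 2) treats both arguments alike.
    Integrating back n - 1 times in each argument gives the squared product in the denominator and
    the exponent n - 1 + (1 + g) / 2 = n - (1 - g) / 2, while d^((2n - 1) / 2) is the price of 2n -
    1 comparisons of the l1 norm with the Euclidean one. The partials of Phi of order at most 2n - 2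
    vanish at 0: this removes both the term of K differentiated twice at (z, z) and the product of
    the two Taylor operators. A node may coincide with z. There |x_j - z|^mu = 0, so the weighted l1
    norm does not see its weight, and the duality treats this coordinate apart. Partial derivatives
    are carried as explicit families indexed by sequences of coordinates and differentiable along
    lines; for polynomials and for Phi such families can be written down. *)

Lemma is_derive1_continuous (R : realType) (f : R -> R) (t l : R) :
  is_derive t 1 f l -> {for t, continuous f}.
Proof. by case=> df _; apply/differentiable_continuous/derivable1_diffP. Qed.

Lemma MVT_cc (R : realType) (f f' : R -> R) (a b : R) : a < b ->
  (forall t : R, a <= t <= b -> is_derive t 1 f (f' t)) ->
  exists2 c, a < c < b & f b - f a = f' c * (b - a).
Proof.
move=> ab df; have [||c] := @MVT R f f' a b ab.
- by move=> t; rewrite in_itv /= => /andP[at_ tb]; apply: df; rewrite !ltW.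
- apply: derivable_within_continuous => t; rewrite in_itv /= => tab.
  by have [] := df t tab.
- by rewrite in_itv /= => cab ->; exists c.
Qed.

Lemma le_powR_of_derive (R : realType) (f f' : R -> R) (M p dl : R) :
  0 <= p ->
  (forall t : R, 0 <= t <= dl -> is_derive t 1 f (f' t)) ->
  f 0 = 0 -> (forall t : R, 0 < t <= dl -> f' t <= M * t `^ p) ->
  forall t : R, 0 <= t <= dl -> f t <= M / (p + 1) * t `^ (p + 1).
Proof.
move=> p0 df f0 le_f' t /andP[t0 tdl]; have p1 : 0 < p + 1 by lra.
move: t0; rewrite le_eqVlt => /predU1P[<-|t0].
  by rewrite f0 powR0 ?mulr0 // gt_eqF.
pose h u := M / (p + 1) * u `^ (p + 1) - f u.
pose h' u := M * u `^ p - f' u.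
have dh u : 0 < u <= dl -> is_derive u 1 h (h' u).
  move=> /andP[u0 udl]; rewrite /h.
  have du := df u; rewrite (ltW u0) udl in du; have {}du := du isT.
  have dp := @is_derive1_powR R (p + 1) u u0.
  have -> : h' u = (M / (p + 1)) *: ((p + 1) * u `^ (p + 1 - 1)) - f' u.
    by rewrite /h' addrK /GRing.scale /= mulrA divfK ?gt_eqF.
  apply: is_deriveB.
have hmono u : 0 < u < t -> h u <= h t.
  move=> /andP[u0 ut]; rewrite -subr_ge0.
  have [v /andP[v0 vt]|v /andP[v0 vt] ->] := @MVT_cc R h h' u t ut.
    by apply: dh; rewrite (lt_le_trans u0) // (le_trans vt).
  rewrite mulr_ge0 ?subr_ge0 ?(ltW ut) // le_f' //.
  by rewrite (lt_trans u0 v0) (le_trans (ltW vt)).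
have h0 : h u @[u --> 0^'+] --> 0.
  have : h u @[u --> 0^'+] --> M / (p + 1) * 0 - f 0.
    apply: cvgB.
      by apply: cvgM; [exact: cvg_cst|exact: powR_cvg0].
    apply: cvg_at_right_filter.
    apply: (is_derive1_continuous (df 0 _)).
    by rewrite lexx (le_trans (ltW t0)).
  by rewrite f0 mulr0 subr0.
rewrite -subr_ge0; rewrite -[0](cvg_lim _ h0) //.
apply: limr_le; first by apply/cvg_ex; exists 0.
near=> u; apply: hmono; apply/andP; split; first by near: u; exact: nbhs_right_gt.
by near: u; exact: nbhs_right_lt.
Unshelve. all: by end_near. Qed.

Lemma norm_le_powR_of_derive (R : realType) (f f' : R -> R) (M p dl : R) :
  0 <= p ->
  (forall t : R, 0 <= t <= dl -> is_derive t 1 f (f' t)) ->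
  f 0 = 0 -> (forall t : R, 0 < t <= dl -> `|f' t| <= M * t `^ p) ->
  forall t : R, 0 <= t <= dl -> `|f t| <= M / (p + 1) * t `^ (p + 1).
Proof.
move=> p0 df f0 le_f' t tdl; rewrite ler_norml; apply/andP; split; last first.
  apply: (le_powR_of_derive p0 df f0) => // u /le_f'.
  exact: le_trans (ler_norm _).
rewrite lerNl; apply: (@le_powR_of_derive R (- f) (fun u => - f' u) M p dl) => //.
- by move=> u /df du; exact: is_deriveN.
- by rewrite /GRing.opp /= f0 oppr0.
- by move=> u /le_f'; rewrite -normrN; exact: le_trans (ler_norm _).
Qed.

(** Each integration raises the exponent by one and divides by the new exponent. With p = (1 + g) /
    2 this is the origin of the product in [tps_const]; with p = 0 it gives the factorial of
    Taylor's formula. *)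
Lemma taylor_remainder_le (R : realType) (m : nat) (F : nat -> R -> R)
    (M p dl : R) : 0 <= p ->
  (forall (j : nat) (t : R), (j < m)%N -> 0 <= t <= dl -> is_derive t 1 (F j) (F j.+1 t)) ->
  (forall j : nat, (j < m)%N -> F j 0 = 0) ->
  (forall t : R, 0 <= t <= dl -> `|F m t| <= M * t `^ p) ->
  forall t : R, 0 <= t <= dl ->
  `|F 0%N t| <= M / (\prod_(1 <= i < m.+1) (p + i%:R)) * t `^ (p + m%:R).
Proof.
elim: m F => [|m IH] F p0 dF F0 leF t tdl.
  by rewrite big_geq // divr1 addr0; exact: leF.
rewrite big_nat_recl //.
have step u : 0 <= u <= dl -> `|F 1%N u| <=
    M / (\prod_(1 <= i < m.+1) (p + i%:R)) * u `^ (p + m%:R).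
  apply: (IH (fun j => F j.+1)) => // j ?; first by move=> ?; exact: dF.
  exact: F0.
have pm0 : 0 <= p + m%:R by rewrite addr_ge0.
have := @norm_le_powR_of_derive R (F 0%N) (F 1%N) _ (p + m%:R) dl pm0.
move=> /(_ (M / (\prod_(1 <= i < m.+1) (p + i%:R)))) H.
have -> : M / ((p + 1) * \prod_(1 <= i < m.+1) (p + i.+1%:R)) =
          M / \prod_(1 <= i < m.+1) (p + i%:R) / (p + m%:R + 1).
  rewrite -mulrA -invfM; congr (_ / _).
  have := @big_nat_recl R 1 *%R m.+1 1 (fun i => p + i%:R) isT.
  rewrite big_nat_recr //= => <-; rewrite mulrC.
  by rewrite -natr1 addrA mulrC.
rewrite -natr1 addrA; apply: H => //; first by move=> u; exact: dF.
  exact: F0.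
by move=> u /andP[u0 ul]; apply: step; rewrite (ltW u0).
Qed.

Lemma cvg_sumr (R : realType) (T I : Type) (F : set_system T) (r : seq I)
    (f : I -> T -> R) (l : I -> R) : Filter F ->
  (forall i, f i t @[t --> F] --> l i) ->
  \sum_(i <- r) f i t @[t --> F] --> \sum_(i <- r) l i.
Proof. by move=> FF fl; apply: cvg_big => //; exact: add_continuous. Qed.

Lemma cvg_cMr (R : realType) (T : Type) (F : set_system T)
    (f : T -> R) (c l : R) : Filter F ->
  f t @[t --> F] --> l -> c * f t @[t --> F] --> c * l.
Proof. by move=> FF fl; apply: cvgM => //; exact: cvg_cst. Qed.

Lemma cvg_ge0 (R : realType) (T : Type) (F : set_system T)
    (f : T -> R) (l : R) : ProperFilter F ->
  (\forall t \near F, 0 <= f t) -> f t @[t --> F] --> l -> 0 <= l.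
Proof. by move=> FF f0; apply: (closed_cvg (fun a : R => 0 <= a)) => //; exact: closed_ge. Qed.

Lemma is_derive_sumr (R : realType) (I : Type) (r : seq I)
    (h : I -> R -> R) (dh : I -> R) (t : R) :
  (forall i, is_derive t 1 (h i) (dh i)) ->
  is_derive t 1 (fun t => \sum_(i <- r) h i t) (\sum_(i <- r) dh i).
Proof.
move=> dhi; elim: r => [|i r IH].
  rewrite big_nil (_ : (fun t => _) = cst 0); first exact: is_derive_cst.
  by apply/funext => u; rewrite big_nil.
rewrite big_cons (_ : (fun t => _) = h i \+ (fun t => \sum_(j <- r) h j t)).
  exact: is_deriveD.
by apply/funext => u; rewrite big_cons.
Qed.

Lemma is_derive_cMr (R : realType) (h : R -> R) (c dh t : R) :
  is_derive t 1 h dh -> is_derive t 1 (fun t => c * h t) (c * dh).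
Proof. by move=> H; exact: is_deriveZ. Qed.

Lemma is_derive_affine (R : realType) (a b u : R) :
  is_derive u 1 (fun u : R => u * a + b) a.
Proof.
have := is_deriveD (is_deriveZ a (is_derive_id u 1)) (is_derive_cst b u 1).
rewrite addr0 [a *: 1](_ : _ = a); last by rewrite /GRing.scale /= mulr1.
by congr is_derive; apply/funext => v; rewrite mulrC.
Qed.

(** * Schur multipliers *)

Lemma ge0_eq (R : realType) (a b : R) : a = b -> 0 <= a -> 0 <= b.
Proof. by move=> ->. Qed.

Definition psd (R : realType) (I : finType) (K : I -> I -> R) :=
  forall b : I -> R, 0 <= \sum_i \sum_j b i * b j * K i j.

(* Positive definite kernels are Schur multipliers (Schur product theorem);
   working with multipliers makes closure under products immediate. *)
Definition schur (R : realType) (I : finType) (K : I -> I -> R) :=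
  forall L, psd L -> psd (fun i j => K i j * L i j).

Section Schur.
Variables (R : realType) (I : finType).
Implicit Types K L : I -> I -> R.

Lemma eq_schur K L : (forall i j, K i j = L i j) -> schur K -> schur L.
Proof.
move=> KL sK M pM b; have := sK M pM b.
by apply: ge0_eq; apply: eq_bigr => i _; apply: eq_bigr => j _; rewrite KL.
Qed.

Lemma schur_psd K : schur K -> psd K.
Proof.
move=> /(_ (fun _ _ => 1)) H b.
have /H/(_ b) : psd (fun _ _ : I => 1 : R).
  move=> c; under eq_bigr do under eq_bigr do rewrite mulr1.
  by under eq_bigr do rewrite -mulr_sumr; rewrite -mulr_suml -expr2 sqr_ge0.
by apply: ge0_eq; apply: eq_bigr => i _; apply: eq_bigr => j _; rewrite mulr1.
Qed.

Lemma schur_rank1 (v : I -> R) : schur (fun i j => v i * v j).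
Proof.
move=> L pL b; have := pL (fun i => b i * v i).
by apply: ge0_eq; apply: eq_bigr => i _; apply: eq_bigr => j _; ring.
Qed.

Lemma schurM K L : schur K -> schur L -> schur (fun i j => K i j * L i j).
Proof.
move=> sK sL M pM b; have := sK _ (sL _ pM) b.
by apply: ge0_eq; apply: eq_bigr => i _; apply: eq_bigr => j _; ring.
Qed.

Lemma schur_cst (c : R) : 0 <= c -> schur (fun _ _ : I => c).
Proof.
move=> c0; apply: eq_schur (schur_rank1 (fun=> Num.sqrt c)) => i j.
by rewrite -expr2 sqr_sqrtr.
Qed.

Lemma schurX K m : schur K -> schur (fun i j => K i j ^+ m).
Proof.
move=> sK; elim: m => [|m IH].
  by apply: eq_schur (schur_cst ler01) => i j; rewrite expr0.
by apply: eq_schur (schurM sK IH) => i j; rewrite exprS.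
Qed.

Lemma schur_sum (J : Type) (r : seq J) (K : J -> I -> I -> R) :
  (forall l, schur (K l)) -> schur (fun i j => \sum_(l <- r) K l i j).
Proof.
move=> sK L pL b.
under eq_bigr do under eq_bigr do rewrite mulr_suml mulr_sumr.
under eq_bigr do rewrite exchange_big; rewrite exchange_big /=.
by apply: sumr_ge0 => l _; exact: sK.
Qed.

Lemma schur_lim (K : nat -> I -> I -> R) L : (forall m, schur (K m)) ->
  (forall i j, K m i j @[m --> \oo] --> L i j) -> schur L.
Proof.
move=> sK KL M pM b.
have H : \sum_i \sum_j b i * b j * (K m i j * M i j) @[m --> \oo] -->
         \sum_i \sum_j b i * b j * (L i j * M i j).
  apply: cvg_sumr => i; apply: cvg_sumr => j; apply: cvg_cMr.
  by apply: cvgM; [exact: KL | exact: cvg_cst].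
by apply: cvg_ge0 H; apply: nearW => m; exact: sK.
Qed.

Lemma schur_geometric K : schur K -> (forall i j, `|K i j| < 1) ->
  schur (fun i j => (1 - K i j)^-1).
Proof.
move=> sK K1.
apply: (@schur_lim (fun m i j => series (geometric 1 (K i j)) m)).
  move=> m; rewrite /series /=; apply: schur_sum => l.
  by apply: eq_schur (schurX l sK) => i j; rewrite mul1r.
by move=> i j; rewrite -[X in _ --> X]mul1r; exact: cvg_geometric_series.
Qed.

(* Under the Cayley transform u = (A - 1) / (A + 1) the Cauchy kernel becomes
   (1 - u_i) (1 - u_j) / (2 (1 - u_i u_j)). *)
Lemma schur_cauchy (A : I -> R) : (forall i, 0 < A i) ->
  schur (fun i j => (A i + A j)^-1).
Proof.
move=> A0; pose u i := (A i - 1) / (A i + 1).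
have u1 i : `|u i| < 1.
  have := A0 i => Ai; have A1 : 0 < A i + 1 by lra.
  rewrite normrM normfV (gtr0_norm A1) ltr_pdivrMr // mul1r ltr_norml; lra.
apply: (@eq_schur (fun i j => (1 - u i) * (1 - u j) *
                      (2^-1 * (1 - u i * u j)^-1))); last first.
  apply: schurM; first exact: (schur_rank1 (fun i => 1 - u i)).
  apply: schurM; first by apply: schur_cst; rewrite invr_ge0.
  apply: schur_geometric; first exact: schur_rank1.
  move=> i j; rewrite normrM; apply: le_lt_trans (u1 i).
  by rewrite ler_piMr // ltW.
move=> i j; have := A0 i; have := A0 j => Aj Ai; rewrite /u.
have n1 : A i + 1 != 0 by rewrite gt_eqF //; lra.
have n2 : A j + 1 != 0 by rewrite gt_eqF //; lra.
have n3 : A i + A j != 0 by rewrite gt_eqF //; lra.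
have -> : 1 - (A i - 1) / (A i + 1) * ((A j - 1) / (A j + 1)) =
  2 * (A i + A j) / ((A i + 1) * (A j + 1)) by field; rewrite n1 n2.
field; rewrite n1 n2 n3 //.
Qed.

End Schur.

(** * The Euclidean norm and the inverse quadratic kernel *)

Lemma enorm_ge0 (R : realType) d (x : 'rV[R]_d) : 0 <= enorm x.
Proof. exact: sqrtr_ge0. Qed.

Lemma sqr_enorm (R : realType) d (x : 'rV[R]_d) :
  enorm x ^+ 2 = \sum_i x 0 i ^+ 2.
Proof. by rewrite sqr_sqrtr // sumr_ge0 // => i _; exact: sqr_ge0. Qed.

Lemma enorm_eq0 (R : realType) d (x : 'rV[R]_d) : enorm x = 0 -> x = 0.
Proof.
move=> x0; have := sqr_enorm x; rewrite x0 expr0n /= => /esym/eqP.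
rewrite psumr_eq0 => [/allP H|i _]; last exact: sqr_ge0.
apply/rowP => i; have := H i; rewrite mem_index_enum => /(_ isT).
by rewrite sqrf_eq0 => /eqP ->; rewrite mxE.
Qed.

(** With A_i = e / 2 + |y_i|^2 the denominator is A_i + A_j - 2 <y_i, y_j>. Factoring out A_i + A_j
    leaves a Cauchy kernel times a geometric series in 2 <y_i, y_j> / (A_i + A_j). This ratio has
    modulus below 1 because both |y_i - y_j|^2 + e and |y_i + y_j|^2 + e are positive. *)
Lemma psd_inv_sqr_enorm (R : realType) d (I : finType) (y : I -> 'rV[R]_d) (e : R) :
  0 < e -> psd (fun i j => (enorm (y i - y j) ^+ 2 + e)^-1).
Proof.
move=> e0; apply: schur_psd.
pose A i := e / 2 + enorm (y i) ^+ 2.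
have A0 i : 0 < A i by rewrite ltr_pwDl ?divr_gt0 // sqr_ge0.
pose G i j := \sum_l y i 0 l * y j 0 l.
have AG i j : enorm (y i - y j) ^+ 2 + e = A i + A j - 2 * G i j.
  rewrite /A !sqr_enorm mulr_sumr addrACA -splitr -big_split -addrA -sumrB.
  rewrite addrC; congr (_ + _); apply: eq_bigr => l _; rewrite !mxE /=; ring.
have AG' i j : 0 < A i + A j + 2 * G i j.
  have -> : A i + A j + 2 * G i j = e + enorm (y i + y j) ^+ 2.
    rewrite /A !sqr_enorm mulr_sumr addrACA -splitr -big_split -addrA -big_split.
    congr (_ + _); apply: eq_bigr => l _; rewrite !mxE /=; ring.
  by rewrite ltr_pwDl // sqr_ge0.
have AA i j : 0 < A i + A j by rewrite addr_gt0.
apply: (@eq_schur _ _ (fun i j => (A i + A j)^-1 *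
                        (1 - 2 * G i j * (A i + A j)^-1)^-1)).
  move=> i j; rewrite AG -invfM; congr (_^-1).
  by rewrite mulrBr mulr1 mulrC divfK // gt_eqF.
apply: schurM; first exact: schur_cauchy.
apply: schur_geometric.
  apply: schurM; last exact: schur_cauchy.
  apply: schurM; first exact: schur_cst.
  by apply: schur_sum => l; exact: (schur_rank1 (fun i => y i 0 l)).
move=> i j; rewrite normrM normfV (gtr0_norm (AA i j)) ltr_pdivrMr // mul1r.
have := AG' i j; have := AG i j; have := sqr_ge0 (enorm (y i - y j)).
by rewrite ltr_norml => *; apply/andP; split; lra.
Qed.

(** * Moments of powers times logarithms *)

(** With x = y^2 this is y * ln (1 / y) <= 1. The square root leaves a positive power of x after the
    logarithm has been absorbed. *)
Lemma xlnx_le (R : realType) (x : R) : 0 < x <= 1 -> `|x * ln x| <= 2 * Num.sqrt x.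
Proof.
move=> /andP[x0 x1]; set y := Num.sqrt x.
have y0 : 0 < y by rewrite sqrtr_gt0.
have xE : x = y ^+ 2 by rewrite sqr_sqrtr // ltW.
have y1 : y <= 1 by rewrite -sqrtr1 ler_wsqrtr.
have := @ln_sublinear R y^-1; rewrite invr_gt0 => /(_ y0); rewrite lnV // => ly.
have ly0 := ln_le0 y1.
rewrite xE lnXn // normrM (ger0_norm (sqr_ge0 _)) ler0_norm; last first.
  by rewrite mulrn_wle0.
rewrite (_ : y ^+ 2 * _ = 2 * y * (y * - ln y)); last by ring.
rewrite ler_piMr //; first by rewrite mulr_ge0 // ltW.
by rewrite -ler_pdivlMl // mulr1; apply: ltW; lra.
Qed.

Lemma xlnx_cvg0 (R : realType) : x * ln x @[x --> (0 : R)^'+] --> (0 : R).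
Proof.
have H : 2 * Num.sqrt x @[x --> (0 : R)^'+] --> (0 : R).
  rewrite -[X in _ --> X](mulr0 2) -[in X in _ --> X](sqrtr0 R).
  apply: cvg_cMr; apply: cvg_at_right_filter; exact: sqrt_continuous.
apply/cvgrPdist_le => e e0; move/cvgrPdist_le : H => /(_ _ e0) H.
near=> x; rewrite sub0r normrN; apply: le_trans (xlnx_le _) _.
  by apply/andP; split; near: x; [exact: nbhs_right_gt|exact: nbhs_right_le].
have : `|0 - 2 * Num.sqrt x| <= e by near: x.
by rewrite sub0r normrN; exact: le_trans (ler_norm _).
Unshelve. all: by end_near. Qed.

Lemma nonincreasing_vanishing_ge0 (R : realType) (f f' : R -> R) (C : R) :
  (forall e : R, 0 < e -> is_derive e 1 f (f' e)) ->
  (forall e : R, 0 < e -> f' e <= 0) ->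
  (forall e : R, 0 < e -> `|f e| <= C / e) ->
  forall e : R, 0 < e -> 0 <= f e.
Proof.
move=> df f'0 fC e e0.
have mono e' : e < e' -> f e' <= f e.
  move=> ee'; have [u /andP[eu _]|c /andP[ec _] E] := @MVT_cc R f f' e e' ee'.
    by apply: df; exact: lt_le_trans e0 eu.
  rewrite -subr_le0 E mulr_le0_ge0 ?subr_ge0 ?(ltW ee') // f'0 //.
  exact: lt_trans e0 ec.
rewrite leNgt; apply/negP => fe0; pose a := - f e.
have a0 : 0 < a by rewrite oppr_gt0.
(* At [e + h] monotonicity still gives a value at most - a, whereas C / (e + h) < a. *)
pose h := (`|C| + 1) / a.
have h0 : 0 < h by rewrite divr_gt0 // ltr_wpDl.
have e'0 : 0 < e + h by rewrite addr_gt0.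
have : a <= C / (e + h).
  apply: le_trans (fC _ e'0); rewrite ler0_norm; last first.
    by apply: le_trans (ltW fe0); apply: mono; rewrite ltrDl.
  by rewrite lerN2 mono // ltrDl.
rewrite ler_pdivlMr // mulrDr mulrCA divff ?gt_eqF // mulr1.
have := ler_norm C; have : 0 < a * e by rewrite mulr_gt0.
lra.
Qed.

Lemma is_derive_ln_comp (R : realType) (g : R -> R) (dg u : R) :
  is_derive u 1 g dg -> 0 < g u -> is_derive u 1 (fun w => ln (g w)) (dg / g u).
Proof.
move=> dgu g0; rewrite mulrC.
exact: (@is_derive1_comp R (@ln R) g u _ _ (is_derive1_ln g0) dgu).
Qed.

Lemma is_derive_pow_ln (R : realType) (g : R -> R) (dg u : R) (m : nat) :
  is_derive u 1 g dg -> 0 < g u ->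
  is_derive u 1 (fun w => g w ^+ m.+1 * ln (g w))
    (dg * (m.+1%:R * (g u ^+ m * ln (g u)) + g u ^+ m)).
Proof.
move=> dgu g0; have n0 : g u != 0 by rewrite gt_eqF.
have := is_deriveM (is_deriveX m.+1 dgu) (is_derive_ln_comp dgu g0).
congr is_derive.
  by apply/funext => w; rewrite fctE exprfctE.
rewrite exprfctE /GRing.scale /= exprS; field; exact: n0.
Qed.

Section LogMoments.
Variables (R : realType) (J : finType) (c t : J -> R) (n : nat).
Hypothesis t0 : forall j, 0 <= t j.
Hypothesis moments : forall l, (l <= n)%N -> \sum_j c j * t j ^+ l = 0.

Lemma moments_shift_pow l m (e u : R) : (l + m <= n)%N ->
  \sum_j c j * t j ^+ l * (u * t j + e) ^+ m = 0.
Proof.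
move=> lmn.
under eq_bigr => j _ do rewrite addrC exprDn mulr_sumr.
rewrite exchange_big big1 // => i _ /=.
rewrite (eq_bigr (fun j => e ^+ (m - i) * u ^+ i *+ 'C(m, i) *
                           (c j * t j ^+ (l + i)))).
  rewrite -mulr_sumr moments ?mulr0 //; apply: leq_trans lmn.
  by rewrite leq_add2l -ltnS.
move=> j _; rewrite exprMn exprD; ring.
Qed.

Let A (m l : nat) (e u : R) :=
  \sum_j c j * t j ^+ l * ((u * t j + e) ^+ m * ln (u * t j + e)).

(** The parameter [u] interpolates between e (u = 0) and t_j + e (u = 1). At u = 0 the sum is a
    multiple of a vanishing moment; its derivative in [u] is m times the same sum with m lowered and
    l raised, up to a term killed by the moments. At m = 0 the derivative is a sum of c_j t_j^(l +
    1) / (u t_j + e), which is O(1 / e). *)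
Lemma log_moment_le m l : (m + l <= n)%N ->
  exists C, forall e u : R, 0 < e -> 0 <= u <= 1 -> `|A m l e u| <= C / e.
Proof.
have lin (e : R) j (u : R) : is_derive u 1 (fun u => u * t j + e) (t j).
  exact: is_derive_affine.
have gt_lin (e : R) j (u : R) : 0 < e -> 0 <= u -> 0 < u * t j + e.
  by move=> e0 u0; rewrite ltr_wpDl // mulr_ge0.
elim: m l => [|m IH] l mln.
  exists (\sum_j `|c j| * t j ^+ l.+1) => e u e0 u01.
  pose A' (u : R) := \sum_j c j * t j ^+ l * (t j / (u * t j + e)).
  have := @norm_le_powR_of_derive R (A 0 l e) A'
            ((\sum_j `|c j| * t j ^+ l.+1) / e) 0 1 (lexx _).
  rewrite add0r divr1 => /(_ _ _ _ u u01) H; apply: le_trans (H _ _ _) _.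
  - move=> v /andP[v0 v1]; apply: is_derive_sumr => j; apply: is_derive_cMr.
    have := is_derive_ln_comp (lin e j v) (gt_lin e j v e0 v0).
    by congr is_derive; apply/funext => w; rewrite expr0 mul1r.
  - rewrite -[RHS](mulr0 (ln e)) -[in RHS](@moments l) // mulr_sumr.
    apply: eq_bigr => j _; rewrite mul0r add0r expr0 mul1r mulrC //.
  - move=> v /andP[v0 v1]; rewrite powRr0 mulr1 /A' mulr_suml.
    apply: le_trans (ler_norm_sum _ _ _) _; apply: ler_sum => j _.
    rewrite !normrM (ger0_norm (t0 j)) normrX (ger0_norm (t0 j)).
    rewrite mulrA -[in leRHS]mulrA exprSr -!mulrA.
    do 3 (apply: ler_wpM2l; rewrite ?exprn_ge0 //).
    rewrite ger0_norm ?invr_ge0 ?(ltW (gt_lin _ _ _ e0 (ltW v0))) //.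
    rewrite lef_pV2 ?posrE //; last exact: gt_lin _ _ _ e0 (ltW v0).
    by rewrite lerDr mulr_ge0 // ltW.
  - move: u01 => /andP[u0 u1]; rewrite powRr1 // ler_piMr // divr_ge0 ?(ltW e0) //.
    by apply: sumr_ge0 => j _; rewrite mulr_ge0 ?exprn_ge0.
have [C HC] := IH l.+1 ltac:(by rewrite addnS -addSn).
exists (m.+1%:R * C) => e u e0 u01.
have ml0 v : \sum_j c j * t j ^+ l.+1 * (v * t j + e) ^+ m = 0.
  by apply: moments_shift_pow; rewrite addSn addnC -addSn.
have := @norm_le_powR_of_derive R (A m.+1 l e) (fun u => m.+1%:R * A m l.+1 e u)
          (m.+1%:R * C / e) 0 1 (lexx _).
rewrite add0r divr1 => /(_ _ _ _ u u01) H; apply: le_trans (H _ _ _) _.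
- move=> v /andP[v0 v1].
  have -> : m.+1%:R * A m l.+1 e v = \sum_j c j * t j ^+ l * (t j *
      (m.+1%:R * ((v * t j + e) ^+ m * ln (v * t j + e)) + (v * t j + e) ^+ m)).
    rewrite /A mulr_sumr -[LHS]addr0 -[X in _ + X = _](ml0 v) -big_split; apply: eq_bigr => j _ /=.
    rewrite !exprS; ring.
  apply: is_derive_sumr => j; apply: is_derive_cMr.
  exact: is_derive_pow_ln (lin e j v) (gt_lin e j v e0 v0).
- rewrite -[RHS](mulr0 (e ^+ m.+1 * ln e)) -[in RHS](@moments l); last first.
    by rewrite (leq_trans _ mln) // leq_addl.
  rewrite mulr_sumr.
  by apply: eq_bigr => j _; rewrite mul0r add0r mulrC.
- move=> v /andP[v0 v1]; rewrite powRr0 mulr1 normrM ger0_norm // -mulrA.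
  by apply: ler_wpM2l => //; apply: HC => //; rewrite v1 ltW.
- move: u01 => /andP[u0 u1]; rewrite powRr1 // ler_piMr // -mulrA mulr_ge0 //.
  by apply: le_trans (HC e 0 e0 _) => //; rewrite lexx ler01.
Qed.

Hypothesis inv_pos : forall e : R, 0 < e -> 0 <= \sum_j c j * (t j + e)^-1.

(* Up to the factor m, the derivative in eps of the m-th sum is the (m-1)-th one,
   and all of them vanish at infinity. *)
Lemma log_moment_shift_ge0 m (eps : R) : (m <= n)%N -> 0 < eps ->
  0 <= (-1) ^+ m.+1 * \sum_j c j * ((t j + eps) ^+ m * ln (t j + eps)).
Proof.
have lin j (e : R) : is_derive e 1 (fun e => t j + e) 1.
  have := is_derive_affine 1 (t j) e; congr is_derive; apply/funext => u.
  by rewrite mulr1 addrC.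
have gt_lin j (e : R) : 0 < e -> 0 < t j + e by move=> e0; rewrite ltr_wpDl.
have bnd k : (k <= n)%N -> exists C, forall e : R, 0 < e ->
    `|(-1) ^+ k.+1 * \sum_j c j * ((t j + e) ^+ k * ln (t j + e))| <= C / e.
  move=> kn; have [C HC] := @log_moment_le k 0 ltac:(by rewrite addn0).
  exists C => e0 e00; rewrite normrM normrX normrN1 expr1n mul1r.
  have := HC e0 1 e00; rewrite lexx ler01 => /(_ isT); rewrite /A.
  by under eq_bigr do rewrite expr0 mulr1 mul1r.
elim: m eps => [|m IH] e mn e0.
  have [C HC] := bnd 0%N mn.
  apply: (@nonincreasing_vanishing_ge0 R _
           (fun e => - \sum_j c j * (t j + e)^-1) C _ _ HC) => //; last first.
    by move=> u u0; rewrite oppr_le0; exact: inv_pos.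
  move=> u u0.
  have -> : - \sum_j c j * (t j + u)^-1 = (-1) ^+ 1 * \sum_j c j * (1 / (t j + u)).
    by rewrite expr1 mulN1r; under [in RHS]eq_bigr do rewrite mul1r.
  apply: is_derive_cMr.
  apply: is_derive_sumr => j; apply: is_derive_cMr.
  have := is_derive_ln_comp (lin j u) (gt_lin j u u0).
  by congr is_derive; apply/funext => w; rewrite expr0 mul1r.
have [C HC] := bnd m.+1 mn.
apply: (@nonincreasing_vanishing_ge0 R _
  (fun e => (-1) ^+ m.+2 * (m.+1%:R *
     \sum_j c j * ((t j + e) ^+ m * ln (t j + e)))) C _ _ HC) => //; last first.
  move=> u u0; rewrite exprS mulN1r mulNr oppr_le0 mulrCA mulr_ge0 //.
  by apply: IH => //; exact: ltnW.
move=> u u0; apply: is_derive_cMr.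
have -> : m.+1%:R * \sum_j c j * ((t j + u) ^+ m * ln (t j + u)) =
  \sum_j c j * (1 *
    (m.+1%:R * ((t j + u) ^+ m * ln (t j + u)) + (t j + u) ^+ m)).
  have := @moments_shift_pow 0 m u 1 ltac:(exact: ltnW).
  under eq_bigr do rewrite expr0 mulr1 mul1r.
  move=> m0; rewrite mulr_sumr -[LHS]addr0 -[X in _ + X = _]m0 -big_split.
  by apply: eq_bigr => j _ /=; ring.
apply: is_derive_sumr => j; apply: is_derive_cMr.
exact: is_derive_pow_ln (lin j u) (gt_lin j u u0).
Qed.

(** The shift is sent to 0. Care is needed only where t_j = 0, as on the diagonal pairs of a kernel:
    there e^n ln e tends to 0 because n > 0, in agreement with the value of the unshifted term. *)
Lemma log_moment_ge0 : (0 < n)%N ->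
  0 <= (-1) ^+ n.+1 * \sum_j c j * (t j ^+ n * ln (t j)).
Proof.
move=> n0.
have H : (-1) ^+ n.+1 * \sum_j c j * ((t j + e) ^+ n * ln (t j + e)) @[e --> 0^'+]
    --> (-1) ^+ n.+1 * \sum_j c j * (t j ^+ n * ln (t j)).
  apply: cvg_cMr; apply: cvg_sumr => j; apply: cvg_cMr.
  have := t0 j; rewrite le_eqVlt => /predU1P[<-|tj0].
    rewrite [X in _ --> X](_ : _ = 0); last by rewrite expr0n gtn_eqF // mul0r.
    have : e ^+ n.-1 * (e * ln e) @[e --> (0 : R)^'+] --> (0 ^+ n.-1 * 0 : R).
      apply: cvgM; last exact: xlnx_cvg0.
      by apply: cvg_at_right_filter; exact: exprn_continuous.
    rewrite mulr0; apply: cvg_trans; apply: near_eq_cvg; near=> e.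
    by rewrite add0r mulrA -exprSr prednK.
  have cl : (fun e => t j + e) e @[e --> (0:R)^'+] --> t j.
    rewrite -[X in _ --> X]addr0; apply: cvgD; first exact: cvg_cst.
    by apply: cvg_at_right_filter.
  apply: cvgM.
    by apply: (@cvg_comp _ _ _ (fun e => t j + e) (fun v => v ^+ n) _ _ _ cl);
      exact: exprn_continuous.
  by apply: (@cvg_comp _ _ _ (fun e => t j + e) (@ln R) _ _ _ cl);
    exact: continuous_ln.
apply: cvg_ge0 H; near=> e; apply: log_moment_shift_ge0 => //.
Unshelve. all: by end_near. Qed.

End LogMoments.

(** * Conditional positive definiteness of thin plate splines *)

Notation polyX R i := (mpoly.mpolyX R (mpoly.mnm1 i)).

Section Peval.
Variables (R : realType) (d : nat).
Implicit Types (p q : mpoly.mpoly d R) (x : 'rV[R]_d).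

Lemma pevalD p q x : peval (p + q) x = peval p x + peval q x.
Proof. exact: raddfD. Qed.

Lemma pevalM p q x : peval (p * q) x = peval p x * peval q x.
Proof. exact: rmorphM. Qed.

Lemma pevalC c x : peval (mpoly.mpolyC d c) x = c.
Proof. exact: mpoly.mevalC. Qed.

Lemma pevalX i x : peval (polyX R i) x = x 0 i.
Proof. exact: mpoly.mevalXU. Qed.

Lemma pevalZ c p x : peval (c *: p) x = c * peval p x.
Proof. exact: mpoly.mevalZ. Qed.

Lemma peval_sum (I : Type) (r : seq I) (P : pred I) (F : I -> mpoly.mpoly d R) x :
  peval (\sum_(i <- r | P i) F i) x = \sum_(i <- r | P i) peval (F i) x.
Proof. exact: raddf_sum. Qed.

Lemma pevalXn p m x : peval (p ^+ m) x = peval p x ^+ m.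
Proof. exact: rmorphXn. Qed.

Lemma Pi_leq (a b : nat) p : (a <= b)%N -> Pi a p -> Pi b p.
Proof. by move=> ab pa; exact: leq_trans ab. Qed.

Lemma PiD (m : nat) p q : Pi m p -> Pi m q -> Pi m (p + q).
Proof.
by move=> h1 h2; apply: leq_trans (mpoly.msizeD_le _ _) _; rewrite geq_max h1.
Qed.

Lemma PiZ (m : nat) c p : Pi m p -> Pi m (c *: p).
Proof. exact: leq_trans (mpoly.msizeZ_le _ _). Qed.

Lemma Pi_sum (m : nat) (I : Type) (r : seq I) (P : pred I) (F : I -> mpoly.mpoly d R) :
  (forall i, P i -> Pi m (F i)) -> Pi m (\sum_(i <- r | P i) F i).
Proof.
move=> H; elim/big_rec: _ => [|i p Pi_ IH]; first by rewrite /Pi /= mpoly.msize0.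
by apply: PiD => //; exact: H.
Qed.

Lemma Pi_polyX (i : 'I_d) : Pi 2 (polyX R i).
Proof. by rewrite /Pi /= mpoly.msizeX mpoly.mdeg1. Qed.

Lemma Pi_polyC (c : R) : Pi 1 (mpoly.mpolyC d c).
Proof. by rewrite /Pi /= mpoly.msizeC; case: eqP. Qed.

Lemma mpoly_scalerAr (c : R) p q : p * (c *: q) = c *: (p * q).
Proof. exact: esym (scalerAr _ _ _). Qed.

Lemma leq_predn (a b : nat) : (a <= b)%N -> (a.-1 <= b.-1)%N.
Proof. lia. Qed.

(** Predecessors of sizes give degrees, with degree 0 for the zero polynomial, so that no factor has
    to be nonzero. *)
Lemma msizeM_pred p q :
  ((mpoly.mmeasure mpoly.mdeg (p * q)).-1 <=
   (mpoly.mmeasure mpoly.mdeg p).-1 + (mpoly.mmeasure mpoly.mdeg q).-1)%N.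
Proof.
have [->|p0] := eqVneq p 0; first by rewrite mul0r mpoly.msize0.
have [->|q0] := eqVneq q 0; first by rewrite mulr0 mpoly.msize0.
rewrite mpoly.msizeM // (mpoly.mpolySpred _ p0) (mpoly.mpolySpred _ q0) /=.
by rewrite addnS.
Qed.

Lemma mderiv_polyX i j :
  mpoly.mderiv i (polyX R j) = mpoly.mpolyC d (i == j)%:R :> mpoly.mpoly d R.
Proof.
rewrite mpoly.mderivX mpoly.mnm1E eq_sym; case: eqP => [<-|_].
  have -> : mpoly.mnm_sub (mpoly.mnm1 i) (mpoly.mnm1 i) = @mpoly.mnm0 d.
    by apply/mpoly.mnmP => l; rewrite mpoly.mnmBE subnn mpoly.mnm0E.
  by rewrite mpoly.mpolyX0 scale1r -mpoly.mpolyC1.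
by rewrite scale0r -(mpoly.mpolyC0 d R).
Qed.

End Peval.

(* mmeasure mdeg is 1 plus the total degree, hence the predecessors. *)
Definition split_deg (R : realType) (d m : nat) (T : 'rV[R]_d -> 'rV[R]_d -> R) :=
  exists r : seq (mpoly.mpoly d R * mpoly.mpoly d R),
    (forall pq, pq \in r -> ((mpoly.mmeasure mpoly.mdeg pq.1).-1 +
                             (mpoly.mmeasure mpoly.mdeg pq.2).-1 <= m)%N) /\
    (forall x y, T x y = \sum_(pq <- r) peval pq.1 x * peval pq.2 y).

Section SplitDeg.
Variables (R : realType) (d : nat).
Implicit Types T : 'rV[R]_d -> 'rV[R]_d -> R.

Lemma split_degM m1 m2 T1 T2 : split_deg m1 T1 -> split_deg m2 T2 ->
  split_deg (m1 + m2) (fun x y => T1 x y * T2 x y).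
Proof.
move=> [r1 [h1 e1]] [r2 [h2 e2]].
exists [seq (u.1 * v.1, u.2 * v.2) | u <- r1, v <- r2]; split.
  move=> _ /allpairsP[[u v] /= [ur vr ->]] /=.
  apply: leq_trans (leq_add (msizeM_pred _ _) (msizeM_pred _ _)) _.
  by rewrite addnACA leq_add ?h1 ?h2.
move=> x y; rewrite e1 e2 big_allpairs_dep /= mulr_suml; apply: eq_bigr => u _.
rewrite mulr_sumr; apply: eq_bigr => v _; rewrite !pevalM; ring.
Qed.

Lemma split_deg_sqr_enorm : split_deg 2 (fun x y : 'rV[R]_d => enorm (x - y) ^+ 2).
Proof.
exists (flatten [seq [:: (polyX R i ^+ 2, 1); (-2 *: polyX R i, polyX R i);
                         (1, polyX R i ^+ 2)] | i <- enum 'I_d]).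
have sX i : (mpoly.mmeasure mpoly.mdeg (polyX R i)).-1 = 1%N.
  by rewrite mpoly.msizeX mpoly.mdeg1.
have sX2 i : ((mpoly.mmeasure mpoly.mdeg (polyX R i ^+ 2)).-1 <= 2)%N.
  by rewrite expr2; apply: leq_trans (msizeM_pred _ _) _; rewrite sX.
split.
  move=> pq /flattenP[s /mapP[i _ ->]]; rewrite !inE.
  case/or3P => /eqP -> /=.
  - by rewrite -mpoly.mpolyC1 mpoly.msizeC oner_eq0 addn0.
  - rewrite sX addn1 ltnS; apply: (@leq_predn _ 2).
    by apply: leq_trans (mpoly.msizeZ_le _ _) _; rewrite mpoly.msizeX mpoly.mdeg1.
  - by rewrite -mpoly.mpolyC1 mpoly.msizeC oner_eq0 add0n; exact: sX2.
move=> x y; rewrite sqr_enorm big_flatten /= big_map big_enum /=.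
apply: eq_bigr => i _; rewrite !big_cons big_nil /= !mxE.
rewrite pevalZ !pevalXn !pevalX -!mpoly.mpolyC1 !pevalC; ring.
Qed.

Lemma split_degX T l : split_deg 2 T -> split_deg (2 * l) (fun x y => T x y ^+ l).
Proof.
move=> sT; elim: l => [|l IH].
  exists [:: (1, 1)]; split.
    by move=> pq; rewrite inE => /eqP -> /=; rewrite -mpoly.mpolyC1 mpoly.msizeC oner_eq0.
  by move=> x y; rewrite big_seq1 /= -!mpoly.mpolyC1 !pevalC mulr1 expr0.
have := split_degM sT IH; rewrite -mulnS; congr split_deg.
by apply/funext => x; apply/funext => y; rewrite exprS.
Qed.

(** In a product p(x) q(y) of total degree at most 2l one of the factors has degree at most l, and
    the coefficients [b] annihilate it. Applied to the powers of |x - y|^2, this supplies the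
    vanishing moments. *)
Lemma split_deg_eq0 (I : finType) (b : I -> R) (y : I -> 'rV[R]_d) (l : nat) T :
  (forall q, Pi l.+1 q -> \sum_i b i * peval q (y i) = 0) ->
  split_deg (2 * l) T -> \sum_i \sum_j b i * b j * T (y i) (y j) = 0.
Proof.
move=> hb [r [hr eT]].
under eq_bigr do under eq_bigr do rewrite eT mulr_sumr.
under eq_bigr do rewrite exchange_big; rewrite exchange_big /=.
rewrite big_seq big1 // => -[p q] pqr /=.
transitivity ((\sum_i b i * peval p (y i)) * (\sum_j b j * peval q (y j))).
  rewrite mulr_suml; apply: eq_bigr => i _; rewrite mulr_sumr.
  by apply: eq_bigr => j _; ring.
have := hr _ pqr => /= H.
have [pl|pl] := leqP (mpoly.mmeasure mpoly.mdeg p) l.+1.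
  by rewrite hb ?mul0r.
rewrite [X in _ * X]hb ?mulr0 //.
have aux (u v : nat) : (u.-1 + v.-1 <= 2 * l)%N -> (l.+1 < u)%N -> (v <= l.+1)%N by lia.
exact: aux H pl.
Qed.

End SplitDeg.

Lemma sqrt_lnE (R : realType) (r : R) : 0 <= r -> ln (Num.sqrt r) = 2^-1 * ln r.
Proof. by move=> r0; rewrite -powR12_sqrt // ln_powR. Qed.

Lemma ln_enorm (R : realType) (d : nat) (x : 'rV[R]_d) :
  ln (enorm x) = 2^-1 * ln (enorm x ^+ 2).
Proof.
by rewrite {1}/enorm sqrt_lnE ?sqr_enorm // sumr_ge0 // => l _; exact: sqr_ge0.
Qed.

(** The moment argument is applied to the pairs of points, with coefficients b_i b_j at the squared
    distances t; the kernel is half of (-1)^(n + 1) t^n ln t. The points may coincide, hence the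
    weak inequality, which is all that the Cauchy-Schwarz inequality and the minimality of the
    weights require. *)
Lemma tps_cond_psd (R : realType) (d n : nat) (I : finType) (b : I -> R)
    (y : I -> 'rV[R]_d) : (0 < n)%N ->
  (forall q, Pi n.+1 q -> \sum_i b i * peval q (y i) = 0) ->
  0 <= \sum_i \sum_j b i * b j * tps n (y i - y j).
Proof.
move=> n0 hb.
pose c (ij : I * I) := b ij.1 * b ij.2.
pose t (ij : I * I) := enorm (y ij.1 - y ij.2) ^+ 2.
have := @log_moment_ge0 R (I * I)%type c t n _ _ _ n0.
have t0 j : 0 <= t j by exact: sqr_ge0.
move=> /(_ t0) H.
suff : 0 <= 2^-1 * ((-1) ^+ n.+1 * \sum_j c j * (t j ^+ n * ln (t j))).
  apply: ge0_eq; rewrite pair_bigA /= !mulr_sumr; apply: eq_bigr => -[i j] _ /=.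
  rewrite /c /t /tps /= exprM.
  rewrite ln_enorm; ring.
rewrite mulr_ge0 ?invr_ge0 //; apply: H.
- move=> l ln_; have := @split_deg_eq0 R d I b y l (fun x y => (enorm (x - y) ^+ 2) ^+ l).
  rewrite pair_bigA /=; apply.
    by move=> q ql; apply: hb; apply: Pi_leq ql.
  exact: split_degX (split_deg_sqr_enorm R d).
- move=> e e0; have := psd_inv_sqr_enorm y e0 b.
  by rewrite pair_bigA.
Qed.

(** * Iterated partial derivatives along lines *)

Section IteratedPartials.
Variables (R : realType) (d : nat).
Implicit Types (f : 'rV[R]_d -> R) (s : seq 'I_d) (x v z u : 'rV[R]_d).

(** Sequences of coordinates make one further derivative a [cons] and allow structural induction;
    [mnm_seq] translates multi-indices into them. *)
Definition ds s f : 'rV[R]_d -> R := foldr (@partial R d) f s.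

Definition mnm_seq (al : mpoly.multinom d) : seq 'I_d :=
  flatten [seq nseq (al i) i | i <- enum 'I_d].

Lemma ds_cat s1 s2 f : ds (s1 ++ s2) f = ds s1 (ds s2 f).
Proof. by rewrite /ds foldr_cat. Qed.

Lemma mpartialE al f : mpartial al f = ds (mnm_seq al) f.
Proof.
rewrite /mpartial /mnm_seq; elim: (enum _) => //= i l ->; rewrite ds_cat.
by elim: (al i) => //= m ->.
Qed.

Lemma size_mnm_seq al : size (mnm_seq al) = mpoly.mdeg al.
Proof.
rewrite size_flatten mpoly.mdegE sumnE /shape -map_comp big_map big_enum /=.
by apply: eq_bigr => i _; rewrite size_nseq.
Qed.

Lemma derive_line f x v l :
  is_derive (0 : R) 1 (fun t => f (t *: v + x)) l -> 'D_v f x = l.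
Proof.
case=> _ <-; rewrite /derive.
suff -> : (fun h : R => h^-1 *: ((f \o shift x) (h *: v) - f x)) =
  (fun h : R => h^-1 *: (((fun t : R => f (t *: v + x)) \o shift 0) (h *: 1) -
     f (0 *: v + x))) by [].
apply/funext => h /=; by rewrite scale0r add0r addr0 [h *: 1]mulr1.
Qed.

(* [G s] plays the role of the iterated partial derivative of [G [::]] along
   [s]; being differentiable along lines is all that is needed below. *)
Definition jet (r : nat) (G : seq 'I_d -> 'rV[R]_d -> R) : Prop :=
  (forall s s', perm_eq s s' -> G s = G s') /\
  (forall s x v, (size s < r)%N ->
     is_derive (0 : R) 1 (fun t => G s (t *: v + x)) (\sum_i v 0 i * G (i :: s) x)).

Lemma is_derive_jet r G s x v (t : R) : jet r G -> (size s < r)%N ->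
  is_derive t 1 (fun t => G s (t *: v + x)) (\sum_i v 0 i * G (i :: s) (t *: v + x)).
Proof.
move=> [_ dG] sr.
have d1 := dG s (t *: v + x) v sr.
have d2 := is_derive_affine 1 (- t) t.
have := @is_derive1_comp R (fun h => G s (h *: v + (t *: v + x)))
  (fun u : R => u * 1 - t) t (\sum_i v 0 i * G (i :: s) (t *: v + x)) 1.
rewrite mulr1 subrr mulr1 => /(_ d1 d2); congr is_derive.
by apply/funext => h /=; rewrite mulr1 addrA -scalerDl subrK.
Qed.

Lemma jet_continuous r G s x v (t : R) : jet r G -> (size s < r)%N ->
  {for t, continuous (fun t : R => G s (t *: v + x))}.
Proof. by move=> jG sr; exact: is_derive1_continuous (is_derive_jet x v t jG sr). Qed.

Lemma jet_ds r G s : jet r G -> (size s <= r)%N -> ds s (G [::]) = G s.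
Proof.
move=> [pG dG]; elim: s => //= i s IH sr.
rewrite -/(ds s _) IH; last exact: ltnW.
apply/funext => x; rewrite /partial (derive_line (dG s x (delta_mx 0 i) sr)).
rewrite (bigD1 i) //= mxE !eqxx mul1r big1 ?addr0 // => j /negbTE ji.
by rewrite mxE eqxx ji mul0r.
Qed.

Lemma jet_shift r G y : jet r G -> jet r (fun s x => G s (x - y)).
Proof.
move=> [pG dG]; split=> [s s' /pG -> //|s x v sr].
have := dG s (x - y) v sr; congr is_derive.
by apply/funext => t; rewrite addrA.
Qed.

Lemma jet_sum r (I : Type) (l : seq I) (b : I -> R) G :
  (forall i, jet r (G i)) -> jet r (fun s x => \sum_(i <- l) b i * G i s x).
Proof.
move=> jG; split=> [s s' ss'|s x v sr].
  apply/funext => x; apply: eq_bigr => i _; by rewrite ((jG i).1 _ _ ss').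
have -> : \sum_j v 0 j * (\sum_(i <- l) b i * G i (j :: s) x) =
  \sum_(i <- l) b i * (\sum_j v 0 j * G i (j :: s) x).
  under eq_bigr do rewrite mulr_sumr; rewrite exchange_big /=.
  apply: eq_bigr => i _; rewrite mulr_sumr; apply: eq_bigr => j _; ring.
apply: is_derive_sumr => i; apply: is_derive_cMr; exact: (jG i).2.
Qed.

Lemma jetD r G1 G2 : jet r G1 -> jet r G2 -> jet r (fun s x => G1 s x + G2 s x).
Proof.
move=> [p1 d1] [p2 d2]; split=> [s s' ss'|s x v sr].
  by rewrite (p1 _ _ ss') (p2 _ _ ss').
under eq_bigr do rewrite mulrDr.
by rewrite big_split; exact: is_deriveD (d1 s x v sr) (d2 s x v sr).
Qed.

Definition mds s (p : mpoly.mpoly d R) := foldr (fun i q => mpoly.mderiv i q) p s.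

Lemma is_derive_peval p0 x v : is_derive (0 : R) 1 (fun t => peval p0 (t *: v + x))
  (\sum_i v 0 i * peval (mpoly.mderiv i p0) x).
Proof.
pose P q := is_derive (0 : R) 1 (fun t => peval q (t *: v + x))
  (\sum_i v 0 i * peval (mpoly.mderiv i q) x).
have PC c : P (mpoly.mpolyC d c).
  rewrite /P big1 => [|i _]; last by rewrite mpoly.mderivC /peval mpoly.meval0 mulr0.
  rewrite (_ : (fun t => _) = cst c); first exact: is_derive_cst.
  by apply/funext => t; rewrite pevalC.
have PX i : P (polyX R i).
  rewrite /P (bigD1 i) //= big1 => [|j /negbTE ji]; last first.
    by rewrite mderiv_polyX ji pevalC mulr0.
  rewrite addr0 mderiv_polyX eqxx pevalC mulr1.
  have := is_derive_affine (v 0 i) (x 0 i) 0; congr is_derive.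
  by apply/funext => t; rewrite pevalX !mxE.
have PD p q : P p -> P q -> P (p + q).
  move=> hp hq; rewrite /P; under eq_fun do rewrite pevalD.
  under eq_bigr do rewrite mpoly.mderivD pevalD mulrDr.
  by rewrite big_split; exact: is_deriveD.
have PM p q : P p -> P q -> P (p * q).
  move=> hp hq; rewrite /P; under eq_fun do rewrite pevalM.
  apply: (is_derive_eq (is_deriveM hp hq)); rewrite scale0r add0r.
  rewrite /GRing.scale /= !mulr_sumr -big_split; apply: eq_bigr => i _.
  rewrite mpoly.mderivM pevalD !pevalM /=; ring.
have PE p m : P p -> P (p ^+ m).
  move=> hp; elim: m => [|m IH]; first by rewrite expr0 -mpoly.mpolyC1; exact: PC.
  by rewrite exprS; exact: PM.
rewrite -/(P p0) (mpoly.mpolyE p0); elim/big_rec: _ => [|m q _ hq].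
  by rewrite -(mpoly.mpolyC0 d R); exact: PC.
apply: PD => //; rewrite -mpoly.mul_mpolyC; apply: (PM); first exact: PC.
rewrite mpoly.mpolyXE_id; apply: (big_rec P) => [|i q' _ hq'].
  by rewrite -mpoly.mpolyC1; exact: PC.
by apply: PM => //; apply: PE.
Qed.

Lemma mds_perm s s' p : perm_eq s s' -> mds s p = mds s' p.
Proof. exact: mpoly.mderiv_perm. Qed.

Lemma jet_peval r p : jet r (fun s => peval (mds s p)).
Proof.
split=> [s s' /mds_perm -> //|s x v _]; exact: is_derive_peval.
Qed.

Lemma ds_peval s p : ds s (peval p) = peval (mds s p).
Proof. exact: jet_ds (jet_peval (size s) p) (leqnn _). Qed.

End IteratedPartials.

(** * Multivariate Taylor polynomials *)

Section Taylor.
Variables (R : realType) (d : nat).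
Implicit Types (s : seq 'I_d) (x v z u : 'rV[R]_d) (c : seq 'I_d -> R).

(* For c the values at a point of the iterated partials of f, this is the m-th
   derivative of f in the direction u at that point. *)
Fixpoint tay (m : nat) c u : R :=
  if m is m'.+1 then \sum_i u 0 i * tay m' (fun s => c (i :: s)) u else c [::].

Lemma eq_tay m c c' u : (forall s, size s = m -> c s = c' s) ->
  tay m c u = tay m c' u.
Proof.
elim: m c c' => [|m IH] c c' cc' /=; first exact: cc'.
by apply: eq_bigr => i _; congr (_ * _); apply: IH => s sm; apply: cc'; rewrite /= sm.
Qed.

Lemma tay_sum (I : Type) (r : seq I) (a : I -> R) (C : I -> seq 'I_d -> R) m u :
  tay m (fun s => \sum_(i <- r) a i * C i s) u = \sum_(i <- r) a i * tay m (C i) u.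
Proof.
elim: m C => [//|m IH] C /=.
under eq_bigr do rewrite IH mulr_sumr; rewrite exchange_big /=.
by apply: eq_bigr => i _; rewrite mulr_sumr; apply: eq_bigr => j _; ring.
Qed.

Lemma tayB m c c' u : tay m (fun s => c s - c' s) u = tay m c u - tay m c' u.
Proof.
elim: m c c' => [//|m IH] c c' /=; rewrite -sumrB; apply: eq_bigr => i _.
by rewrite IH mulrBr.
Qed.

Lemma tayZ m c (a : R) u : tay m c (a *: u) = a ^+ m * tay m c u.
Proof.
elim: m c => [|m IH] c /=; first by rewrite mul1r.
by rewrite mulr_sumr; apply: eq_bigr => i _; rewrite IH mxE exprS; ring.
Qed.

Lemma tay_eq0 m c u : (forall s, size s = m -> c s = 0) -> tay m c u = 0.
Proof.
elim: m c => [|m IH] c c0 /=; first exact: c0.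
by rewrite big1 // => i _; rewrite IH ?mulr0 // => s sm; apply: c0; rewrite /= sm.
Qed.

Lemma tay0 m c : (0 < m)%N -> tay m c 0 = 0.
Proof. by case: m => // m _ /=; rewrite big1 // => i _; rewrite mxE mul0r. Qed.

Lemma tay_norm_le m c u (M : R) : (forall s, size s = m -> `|c s| <= M) ->
  `|tay m c u| <= (\sum_i `|u 0 i|) ^+ m * M.
Proof.
elim: m c => [|m IH] c cM /=; first by rewrite mul1r cM.
apply: le_trans (ler_norm_sum _ _ _) _; rewrite exprS -mulrA mulr_suml.
apply: ler_sum => i _; rewrite normrM ler_wpM2l //; apply: IH => s sm.
by apply: cM; rewrite /= sm.
Qed.

Lemma is_derive_tay m (C : seq 'I_d -> R -> R) c' u (t : R) :
  (forall s, size s = m -> is_derive t 1 (C s) (c' s)) ->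
  is_derive t 1 (fun t => tay m (C^~ t) u) (tay m c' u).
Proof.
elim: m C c' => [|m IH] C c' dC /=; first exact: dC.
apply: is_derive_sumr => i; apply: is_derive_cMr.
by apply: (IH (fun s => C (i :: s))) => s sm; apply: dC; rewrite /= sm.
Qed.

Lemma is_derive_tay_jet r G m x u v (t : R) : jet r G -> (m < r)%N ->
  is_derive t 1 (fun t => tay m (fun s => G s (t *: v + x)) u)
    (\sum_i v 0 i * tay m (fun s => G (i :: s) (t *: v + x)) u).
Proof.
move=> jG mr; rewrite -tay_sum; apply: is_derive_tay => s sm.
by apply: is_derive_jet jG _; rewrite sm.
Qed.

Lemma is_derive_tay_line r G m x u (t : R) : jet r G -> (m < r)%N ->
  is_derive t 1 (fun t => tay m (fun s => G s (t *: u + x)) u)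
    (tay m.+1 (fun s => G s (t *: u + x)) u).
Proof. exact: is_derive_tay_jet. Qed.

Definition expsum (a : nat -> R) (q : nat) (t : R) : R :=
  \sum_(0 <= m < q) (m`!%:R)^-1 * a m * t ^+ m.

Lemma is_derive_expsum a q (t : R) :
  is_derive t 1 (expsum a q) (expsum (fun m => a m.+1) q.-1 t).
Proof.
case: q => [|q] /=.
  have -> : expsum a 0 = cst 0 by apply/funext => u; rewrite /expsum big_geq.
  by rewrite /expsum big_geq //; exact: is_derive_cst.
have -> : expsum (fun m => a m.+1) q t =
    \sum_(m <- index_iota 0 q.+1) (m`!%:R)^-1 * a m * (m%:R * t ^+ m.-1).
  rewrite big_nat_recl // mul0r mulr0 add0r; apply: eq_bigr => m _.
  rewrite factS natrM /=; have n0 : (m`!%:R : R) != 0 by rewrite pnatr_eq0 -lt0n fact_gt0.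
  have n1 : (m.+1%:R : R) != 0 by rewrite pnatr_eq0.
  by field; rewrite n0 addrC natr1 n1.
apply: is_derive_sumr => m; apply: is_derive_cMr.
have := is_deriveX m (is_derive_id t (1 : R)); rewrite [_ *: 1]mulr1.
by congr is_derive; apply/funext => w; rewrite exprfctE.
Qed.

Lemma expsum0 a q : (0 < q)%N -> expsum a q 0 = a 0%N.
Proof.
case: q => // q _; rewrite /expsum big_nat_recl // expr0 mulr1 fact0 invr1 mul1r.
by rewrite big1 ?addr0 // => i _; rewrite exprS mul0r mulr0.
Qed.

Lemma is_derive_expsum_shift a q j (t : R) :
  is_derive t 1 (expsum (fun m => a (m + j)%N) (q - j))
                (expsum (fun m => a (m + j.+1)%N) (q - j.+1) t).
Proof.
have := is_derive_expsum (fun m => a (m + j)%N) (q - j) t.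
rewrite subnS; congr is_derive; congr expsum; apply/funext => m.
by rewrite addSnnS.
Qed.

Fixpoint taym (m : nat) c z : mpoly.mpoly d R :=
  if m is m'.+1 then
    \sum_i (polyX R i - mpoly.mpolyC d (z 0 i)) * taym m' (fun s => c (i :: s)) z
  else mpoly.mpolyC d (c [::]).

Lemma peval_taym m c z x : peval (taym m c z) x = tay m c (x - z).
Proof.
elim: m c => [|m IH] c /=; first exact: pevalC.
rewrite peval_sum; apply: eq_bigr => i _; rewrite pevalM IH; congr (_ * _).
by rewrite !mxE -mulN1r -mpoly.mpolyC1 -mpoly.mpolyCN -mpoly.mpolyCM pevalD pevalX pevalC mulN1r.
Qed.

Lemma Pi_taym m c z : Pi m.+1 (taym m c z).
Proof.
elim: m c => [|m IH] c /=; first exact: Pi_polyC.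
apply: Pi_sum => i _.
have H : Pi 2 (polyX R i - mpoly.mpolyC d (z 0 i)).
  apply: PiD; first exact: Pi_polyX.
  by rewrite -mpoly.mpolyCN; apply: Pi_leq (Pi_polyC _ _).
move: H (IH (fun s => c (i :: s))); rewrite /Pi /=.
set p := (_ - _); set q := taym _ _ _ => p2 qm.
have := msizeM_pred p q => H.
have aux (a b e : nat) : (a <= b.-1 + e.-1)%N -> (b <= 2)%N -> (e <= m.+1)%N ->
  (a <= m.+1)%N by lia.
have := aux _ _ _ H p2 qm.
by case: (mpoly.mmeasure _ (p * q)).
Qed.

(** The derivative may hit any of the m linear factors; the symmetry of [c] moves the index of that
    factor to the front, so all m contributions are equal. *)
Lemma mderiv_taym m c z j : (forall s s', perm_eq s s' -> c s = c s') ->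
  mpoly.mderiv j (taym m c z) = m%:R *: taym m.-1 (fun s => c (j :: s)) z.
Proof.
move=> pc; case: m => [|m]; first by rewrite scale0r /= mpoly.mderivC.
elim: m c pc => [|m IH] c pc.
  rewrite /= raddf_sum (bigD1 j) //= big1 => [|i /negbTE ij]; last first.
    rewrite mpoly.mderivM mpoly.mderivB !mpoly.mderivC mderiv_polyX eq_sym ij.
    by rewrite mpoly.mpolyC0 subr0 mul0r mulr0 addr0.
  rewrite mpoly.mderivM mpoly.mderivB !mpoly.mderivC mderiv_polyX eqxx.
  by rewrite scale1r mpoly.mpolyC1 subr0 mul1r mulr0 !addr0.
have pci i : forall s s', perm_eq s s' -> c (i :: s) = c (i :: s').
  by move=> s s' ss'; apply: pc; rewrite perm_cons.
rewrite [taym m.+2 _ _]/= raddf_sum /=.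
have E i : mpoly.mderiv j ((polyX R i - mpoly.mpolyC d (z 0 i)) *
     taym m.+1 (fun s => c (i :: s)) z) =
  (i == j)%:R *: taym m.+1 (fun s => c (i :: s)) z +
  m.+1%:R *: ((polyX R i - mpoly.mpolyC d (z 0 i)) *
     taym m (fun s => c (i :: j :: s)) z).
  rewrite mpoly.mderivM mpoly.mderivB mpoly.mderivC subr0; congr (_ + _).
    rewrite mderiv_polyX eq_sym; case: eqP => [->|_].
      by rewrite scale1r mpoly.mpolyC1 mul1r.
    by rewrite scale0r mpoly.mpolyC0 mul0r.
  rewrite IH; last exact: pci.
  exact: mpoly_scalerAr.
transitivity (\sum_i ((i == j)%:R *: taym m.+1 (fun s => c (i :: s)) z +
  m.+1%:R *: ((polyX R i - mpoly.mpolyC d (z 0 i)) *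
     taym m (fun s => c (i :: j :: s)) z))).
  by apply: eq_bigr => i _; exact: E.
have sumT (T : 'I_d -> mpoly.mpoly d R) : \sum_i (i == j)%:R *: T i = T j.
  rewrite (bigD1 j) //= eqxx scale1r big1 ?addr0 // => i /negbTE ->.
  by rewrite scale0r.
transitivity (taym m.+1 (fun s => c (j :: s)) z +
  m.+1%:R *: (\sum_i (polyX R i - mpoly.mpolyC d (z 0 i)) *
     taym m (fun s => c (i :: j :: s)) z)).
  rewrite big_split; congr (_ + _).
    exact: (sumT (fun i => taym m.+1 (fun s => c (i :: s)) z)).
  by rewrite scaler_sumr.
have tE : taym m.+1 (fun s => c (j :: s)) z = \sum_i
   (polyX R i - mpoly.mpolyC d (z 0 i)) * taym m (fun s => c (i :: j :: s)) z.
  rewrite /=; apply: eq_bigr => i _; congr (_ * taym _ _ _); apply/funext => s.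
  by apply: pc; rewrite -[i :: j :: s]/([:: i; j] ++ s) -[j :: i :: s]/([:: j; i] ++ s)
     perm_cat2r -perm_rcons.
rewrite -[RHS]/(m.+2%:R *: taym m.+1 (fun s => c (j :: s)) z) tE.
by rewrite -[m.+2]add1n natrD scalerDl scale1r.
Qed.

Lemma mds_taym m c z s : (forall s s', perm_eq s s' -> c s = c s') ->
  mds s (taym m c z) =
  (m ^_ (size s))%:R *: taym (m - size s) (fun l => c (s ++ l)) z.
Proof.
move=> pc; elim: s => [|i s IH]; first by rewrite scale1r subn0.
rewrite /= -/(mds s _) IH mpoly.mderivZ mderiv_taym; last first.
  by move=> l l' ll'; apply: pc; rewrite perm_cat2l.
rewrite scalerA -natrM -ffactnSr subnS; congr (_ *: taym _ _ _).
apply/funext => l; apply: pc; apply/permPl; exact: (perm_catCA s [:: i] l).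
Qed.

Definition taylor (q : nat) c z : mpoly.mpoly d R :=
  \sum_(0 <= m < q) (m`!%:R)^-1 *: taym m c z.

Lemma Pi_taylor q c z : Pi q (taylor q c z).
Proof.
rewrite /taylor big_nat; apply: Pi_sum => m /andP[_ mq].
by apply: PiZ; apply: Pi_leq (Pi_taym _ _ _).
Qed.

Lemma peval_taylor q c z u (t : R) :
  peval (taylor q c z) (t *: u + z) = expsum (fun m => tay m c u) q t.
Proof.
rewrite peval_sum; apply: eq_bigr => m _.
by rewrite pevalZ peval_taym addrK tayZ -mulrA [tay _ _ _ * _]mulrC.
Qed.

Lemma mds_sum s (I : Type) (r : seq I) (F : I -> mpoly.mpoly d R) :
  mds s (\sum_(i <- r) F i) = \sum_(i <- r) mds s (F i).
Proof. by elim: s => //= i s ->; rewrite raddf_sum. Qed.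

Lemma mdsZ s (a : R) (p : mpoly.mpoly d R) : mds s (a *: p) = a *: mds s p.
Proof. by elim: s => //= i s ->; rewrite mpoly.mderivZ. Qed.

Lemma peval_mds_taym m c z s : (forall s s', perm_eq s s' -> c s = c s') ->
  peval (mds s (taym m c z)) z = if m == size s then m`!%:R * c s else 0.
Proof.
move=> pc; rewrite mds_taym // pevalZ peval_taym subrr.
case: eqP => [->|/eqP ms]; first by rewrite subnn ffactnn /= cats0.
have [sm|ms'] := ltnP m (size s); first by rewrite ffact_small // mul0r.
by rewrite tay0 ?mulr0 // subn_gt0 ltn_neqAle eq_sym ms.
Qed.

Lemma peval_mds_taylor q c z s : (forall s s', perm_eq s s' -> c s = c s') ->
  (size s < q)%N -> peval (mds s (taylor q c z)) z = c s.
Proof.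
move=> pc sq; rewrite /taylor mds_sum peval_sum (bigD1_seq (size s)) //=; last 2 first.
- by rewrite mem_index_iota.
- exact: iota_uniq.
rewrite mdsZ pevalZ peval_mds_taym // eqxx mulrA mulVf ?mul1r; last first.
  by rewrite pnatr_eq0 -lt0n fact_gt0.
rewrite big1 ?addr0 // => i /negbTE is_; rewrite mdsZ pevalZ peval_mds_taym //.
by rewrite is_ mulr0.
Qed.

(** Two lengths are kept apart: q derivatives are integrated, whereas the Taylor polynomial has q'
    terms. The choice q' = q shows that Taylor's formula is exact on polynomials, and q' = q + 1
    gives the Peano form. *)
Lemma taylor_jet_le r G q q' x u (M dl : R) : jet r G -> (q <= r)%N -> (q <= q')%N ->
  (forall t, 0 <= t <= dl -> `|tay q (fun s => G s (t *: u + x)) u -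
     expsum (fun m => tay (m + q) (G^~ x) u) (q' - q) t| <= M) ->
  forall t, 0 <= t <= dl ->
  `|G [::] (t *: u + x) - peval (taylor q' (G^~ x) x) (t *: u + x)| <= M * t ^+ q.
Proof.
move=> jG qr qq' HM t tdl.
pose a m := tay m (G^~ x) u.
pose F j (t : R) := tay j (fun s => G s (t *: u + x)) u -
  expsum (fun m => a (m + j)%N) (q' - j) t.
have -> : G [::] (t *: u + x) - peval (taylor q' (G^~ x) x) (t *: u + x) = F 0%N t.
  rewrite /F peval_taylor subn0; congr (_ - expsum _ _ _).
  by apply/funext => m; rewrite addn0.
apply: le_trans (@taylor_remainder_le R q F M 0 dl (lexx _) _ _ _ t tdl) _.
- move=> j w jq wdl; apply: is_deriveB; last exact: is_derive_expsum_shift.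
  by apply: is_derive_tay_line jG _; exact: leq_trans qr.
- move=> j jq; rewrite /F expsum0 ?subn_gt0 ?(leq_trans jq) // add0n /a.
  by apply/eqP; rewrite subr_eq0; apply/eqP/eq_tay => s _; rewrite scale0r add0r.
- by move=> w wdl; rewrite powRr0 mulr1; exact: HM.
move: tdl => /andP[t0 tdl].
have M0 : 0 <= M.
  by apply: le_trans (HM 0 _); rewrite ?normr_ge0 // lexx (le_trans t0).
rewrite add0r powR_mulrn // ler_wpM2r ?exprn_ge0 //.
have -> : \prod_(1 <= i < q.+1) (0 + i%:R) = q`!%:R :> R.
  by rewrite fact_prod natr_prod; apply: eq_bigr => i _; rewrite add0r.
rewrite ler_pdivrMr ?ltr0n ?fact_gt0 // ler_peMr // ler1n fact_gt0 //.
Qed.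

(** After q derivatives the remainder is the increment of the q-th derivative along the line, which
    is small near 0 by continuity. *)
Lemma taylor_peano r G q x u (e : R) : jet r G -> (q < r)%N -> 0 < e ->
  \forall t \near 0^'+,
  `|G [::] (t *: u + x) - peval (taylor q.+1 (G^~ x) x) (t *: u + x)| <= e * t ^+ q.
Proof.
move=> jG qr e0.
have := is_derive1_continuous (is_derive_tay_line x u 0 jG qr).
move=> /cvgrPdist_le /(_ e e0) [dl /= dl0 H].
near=> t.
have t0 : 0 < t by near: t; exact: nbhs_right_gt.
have tdl : t < dl by near: t; exact: nbhs_right_lt.
apply: (taylor_jet_le jG (ltnW qr) (leqnSn q) (dl := t)).
  move=> w /andP[w0 wt].
  rewrite subSnn /expsum big_nat1 fact0 invr1 mul1r expr0 mulr1 add0n distrC.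
  have := H w; rewrite scale0r add0r; apply.
  by rewrite /= sub0r normrN ger0_norm // (le_lt_trans wt).
by rewrite lexx ltW.
Unshelve. all: by end_near. Qed.

Lemma Pi_mderiv (m : nat) i (p : mpoly.mpoly d R) :
  Pi m.+1 p -> Pi m (mpoly.mderiv i p).
Proof.
rewrite /Pi /= => pm; rewrite mpoly.msizeE; apply/bigmax_leqP_seq => l + _.
rewrite mpoly.mcoeff_msupp mpoly.mcoeff_mderiv => nz.
have : mpoly.mnm_add l (mpoly.mnm1 i) \in mpoly.msupp p.
  by rewrite mpoly.mcoeff_msupp; apply: contraNneq nz => ->; rewrite mul0rn.
by move/mpoly.msize_mdeg_lt; rewrite mpoly.mdegD mpoly.mdeg1 addn1 => /leq_trans/(_ pm).
Qed.

Lemma mds_Pi_eq0 s (p : mpoly.mpoly d R) : Pi (size s) p -> mds s p = 0.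
Proof.
elim/last_ind: s p => [|s i IH] p; rewrite /Pi /=.
  by rewrite leqn0 mpoly.msize_poly_eq0 => /eqP.
rewrite size_rcons => ps; rewrite /mds -cats1 foldr_cat.
by apply: IH; exact: Pi_mderiv.
Qed.

Lemma taylor_exact q (p : mpoly.mpoly d R) z x : Pi q p ->
  peval p x = peval (taylor q (fun s => peval (mds s p) z) z) x.
Proof.
move=> pq; apply/eqP; rewrite -subr_eq0 -normr_le0.
have := @taylor_jet_le q (fun s => peval (mds s p)) q q z (x - z) 0 1
  (jet_peval q p) (leqnn _) (leqnn _) _ 1.
rewrite scale1r subrK mul0r; apply; last by rewrite ler01 lexx.
move=> t _; rewrite subnn /expsum big_geq // subr0 tay_eq0 ?normr0 //.
by move=> s sq; rewrite mds_Pi_eq0 ?sq // /peval mpoly.meval0.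
Qed.

End Taylor.

(** * Finite difference stencils *)

Section Grid.
Variables (R : realType) (d q : nat).
Implicit Types (p : mpoly.mpoly d R) (x : 'rV[R]_d).

Definition grid_pt (g : {ffun 'I_d -> 'I_q}) : 'rV[R]_d := \row_i (g i)%:R.

Let lag (c : 'I_q) : {poly R} := tnth (lagrange q (fun k => k%:R : R)) c.

Definition grid_poly (g : {ffun 'I_d -> 'I_q}) : mpoly.mpoly d R :=
  \prod_i (\sum_(k < size (lag (g i))) (lag (g i))`_k *: polyX R i ^+ k).

Lemma peval_prod (I : Type) (r : seq I) (F : I -> mpoly.mpoly d R) x :
  peval (\prod_(i <- r) F i) x = \prod_(i <- r) peval (F i) x.
Proof. exact: rmorph_prod. Qed.

Lemma peval_grid_poly g x : peval (grid_poly g) x = \prod_i (lag (g i)).[x 0 i].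
Proof.
rewrite peval_prod; apply: eq_bigr => i _; rewrite horner_coef peval_sum.
by apply: eq_bigr => k _; rewrite pevalZ pevalXn pevalX.
Qed.

Lemma lagrange_monomial (m : nat) (t : R) : (m < q)%N ->
  t ^+ m = \sum_(c < q) (c%:R : R) ^+ m * (lag c).[t].
Proof.
move=> mq; have q0 : (0 < q)%N by apply: leq_ltn_trans mq.
have inj : injective (fun k : nat => k%:R : R).
  by move=> i j /eqP; rewrite eqr_nat => /eqP.
have := @lagrange_gen R q (fun k => k%:R : R) q0 inj 'X^m.
rewrite size_polyXn => /(_ mq) /(congr1 (fun p : {poly R} => p.[t])).
rewrite hornerXn => ->; rewrite horner_sum; apply: eq_bigr => c _.
by rewrite hornerM hornerC hornerXn.
Qed.

(** Interpolation in one variable reproduces the powers below q; multiplying over the coordinates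
    reproduces every monomial with all exponents below q, in particular those of [Pi q]. *)
Lemma grid_exact p x : Pi q p ->
  peval p x = \sum_g peval p (grid_pt g) * peval (grid_poly g) x.
Proof.
move=> pq.
have E y : peval p y =
    \sum_(m <- mpoly.msupp p) mpoly.mcoeff m p * \prod_i y 0 i ^+ m i.
  exact: mpoly.mevalE.
under [in RHS]eq_bigr do rewrite E mulr_suml.
rewrite exchange_big E /= big_seq [in RHS]big_seq; apply: eq_bigr => m mp.
under [in RHS]eq_bigr do rewrite -mulrA; rewrite -mulr_sumr; congr (_ * _).
have mq i : (m i < q)%N.
  apply: leq_trans pq; apply: leq_ltn_trans (mpoly.msize_mdeg_lt mp).
  by rewrite mpoly.mdegE (bigD1 i) //= leq_addr.
under eq_bigr => i _ do rewrite (lagrange_monomial (x 0 i) (mq i)).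
rewrite bigA_distr_bigA /=; apply: eq_bigr => g _.
by rewrite peval_grid_poly -big_split /=; apply: eq_bigr => i _; rewrite mxE.
Qed.

Lemma grid_exact_mds p s x : Pi q p ->
  peval (mds s p) x = \sum_g peval p (grid_pt g) * peval (mds s (grid_poly g)) x.
Proof.
move=> pq.
(* The two polynomials are only known to agree as functions; [ds_peval] transfers this to their
   derivatives. *)
have : peval p = peval (\sum_g peval p (grid_pt g) *: grid_poly g).
  apply/funext => y; rewrite (grid_exact y pq) peval_sum.
  by apply: eq_bigr => g _; rewrite pevalZ.
move=> /(congr1 (fun f => ds s f x)); rewrite !ds_peval => ->.
by rewrite mds_sum peval_sum; apply: eq_bigr => g _; rewrite mdsZ pevalZ.
Qed.

End Grid.

Section Stencil.
Variables (R : realType) (d q k : nat) (J : finType) (a : J -> R)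
  (sq : J -> seq 'I_d) (z : 'rV[R]_d).
Hypothesis sqk : forall j, (size (sq j) <= k)%N.
Hypothesis kq : (k < q)%N.
Implicit Types (t : R).

Definition stencil_pt (t : R) (g : {ffun 'I_d -> 'I_q}) : 'rV[R]_d := t *: grid_pt R g + z.

(** The differential expression is applied at 0 to the grid interpolant of u |-> f (t u + z); the
    chain rule accounts for the negative powers of t. *)
Definition stencil_wt (t : R) (g : {ffun 'I_d -> 'I_q}) : R :=
  \sum_j a j * t ^- size (sq j) * peval (mds (sq j) (grid_poly R g)) 0.

Lemma stencil_exact t p : t != 0 -> Pi q p ->
  \sum_g stencil_wt t g * peval p (stencil_pt t g) =
  \sum_j a j * peval (mds (sq j) p) z.
Proof.
move=> t0 pq; pose c s := peval (mds s p) z.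
have pc s s' : perm_eq s s' -> c s = c s' by move=> /mds_perm; rewrite /c => ->.
under eq_bigr => g _.
  rewrite /stencil_pt (taylor_exact z _ pq) peval_taylor -/c mulr_suml.
  over.
rewrite exchange_big; apply: eq_bigr => j _ /=.
under eq_bigr do rewrite mulr_sumr.
rewrite exchange_big /=.
transitivity (\sum_(0 <= m < q) a j * t ^- size (sq j) * t ^+ m * (m`!%:R)^-1 *
    (if m == size (sq j) then m`!%:R * c (sq j) else 0)).
  rewrite big_nat [in RHS]big_nat; apply: eq_bigr => m /andP[_ mq].
  rewrite -(@peval_mds_taym R d m c 0 (sq j) pc).
  rewrite (grid_exact_mds _ _ (Pi_leq mq (Pi_taym m c 0))) mulr_sumr.
  by apply: eq_bigr => g _; rewrite peval_taym subr0; ring.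
rewrite (bigD1_seq (size (sq j))) ?iota_uniq //=; last first.
  by rewrite mem_index_iota /= (leq_ltn_trans _ kq).
rewrite eqxx big1 ?addr0 => [|i /negbTE ->]; last by rewrite mulr0.
have n0 : ((size (sq j))`!%:R : R) != 0 by rewrite pnatr_eq0 -lt0n fact_gt0.
rewrite -[a j * _ * _]mulrA mulVf ?expf_neq0 // mulr1 -mulrA mulKf //.
Qed.

Lemma stencil_wt_le : exists C, forall t g, 0 < t <= 1 ->
  `|stencil_wt t g| <= C * t ^- k.
Proof.
pose C (g : {ffun 'I_d -> 'I_q}) : R := \sum_j `|a j| * `|peval (mds (sq j) (grid_poly R g)) 0|.
have C0 g : 0 <= C g by apply: sumr_ge0 => j _; rewrite mulr_ge0.
exists (\sum_g C g) => t g /andP[t0 t1].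
apply: (@le_trans _ _ (C g * t ^- k)); last first.
  rewrite ler_wpM2r ?invr_ge0 ?exprn_ge0 ?(ltW t0) //.
  by rewrite (bigD1 g) //= lerDl sumr_ge0.
rewrite mulr_suml; apply: le_trans (ler_norm_sum _ _ _) _; apply: ler_sum => j _.
rewrite !normrM mulrAC ler_wpM2l ?mulr_ge0 //.
rewrite ger0_norm ?invr_ge0 ?exprn_ge0 ?(ltW t0) //.
by rewrite lef_pV2 ?posrE ?exprn_gt0 // ler_wiXn2l // ltW.
Qed.

(** The stencil is exact on the Taylor polynomial of degree k, and the remainder, which is o(t^k) at
    the stencil points, meets weights of size O(t^-k). *)
Lemma stencil_cvg r G : (k < r)%N -> jet r G ->
  \sum_g stencil_wt t g * G [::] (stencil_pt t g) @[t --> 0^'+] -->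
  \sum_j a j * G (sq j) z.
Proof.
move=> kr jG; pose T := taylor k.+1 (G^~ z) z.
have TE j : peval (mds (sq j) T) z = G (sq j) z.
  rewrite peval_mds_taylor //; last by rewrite ltnS.
  by move=> s s' ss'; rewrite (jG.1 _ _ ss').
have -> : \sum_j a j * G (sq j) z =
    \sum_j a j * peval (mds (sq j) T) z + \sum_(g : {ffun 'I_d -> 'I_q}) 0.
  by rewrite big1_eq addr0; apply: eq_bigr => j _; rewrite TE.
have H : \sum_j a j * peval (mds (sq j) T) z +
    \sum_g stencil_wt t g * (G [::] (stencil_pt t g) - peval T (stencil_pt t g))
    @[t --> 0^'+] -->
    \sum_j a j * peval (mds (sq j) T) z + \sum_(g : {ffun 'I_d -> 'I_q}) 0.
  apply: cvgD; first exact: cvg_cst.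
  apply: cvg_sumr => g; have [C HC] := stencil_wt_le.
  apply/cvgrPdist_le => e e0.
  pose e' := e / (`|C| + 1).
  have C1 : 0 < `|C| + 1 by rewrite ltr_wpDl.
  have e'0 : 0 < e' by rewrite divr_gt0.
  have P := taylor_peano z (grid_pt R g) jG kr e'0.
  near=> t; rewrite sub0r normrN normrM.
  have t0 : 0 < t by near: t; exact: nbhs_right_gt.
  have t1 : t <= 1 by near: t; exact: nbhs_right_le.
  have Pt : `|G [::] (stencil_pt t g) - peval T (stencil_pt t g)| <= e' * t ^+ k.
    by near: t.
  have Ct : `|stencil_wt t g| <= (`|C| + 1) * t ^- k.
    apply: le_trans (HC t g _) _; first by rewrite t0.
    rewrite ler_wpM2r ?invr_ge0 ?exprn_ge0 ?(ltW t0) //.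
    by rewrite (le_trans (ler_norm C)) // lerDl.
  apply: le_trans (ler_pM _ _ Ct Pt) _ => //.
  rewrite mulrACA mulVf ?expf_neq0 ?gt_eqF // mulr1 /e' mulrC divfK ?gt_eqF //.
apply: cvg_trans H; apply: near_eq_cvg; near=> t.
have t0 : t != 0 by rewrite gt_eqF //; near: t; exact: nbhs_right_gt.
rewrite -(stencil_exact t0); last exact: Pi_leq kq (Pi_taylor _ _ _).
by rewrite -big_split; apply: eq_bigr => g _ /=; ring.
Unshelve. all: by end_near. Qed.

(* D applied to both arguments of the kernel gives 0 at (z, z), since all the
   partial derivatives involved vanish at 0. *)
Lemma stencil_double_cvg r G : (2 * k < r)%N -> jet r G ->
  (forall s, (size s <= 2 * k)%N -> G s 0 = 0) ->
  \sum_g \sum_g' stencil_wt t g * stencil_wt t g' *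
    G [::] (stencil_pt t g - stencil_pt t g') @[t --> 0^'+] --> (0 : R).
Proof.
move=> kr jG G0.
rewrite [X in _ --> X](_ : 0 =
    \sum_(g : {ffun 'I_d -> 'I_q}) \sum_(g' : {ffun 'I_d -> 'I_q}) (0 : R)); last first.
  by rewrite big1 // => g _; rewrite big1_eq.
apply: cvg_sumr => g; apply: cvg_sumr => g'; have [C HC] := stencil_wt_le.
apply/cvgrPdist_le => e e0.
pose e' := e / (`|C| + 1) ^+ 2.
have C1 : 0 < `|C| + 1 by rewrite ltr_wpDl.
have e'0 : 0 < e' by rewrite divr_gt0 // exprn_gt0.
have P := taylor_peano 0 (grid_pt R g - grid_pt R g') jG kr e'0.
near=> t; rewrite sub0r normrN !normrM.
have t0 : 0 < t by near: t; exact: nbhs_right_gt.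
have t1 : t <= 1 by near: t; exact: nbhs_right_le.
have Pt : `|G [::] (stencil_pt t g - stencil_pt t g')| <= e' * t ^+ (2 * k).
  have -> : stencil_pt t g - stencil_pt t g' = t *: (grid_pt R g - grid_pt R g') + 0.
    by rewrite /stencil_pt addr0 scalerBr opprD addrACA subrr addr0.
  have -> : G [::] (t *: (grid_pt R g - grid_pt R g') + 0) =
    G [::] (t *: (grid_pt R g - grid_pt R g') + 0) -
    peval (taylor (2 * k).+1 (G^~ 0) 0) (t *: (grid_pt R g - grid_pt R g') + 0).
    rewrite peval_taylor /expsum big_nat big1 ?subr0 // => m /andP[_ mk].
    by rewrite tay_eq0 ?mulr0 ?mul0r // => s sm; rewrite G0 // sm -ltnS.
  by near: t.
have Ct g1 : `|stencil_wt t g1| <= (`|C| + 1) * t ^- k.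
  apply: le_trans (HC t g1 _) _; first by rewrite t0.
  rewrite ler_wpM2r ?invr_ge0 ?exprn_ge0 ?(ltW t0) //.
  by rewrite (le_trans (ler_norm C)) // lerDl.
apply: le_trans (ler_pM _ _ (ler_pM _ _ (Ct g) (Ct g')) Pt) _ => //.
have n0 : t ^+ k != 0 by rewrite expf_neq0 // gt_eqF.
have n1 : `|C| + 1 != 0 by rewrite gt_eqF.
rewrite /e' mul2n -addnn exprD le_eqVlt; apply/orP; left; apply/eqP.
by field; rewrite n0 n1.
Unshelve. all: by end_near. Qed.

End Stencil.

(** * The quadratic form of a differentiation formula *)

Lemma enormN (R : realType) d (x : 'rV[R]_d) : enorm (- x) = enorm x.
Proof. by rewrite /enorm; under eq_bigr do rewrite mxE sqrrN. Qed.

Lemma tpsN (R : realType) d n (x : 'rV[R]_d) : tps n (- x) = tps n x.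
Proof. by rewrite /tps enormN. Qed.

(** No sign is assumed on [B], because it will be [jet_form], whose sign is not known in advance.
    For B <= 0 the choice r = - (A + 1) / (2 L) forces L = 0, and B < 0 is then absurd for large
    r. *)
Lemma discriminant_le (R : realType) (A L B : R) :
  (forall r, 0 <= A + 2 * r * L + r ^+ 2 * B) -> L ^+ 2 <= A * B.
Proof.
move=> H; have A0 : 0 <= A by have := H 0; rewrite mulr0 mul0r expr0n mul0r !addr0.
have [B0|B0] := ltP 0 B.
  have := H (- L / B); have n0 : B != 0 by rewrite gt_eqF.
  have -> : A + 2 * (- L / B) * L + (- L / B) ^+ 2 * B = (A * B - L ^+ 2) / B.
    by field.
  by rewrite pmulr_lge0 ?invr_gt0 // subr_ge0.
have L0 : L = 0.
  apply/eqP/negPn/negP => Ln.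
  have := H (- (A + 1) / (2 * L)).
  have -> : 2 * (- (A + 1) / (2 * L)) * L = - (A + 1) by field.
  have : (- (A + 1) / (2 * L)) ^+ 2 * B <= 0 by rewrite mulr_ge0_le0 ?sqr_ge0.
  lra.
move: B0; rewrite le_eqVlt => /predU1P[->|B0]; first by rewrite L0 mulr0 expr0n.
have := H (1 + A / - B); rewrite L0 mulr0 addr0 expr0n /= => H1.
have B1 : 0 < - B by rewrite oppr_gt0.
have n0 : B != 0 by rewrite lt_eqF.
have : (1 + A / - B) ^+ 2 * B = B - 2 * A + A ^+ 2 / B by field; rewrite n0 ?oppr_eq0.
have : A ^+ 2 / B <= 0 by rewrite mulr_ge0_le0 ?sqr_ge0 // invr_le0 ltW.
nra.
Qed.

(** This is the form on the functional b + r (be - w), sorted by powers of r for the discriminant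
    argument; [be] will be a stencil. *)
Lemma quadratic_form_sum3 (R : realType) (V : Type) (I1 I2 I3 : finType)
    (K : V -> V -> R) (b : I1 -> R) (be : I2 -> R) (w : I3 -> R)
    (y : I1 -> V) (ze : I2 -> V) (x : I3 -> V) (r : R)
    (cf := fun e : I1 + (I2 + I3) => match e with
       inl i => b i | inr (inl g) => r * be g | inr (inr i) => - r * w i end)
    (pt := fun e : I1 + (I2 + I3) => match e with
       inl i => y i | inr (inl g) => ze g | inr (inr i) => x i end) :
  (forall u v, K u v = K v u) ->
  \sum_e \sum_e' cf e * cf e' * K (pt e) (pt e') =
  \sum_i \sum_j b i * b j * K (y i) (y j) +
  2 * r * (\sum_i b i * (\sum_g be g * K (ze g) (y i) -
                         \sum_i' w i' * K (x i') (y i))) +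
  r ^+ 2 * (\sum_g \sum_g' be g * be g' * K (ze g) (ze g') +
     (- 2 * (\sum_i w i * \sum_g be g * K (ze g) (x i)) +
      \sum_i \sum_j w i * w j * K (x i) (x j))).
Proof.
move=> symm.
have sumT (F : I1 + (I2 + I3) -> R) : \sum_e F e =
    \sum_i F (inl i) + (\sum_g F (inr (inl g)) + \sum_i F (inr (inr i))).
  by rewrite big_sumType /= big_sumType.
pose Sbg := \sum_i b i * \sum_g be g * K (ze g) (y i).
pose Sbw := \sum_i b i * \sum_i' w i' * K (x i') (y i).
pose Swg := \sum_i w i * \sum_g be g * K (ze g) (x i).
have -> : \sum_i b i * (\sum_g be g * K (ze g) (y i) -
    \sum_i' w i' * K (x i') (y i)) = Sbg - Sbw.
  by rewrite -sumrB; apply: eq_bigr => i _; rewrite mulrBr.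
rewrite -/Swg.
have e1 : \sum_i \sum_g b i * (r * be g) * K (y i) (ze g) = r * Sbg.
  rewrite mulr_sumr; apply: eq_bigr => i _; rewrite !mulr_sumr.
  by apply: eq_bigr => g _; rewrite symm; ring.
have e2 : \sum_i \sum_i' b i * (- r * w i') * K (y i) (x i') = - r * Sbw.
  rewrite mulr_sumr; apply: eq_bigr => i _; rewrite !mulr_sumr.
  by apply: eq_bigr => g _; rewrite symm; ring.
have e3 : \sum_g \sum_i r * be g * b i * K (ze g) (y i) = r * Sbg.
  rewrite exchange_big mulr_sumr; apply: eq_bigr => i _; rewrite !mulr_sumr.
  by apply: eq_bigr => g _; ring.
have e4 : \sum_g \sum_g' r * be g * (r * be g') * K (ze g) (ze g') =
    r ^+ 2 * \sum_g \sum_g' be g * be g' * K (ze g) (ze g').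
  rewrite mulr_sumr; apply: eq_bigr => i _; rewrite !mulr_sumr.
  by apply: eq_bigr => g _; ring.
have e5 : \sum_g \sum_i r * be g * (- r * w i) * K (ze g) (x i) =
    - r ^+ 2 * Swg.
  rewrite exchange_big mulr_sumr; apply: eq_bigr => i _; rewrite !mulr_sumr.
  by apply: eq_bigr => g _; ring.
have e6 : \sum_i' \sum_i - r * w i' * b i * K (x i') (y i) = - r * Sbw.
  rewrite exchange_big mulr_sumr; apply: eq_bigr => i _; rewrite !mulr_sumr.
  by apply: eq_bigr => g _; ring.
have e7 : \sum_i \sum_g - r * w i * (r * be g) * K (x i) (ze g) =
    - r ^+ 2 * Swg.
  rewrite mulr_sumr; apply: eq_bigr => i _; rewrite !mulr_sumr.
  by apply: eq_bigr => g _; rewrite symm; ring.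
have e8 : \sum_i \sum_j - r * w i * (- r * w j) * K (x i) (x j) =
    r ^+ 2 * \sum_i \sum_j w i * w j * K (x i) (x j).
  rewrite mulr_sumr; apply: eq_bigr => i _; rewrite !mulr_sumr.
  by apply: eq_bigr => g _; ring.
rewrite sumT /=.
under eq_bigr do rewrite sumT /=.
under [X in _ + (X + _)]eq_bigr do rewrite sumT /=.
under [X in _ + (_ + X)]eq_bigr do rewrite sumT /=.
rewrite !big_split /= e1 e2 e3 e4 e5 e6 e7 e8; ring.
Qed.

Definition tps_jet (R : realType) (d n : nat) (G : seq 'I_d -> 'rV[R]_d -> R) :=
  [/\ jet (2 * n - 1) G, G [::] = tps n &
      forall s, (size s <= 2 * n - 2)%N -> G s 0 = 0].

Section JetFunctional.
Variables (R : realType) (d n k s : nat) (G : seq 'I_d -> 'rV[R]_d -> R).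
Hypotheses (kn : (k < n)%N) (ns : (n < s)%N) (tG : tps_jet n G).
Variables (J : finType) (a : J -> R) (sq : J -> seq 'I_d) (z : 'rV[R]_d).
Hypothesis sqk : forall j, (size (sq j) <= k)%N.
Variables (I : finType) (w : I -> R) (x : I -> 'rV[R]_d).
Hypothesis w_exact : forall p, Pi s p ->
  \sum_i w i * peval p (x i) = \sum_j a j * peval (mds (sq j) p) z.

(** This is the squared dual norm, lambda applied to both arguments of K, of the error functional
    lambda. The term in which both arguments are differentiated at z is absent: it involves partials
    of order at most 2k <= 2n - 2 at 0, which vanish. *)
Definition jet_form : R :=
  - 2 * (\sum_i w i * \sum_j a j * G (sq j) (z - x i)) +
  \sum_i \sum_j w i * w j * tps n (x i - x j).

Lemma ds_tps_comb (I' : finType) (b : I' -> R) (y : I' -> 'rV[R]_d) p0 l :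
  (size l <= 2 * n - 1)%N ->
  ds l (fun u => \sum_i b i * tps n (u - y i) + peval p0 u) =
  (fun u => \sum_i b i * G l (u - y i) + peval (mds l p0) u).
Proof.
have [jG G1 _] := tG => lr.
have jH := jetD (jet_sum (index_enum I') b (fun i => jet_shift (y i) jG))
                (jet_peval (2 * n - 1) p0).
have := jet_ds jH lr; rewrite /= => <-; congr ds; apply/funext => u.
by congr (_ + _); apply: eq_bigr => i _; rewrite G1.
Qed.

(** This is the Cauchy-Schwarz inequality for the semi-inner product of K. For fixed r nonnegativity
    is obtained with a stencil of step t in place of the derivatives, and t tends to 0 before the
    discriminant is taken. *)
Lemma jet_functional_sqr_le (I' : finType) (b : I' -> R) (y : I' -> 'rV[R]_d)
    (p0 : mpoly.mpoly d R) (h := fun u => \sum_i b i * tps n (u - y i) + peval p0 u) :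
  Pi s p0 -> (forall q, Pi s q -> \sum_i b i * peval q (y i) = 0) ->
  (\sum_j a j * ds (sq j) h z - \sum_i w i * h (x i)) ^+ 2 <=
  (\sum_i \sum_j b i * b j * tps n (y i - y j)) * jet_form.
Proof.
move=> p0s hb; have [jG G1 G0] := tG.
have kr : (k < 2 * n - 1)%N by lia.
have ks : (k < s)%N by lia.
have n0 : (0 < n)%N by lia.
pose DK u := \sum_j a j * G (sq j) (z - u).
(* The polynomial part of [h] disappears by exactness of [w], and the error functional moves onto
   the kernel. *)
have -> : \sum_j a j * ds (sq j) h z - \sum_i w i * h (x i) =
    \sum_i b i * (DK (y i) - \sum_i' w i' * tps n (x i' - y i)).
  rewrite /h; under eq_bigr do rewrite ds_tps_comb ?(leq_trans (sqk _)) ?(ltnW kr) // mulrDr.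
  rewrite big_split /=; under [X in _ - X]eq_bigr do rewrite mulrDr.
  rewrite [X in _ - X]big_split /= w_exact // opprD addrACA subrr addr0.
  under [RHS]eq_bigr do rewrite mulrBr; rewrite sumrB; congr (_ - _).
    under eq_bigr do rewrite mulr_sumr; rewrite exchange_big /=.
    apply: eq_bigr => i _; rewrite /DK mulr_sumr; apply: eq_bigr => j _; ring.
  under eq_bigr do rewrite mulr_sumr; rewrite exchange_big /=.
  by apply: eq_bigr => i _; rewrite mulr_sumr; apply: eq_bigr => j _; ring.
apply: discriminant_le => r.
pose Gr := {ffun 'I_d -> 'I_s}.
pose be t (g : Gr) := stencil_wt a sq t g; pose ze t (g : Gr) := stencil_pt z t g.
have cvgDK u : \sum_g be t g * tps n (ze t g - u) @[t --> 0^'+] --> DK u.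
  have := stencil_cvg sqk ks kr (jet_shift u jG) (a := a) (z := z).
  by rewrite /= G1.
have cvgDD : \sum_g \sum_g' be t g * be t g' * tps n (ze t g - ze t g')
    @[t --> 0^'+] --> (0 : R).
  have k2r : (2 * k < 2 * n - 1)%N by lia.
  have := @stencil_double_cvg R d s k J a sq z sqk _ G k2r jG _.
  rewrite /= G1; apply => l lk; apply: G0; lia.
pose Q t := \sum_i \sum_j b i * b j * tps n (y i - y j) +
  2 * r * (\sum_i b i * (\sum_g be t g * tps n (ze t g - y i) -
                         \sum_i' w i' * tps n (x i' - y i))) +
  r ^+ 2 * (\sum_g \sum_g' be t g * be t g' * tps n (ze t g - ze t g') +
     (- 2 * (\sum_i w i * \sum_g be t g * tps n (ze t g - x i)) +
      \sum_i \sum_j w i * w j * tps n (x i - x j))).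
have cvgQ : Q t @[t --> 0^'+] -->
  \sum_i \sum_j b i * b j * tps n (y i - y j) +
  2 * r * (\sum_i b i * (DK (y i) - \sum_i' w i' * tps n (x i' - y i))) +
  r ^+ 2 * (0 + jet_form).
  apply: cvgD.
    apply: cvgD; first exact: cvg_cst.
    apply: cvg_cMr; apply: cvg_sumr => i; apply: cvg_cMr.
    by apply: cvgB; [exact: cvgDK | exact: cvg_cst].
  apply: cvg_cMr; apply: cvgD => //; apply: cvgD; last exact: cvg_cst.
  by apply: cvg_cMr; apply: cvg_sumr => i; apply: cvg_cMr; exact: cvgDK.
rewrite add0r in cvgQ; apply: cvg_ge0 cvgQ; near=> t.
have t0 : t != 0 by rewrite gt_eqF //; near: t; exact: nbhs_right_gt.
pose T := (I' + (Gr + I))%type.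
pose cf (e : T) : R := match e with
  inl i => b i | inr (inl g) => r * be t g | inr (inr i) => - r * w i end.
pose pt (e : T) : 'rV[R]_d := match e with
  inl i => y i | inr (inl g) => ze t g | inr (inr i) => x i end.
have sumT (F : T -> R) : \sum_e F e =
    \sum_i F (inl i) + (\sum_g F (inr (inl g)) + \sum_i F (inr (inr i))).
  by rewrite big_sumType /= big_sumType.
(* positive semidefiniteness on the functional b + r (stencil - w) *)
have H : 0 <= \sum_e \sum_e' cf e * cf e' * tps n (pt e - pt e').
  apply: tps_cond_psd => // q qn; have qs := Pi_leq ns qn.
  rewrite sumT /= hb // add0r.
  under eq_bigr do rewrite -mulrA; rewrite -mulr_sumr (@stencil_exact R d s k J a sq z sqk ks t _ t0) //.
  under [X in _ + X]eq_bigr do rewrite -mulrA; rewrite -mulr_sumr w_exact //.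
  by rewrite mulNr subrr.
have symm u v : tps n (u - v) = tps n (v - u) by rewrite -tpsN opprB.
by move: H; rewrite (@quadratic_form_sum3 R _ I' Gr I (fun u v => tps n (u - v))).
Unshelve. all: by end_near. Qed.

End JetFunctional.

(** * Partial derivatives of thin plate splines *)

Lemma is_derive_invX (R : realType) (f : R -> R) (df t : R) (m : nat) :
  f t != 0 -> is_derive t 1 f df ->
  is_derive t 1 (fun u => (f u) ^- m) (- (m%:R * df * f t ^- m.+1)).
Proof.
move=> ft0 dft; have fd : derivable f t 1 by case: dft.
have dv : is_derive t 1 (fun u => (f u)^-1) (- (f t) ^- 2 * df).
  split; first exact: derivableV.
  by rewrite deriveV // (@derive_val _ _ _ _ _ _ _ dft).
have := is_deriveX m dv; rewrite /=.
have -> : (m%:R * (f t)^-1 ^+ m.-1) *: (- f t ^- 2 * df) = - (m%:R * df * f t ^- m.+1).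
  case: m => [|m]; first by rewrite !mul0r oppr0 scale0r.
  rewrite /GRing.scale /= exprVn !exprS expr0 mulr1; field.
  by rewrite ft0 expf_neq0.
congr is_derive; apply/funext => u; by rewrite exprfctE exprVn.
Qed.

(** The exponent 3/2 lies strictly between 1 and 2: a function of size h^2 ln h satisfies the bound,
    but no bound by a multiple of h^2. *)
Lemma is_derive0_sqrt (R : realType) (f : R -> R) (C : R) : f 0 = 0 ->
  (forall h : R, 0 < `|h| <= 1 -> `|f h| <= C * (`|h| * Num.sqrt `|h|)) ->
  is_derive (0 : R) 1 f 0.
Proof.
move=> f0 fC.
have H : h^-1 *: ((f \o shift 0) (h *: (1 : R)) - f 0) @[h --> 0^'] --> (0 : R).
  have S : Num.sqrt `|h| @[h --> (0 : R)^'] --> (0 : R).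
    have cn : (fun h : R => `|h|) h @[h --> (0 : R)^'] --> (0 : R).
      apply: cvg_within_filter.
      by have := @norm_continuous R R 0; rewrite /continuous_at normr0.
    have cs : Num.sqrt u @[u --> (0 : R)] --> (0 : R).
      by have := @sqrt_continuous R 0; rewrite /continuous_at sqrtr0.
    exact: (@cvg_comp _ _ _ (fun h : R => `|h|) (@Num.sqrt R) _ _ _ cn cs).
  apply/cvgrPdist_le => e e0.
  have e'0 : 0 < e / (`|C| + 1) by rewrite divr_gt0 // ltr_wpDl.
  move/cvgrPdist_le : S => /(_ _ e'0) S.
  near=> h; rewrite sub0r normrN /= addr0 f0 subr0 [h *: 1]mulr1.
  have h0 : 0 < `|h| by rewrite normr_gt0; near: h; exact: nbhs_dnbhs_neq.
  have h1 : `|h| <= 1.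
    near: h; apply: nbhs_dnbhs; exists 1 => [|u] /=; first exact: ltr01.
    by rewrite sub0r normrN => /ltW.
  have Sh : Num.sqrt `|h| <= e / (`|C| + 1).
    have : `|0 - Num.sqrt `|h| | <= e / (`|C| + 1) by near: h.
    by rewrite sub0r normrN; apply: le_trans (ler_norm _).
  rewrite normrM normfV ler_pdivrMl //; apply: le_trans (fC h _) _; first by rewrite h0.
  rewrite mulrCA ler_wpM2l //.
  apply: (@le_trans _ _ ((`|C| + 1) * Num.sqrt `|h|)).
    by rewrite ler_wpM2r ?sqrtr_ge0 // (le_trans (ler_norm C)) // lerDl.
  by rewrite mulrC -ler_pdivlMr // ltr_wpDl.
split; first by apply/cvg_ex; exists 0.
exact: cvg_lim H.
Unshelve. all: by end_near. Qed.

Section TpsJet.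
Variables (R : realType) (d : nat).
Implicit Types (p P Q : mpoly.mpoly d R) (x v : 'rV[R]_d) (i : 'I_d) (t : R).

Definition rho : mpoly.mpoly d R := \sum_i polyX R i * polyX R i.

Lemma peval_rho x : peval rho x = enorm x ^+ 2.
Proof.
rewrite peval_sum sqr_enorm; apply: eq_bigr => i _.
by rewrite pevalM !pevalX expr2.
Qed.

Lemma mderiv_rho i : mpoly.mderiv i rho = 2%:R *: polyX R i.
Proof.
rewrite raddf_sum (bigD1 i) //= big1 ?addr0 => [|j /negbTE ji]; last first.
  by rewrite mpoly.mderivM mderiv_polyX eq_sym ji mpoly.mpolyC0 mul0r mulr0 addr0.
by rewrite mpoly.mderivM mderiv_polyX eqxx mpoly.mpolyC1 mul1r mulr1 scaler_nat mulr2n.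
Qed.

(* (P, Q, m) stands for P ln rho + Q rho^-m; a triple is kept, rather than a
   function, so that partial derivatives commute formally. *)
Definition logrep : Type := (mpoly.mpoly d R * mpoly.mpoly d R * nat)%type.

Definition logeval (T : logrep) x : R :=
  peval T.1.1 x * ln (peval rho x) + peval T.1.2 x * peval rho x ^- T.2.

(** All terms are put over the common denominator [rho ^+ m.+1] without cancellation, so the
    exponent depends only on the number of derivatives taken. *)
Definition logderiv i (T : logrep) : logrep :=
  (mpoly.mderiv i T.1.1,
   2%:R *: (polyX R i * T.1.1 * rho ^+ T.2) + mpoly.mderiv i T.1.2 * rho
     - (2 * T.2)%:R *: (polyX R i * T.1.2),
   T.2.+1).

Lemma mderivX_rho i m :
  mpoly.mderiv i (rho ^+ m) = (2 * m)%:R *: (polyX R i * rho ^+ m.-1).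
Proof.
elim: m => [|m IH].
  by rewrite expr0 -mpoly.mpolyC1 mpoly.mderivC muln0 scale0r.
rewrite exprS mpoly.mderivM IH mderiv_rho !scaler_nat mulrnAl.
case: m {IH} => [|m]; first by rewrite muln0 mulr0n mulr0 addr0 muln1.
rewrite mulrnAr mulrCA -exprS -mulrnDr; congr (_ *+ _); lia.
Qed.

Lemma logderiv_comm i j T : logderiv i (logderiv j T) = logderiv j (logderiv i T).
Proof.
case: T => [[P Q] m]; rewrite /logderiv /=; congr (_, _, _).
  exact: mpoly.mderiv_comm.
rewrite !(mpoly.mderivB, mpoly.mderivD, mpoly.mderivZ, mpoly.mderivM, mderivX_rho).
rewrite !mderiv_rho !mderiv_polyX (eq_sym j i) (mpoly.mderiv_comm i j Q).
case: m => [|m].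
  rewrite !scaler_nat !muln0 !muln1 !mulr0n expr1 expr0; ring.
rewrite !scaler_nat /= !exprS; ring.
Qed.

Lemma foldr_logderiv_perm T (s s' : seq 'I_d) : perm_eq s s' ->
  foldr logderiv T s = foldr logderiv T s'.
Proof.
have front l i : i \in l -> foldr logderiv T l = foldr logderiv T (i :: rem i l).
  elim: l => //= j l IH; rewrite inE; case: eqVneq => [->|ij] //=.
  by move=> /IH ->; rewrite /= logderiv_comm.
elim: s s' => [|i s IH] s' ss'.
  by move: ss'; rewrite perm_sym => /perm_nilP ->.
have is' : i \in s' by rewrite -(perm_mem ss') mem_head.
rewrite (front _ _ is') /=; congr logderiv; apply: IH.
by rewrite -(perm_cons i); apply: perm_trans ss' (perm_to_rem is').
Qed.

Definition homog (j : nat) p :=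
  forall t x, t != 0 -> peval p (t *: x) = t ^+ j * peval p x.

Lemma homogD j P Q : homog j P -> homog j Q -> homog j (P + Q).
Proof. by move=> hP hQ t x t0; rewrite !pevalD hP // hQ // mulrDr. Qed.

Lemma homogZ j (c : R) P : homog j P -> homog j (c *: P).
Proof. by move=> hP t x t0; rewrite !pevalZ hP // mulrCA. Qed.

Lemma homogM j k P Q : homog j P -> homog k Q -> homog (j + k) (P * Q).
Proof. by move=> hP hQ t x t0; rewrite !pevalM hP // hQ // exprD mulrACA. Qed.

Lemma homogX j m P : homog j P -> homog (j * m) (P ^+ m).
Proof. by move=> hP t x t0; rewrite !pevalXn hP // exprMn exprM. Qed.

Lemma homog_polyX i : homog 1 (polyX R i).
Proof. by move=> t x t0; rewrite !pevalX mxE expr1. Qed.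

Lemma homog_rho : homog 2 rho.
Proof.
move=> t x t0; rewrite !peval_sum mulr_sumr; apply: eq_bigr => i _.
by rewrite !pevalM !pevalX mxE; ring.
Qed.

(** Differentiating p (t x) = t^(j + 1) p (x) along the i-th axis gives an extra factor t on the
    left; cancelling it is the reason for restricting homogeneity to t != 0. *)
Lemma homog_mderiv j i p : homog j.+1 p -> homog j (mpoly.mderiv i p).
Proof.
move=> hp t x t0; pose e : 'rV[R]_d := delta_mx 0 i.
have sumE c y : \sum_l (c *: e) 0 l * peval (mpoly.mderiv l p) y =
    c * peval (mpoly.mderiv i p) y.
  rewrite (bigD1 i) //= !mxE !eqxx mulr1 big1 ?addr0 // => l /negbTE li.
  by rewrite !mxE li andbF mulr0 mul0r.
have d1 := is_derive_peval p (t *: x) (t *: e).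
have d2 := is_derive_cMr (t ^+ j.+1) (is_derive_peval p x (1 *: e)).
rewrite !sumE mul1r in d1 d2.
have E : (fun u : R => peval p (u *: (t *: e) + t *: x)) =
         (fun u : R => t ^+ j.+1 * peval p (u *: (1 *: e) + x)).
  apply/funext => u; rewrite -hp // scale1r scalerDr; congr (peval p (_ + _)).
  by rewrite !scalerA mulrC.
rewrite E in d1.
have := @derive_val _ _ _ _ _ _ _ d1; rewrite (@derive_val _ _ _ _ _ _ _ d2).
by rewrite exprS -mulrA => /(mulfI t0).
Qed.

(** The second numerator carries the additional degree 2m of its denominator, so that the whole
    expression has degree j up to the logarithm. *)
Definition log_homog j (T : logrep) := homog j T.1.1 /\ homog (j + 2 * T.2) T.1.2.

Lemma log_homog_logderiv j i T : log_homog j.+1 T -> log_homog j (logderiv i T).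
Proof.
case: T => [[P Q] m] [/= hP hQ]; split => /=; first exact: homog_mderiv.
have -> : (j + 2 * m.+1 = 1 + j.+1 + 2 * m)%N by lia.
have hXPr : homog (1 + j.+1 + 2 * m) (polyX R i * P * rho ^+ m).
  by apply: homogM; [apply: homogM => //; exact: homog_polyX|apply/homogX/homog_rho].
have hQr : homog (1 + j.+1 + 2 * m) (mpoly.mderiv i Q * rho).
  have -> : (1 + j.+1 + 2 * m = j + 2 * m + 2)%N by lia.
  by apply: homogM; [apply: homog_mderiv; rewrite -addSn|exact: homog_rho].
have hXQ : homog (1 + j.+1 + 2 * m) (polyX R i * Q).
  by rewrite -addnA; apply: homogM => //; exact: homog_polyX.
apply: homogD; first by apply: homogD => //; exact: homogZ.
by rewrite -scaleNr; exact: homogZ.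
Qed.

Lemma homog_cst_eq0 j p : homog j.+1 p -> peval p 0 = 0.
Proof.
move=> /(_ 2 0); rewrite scaler0 pnatr_eq0 => /(_ isT) /eqP.
rewrite eq_sym -subr_eq0 -{2}[peval p 0]mul1r -mulrBl mulf_eq0 => /orP[|/eqP //].
rewrite subr_eq0 => /eqP E.
have : 1 < (2 : R) ^+ j.+1 by rewrite exprn_egt1 // ltr1n.
by rewrite E ltxx.
Qed.

(** Both polynomial factors vanish at 0, so the value is 0 whatever the conventions for ln 0 and for
    division by 0. *)
Lemma logeval0 j T : log_homog j.+1 T -> logeval T 0 = 0.
Proof.
move=> [hP hQ]; rewrite /logeval (homog_cst_eq0 hP) mul0r add0r.
by rewrite (@homog_cst_eq0 (j + 2 * T.2)) ?mul0r.
Qed.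

Lemma logeval_scale j T t v : log_homog j T -> t != 0 -> peval rho v != 0 ->
  logeval T (t *: v) =
  t ^+ j * (peval T.1.1 v * (ln (t ^+ 2) + ln (peval rho v)) +
            peval T.1.2 v * peval rho v ^- T.2).
Proof.
case: T => [[P Q] m] [/= hP hQ] t0 v0; rewrite /logeval /= hP // hQ // homog_rho //.
rewrite lnM ?posrE ?exprn_even_gt0 ?t0 ?orbT //; last first.
  by rewrite lt_neqAle eq_sym v0 peval_rho sqr_ge0.
rewrite exprMn invfM -exprM exprD; field.
by rewrite !expf_neq0.
Qed.

Lemma is_derive_logeval T x v : peval rho x != 0 ->
  is_derive (0 : R) 1 (fun t => logeval T (t *: v + x))
    (\sum_i v 0 i * logeval (logderiv i T) x).
Proof.
case: T => [[P Q] m] x0; have dP := is_derive_peval P x v.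
have dQ := is_derive_peval Q x v; have dr := is_derive_peval rho x v.
have x00 : peval rho (0 *: v + x) != 0 by rewrite scale0r add0r.
have xp : 0 < peval rho (0 *: v + x).
  by rewrite lt_neqAle eq_sym x00 peval_rho sqr_ge0.
have dl := is_derive_ln_comp dr xp.
have di := @is_derive_invX R _ _ 0 m x00 dr.
have := is_deriveD (is_deriveM dP dl) (is_deriveM dQ di).
set df := (X in is_derive _ _ _ X -> _) => H.
suff -> : \sum_i v 0 i * logeval (logderiv i (P, Q, m)) x = df by exact: H.
rewrite /df /= scale0r add0r {df H dl di} /GRing.scale /=.
rewrite /logeval /logderiv /=.
have E : \sum_i v 0 i * peval (mpoly.mderiv i rho) x = 2 * \sum_i v 0 i * x 0 i.
  rewrite mulr_sumr; apply: eq_bigr => i _.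
  by rewrite mderiv_rho pevalZ pevalX mulrCA.
rewrite E.
transitivity (\sum_i (ln (peval rho x) * (v 0 i * peval (mpoly.mderiv i P) x)
   + (2 * peval P x / peval rho x) * (v 0 i * x 0 i)
   + (peval rho x ^- m) * (v 0 i * peval (mpoly.mderiv i Q) x)
   + (- (2 * m%:R) * peval Q x * peval rho x ^- m.+1) * (v 0 i * x 0 i))).
  apply: eq_bigr => i _; rewrite pevalD pevalD -scaleNr !pevalZ !pevalM pevalX pevalXn.
  rewrite natrM !exprS; field; rewrite x0 expf_neq0 //.
rewrite !big_split /= -!mulr_sumr; field; rewrite x0 ?expf_neq0 //.
Qed.

(** On the line through 0 the function is h^(j + 2) times an affine function of ln |h|. One power of
    h is kept, and the other absorbs the logarithm at the price of a square root. *)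
Lemma is_derive_logeval0 j T v : log_homog j.+2 T ->
  is_derive (0 : R) 1 (fun t => logeval T (t *: v)) 0.
Proof.
move=> hT; have hT0 := logeval0 hT.
have [v0|v0] := eqVneq (peval rho v) 0.
  have -> : v = 0 by apply/enorm_eq0/eqP; rewrite -sqrf_eq0 -peval_rho v0.
  have -> : (fun t : R => logeval T (t *: 0)) = cst 0.
    by apply/funext => t; rewrite scaler0.
  exact: is_derive_cst.
(* [A] bounds the part free of ln |h|. In 4 * B one factor 2 comes from ln (h^2) = 2 ln |h| and the
   other from [xlnx_le]. *)
pose A := `|peval T.1.1 v * ln (peval rho v) + peval T.1.2 v * peval rho v ^- T.2|.
pose B := `|peval T.1.1 v|.
apply: (@is_derive0_sqrt R _ (A + 4 * B)); first by rewrite scale0r.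
move=> h /andP[h0 h1]; have hn0 : h != 0 by rewrite -normr_gt0.
rewrite (logeval_scale hT hn0 v0) normrM normrX.
have -> : peval T.1.1 v * (ln (h ^+ 2) + ln (peval rho v)) +
   peval T.1.2 v * peval rho v ^- T.2 =
   peval T.1.1 v * ln (peval rho v) + peval T.1.2 v * peval rho v ^- T.2
   + peval T.1.1 v * (2 * ln `|h|).
  rewrite -real_normK ?num_real // lnXn // -mulr_natl; ring.
set S := Num.sqrt `|h|.
have S0 : 0 <= S by exact: sqrtr_ge0.
have hS : `|h| = S ^+ 2 by rewrite sqr_sqrtr.
have S1 : S <= 1 by rewrite /S -[leRHS]sqrtr1 ler_wsqrtr.
have hl : `|h| * `|ln `|h| | <= 2 * S.
  by rewrite -{1}[`|h|]normr_id -normrM; apply: xlnx_le; rewrite h0.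
apply: (@le_trans _ _ (`|h| * (`|h| * (A + B * (2 * `|ln `|h| |))))).
  rewrite [leRHS]mulrA -expr2; apply: ler_pM => //.
  - by rewrite ler_wiXn2l.
  - apply: le_trans (ler_normD _ _) _; rewrite lerD2l !normrM /B.
    by rewrite (ger0_norm (ler0n _ 2)).
rewrite [leRHS]mulrCA ler_wpM2l // [leLHS]mulrDr [leRHS]mulrDl lerD //.
  rewrite mulrC ler_wpM2l //; first exact: normr_ge0.
  by rewrite hS expr2 ler_piMl.
have B0 : 0 <= B by exact: normr_ge0.
have -> : `|h| * (B * (2 * `|ln `|h| |)) = 2 * B * (`|h| * `|ln `|h| |) by ring.
have -> : 4 * B * S = 2 * B * (2 * S) by ring.
by rewrite ler_wpM2l // mulr_ge0.
Qed.

(** The factor 1/2 compensates for ln rho = 2 ln |x|. *)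
Definition tps_partial (n : nat) (s : seq 'I_d) : 'rV[R]_d -> R :=
  logeval (foldr logderiv (((-1) ^+ n.+1 / 2) *: rho ^+ n, 0, 0%N) s).

Lemma log_homog_tps n (s : seq 'I_d) : (size s <= 2 * n)%N ->
  log_homog (2 * n - size s) (foldr logderiv (((-1) ^+ n.+1 / 2) *: rho ^+ n, 0, 0%N) s).
Proof.
elim: s => [|i s IH] sn /=.
  split=> /=; first by rewrite subn0; apply/homogZ/homogX/homog_rho.
  by move=> t x _; rewrite /peval !mpoly.meval0 mulr0.
apply: log_homog_logderiv; have := IH (ltnW sn).
by rewrite subnSK.
Qed.

Lemma tps_partialP n : (0 < n)%N -> tps_jet n (tps_partial n).
Proof.
move=> n0; split.
- split=> [s s' ss'|s x v sn].
    by rewrite /tps_partial (foldr_logderiv_perm _ ss').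
  have [x0|x0] := eqVneq (peval rho x) 0; last exact: is_derive_logeval.
  have -> : x = 0 by apply/enorm_eq0/eqP; rewrite -sqrf_eq0 -peval_rho x0.
  (* The homogeneity degree 2n - |l| is at least 1 up to order 2n - 1, which gives the value 0 at
     the origin. Before the last derivative it is at least 2, which gives differentiability
     there. *)
  have hs (l : seq 'I_d) : (size l <= 2 * n - 1)%N -> tps_partial n l 0 = 0.
    move=> ln; have := @log_homog_tps n l ltac:(lia).
    have -> : (2 * n - size l = (2 * n - size l).-1.+1)%N by lia.
    exact: logeval0.
  rewrite big1 => [|i _]; last by rewrite hs ?mulr0.
  have := @log_homog_tps n s ltac:(lia).
  have -> : (2 * n - size s = (2 * n - size s).-2.+2)%N by lia.
  move=> /(is_derive_logeval0 v); congr is_derive.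
  by apply/funext => t; rewrite addr0.
- apply/funext => x; rewrite /tps_partial /logeval /= /tps pevalZ pevalXn peval_rho.
  rewrite /peval mpoly.meval0 mul0r addr0 exprM.
  rewrite ln_enorm; ring.
- move=> s sn; have := @log_homog_tps n s ltac:(lia).
  have -> : (2 * n - size s = (2 * n - size s).-1.+1)%N by lia.
  exact: logeval0.
Qed.

End TpsJet.

(** * Mixed Taylor remainders *)

(** [F l m] stands for the derivative of order l in a and m in b. With N derivatives in a already
    taken, N integrations in b are carried out, followed by N integrations in a. The Taylor sums
    have N + 1 terms, and their top terms are the ones subtracted in the hypothesis on [F N N]. *)
Lemma double_taylor_le (R : realType) (N : nat) (F : nat -> nat -> R -> R -> R)
    (M p : R) : 0 <= p ->
  (forall l m (a b : R), (l < N)%N -> (m <= N)%N ->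
     is_derive a 1 (F l m ^~ b) (F l.+1 m a b)) ->
  (forall l m (a b : R), (l <= N)%N -> (m < N)%N ->
     is_derive b 1 (F l m a) (F l m.+1 a b)) ->
  (forall l m, (l <= N)%N -> (m <= N)%N -> F l m 0 0 = 0) ->
  (forall a b : R, 0 <= a <= 1 -> 0 <= b <= 1 ->
     `|F N N a b - F N N 0 b - F N N a 0| <= M * (a `^ p) * (b `^ p)) ->
  `|F 0%N 0%N 1 1 - expsum (fun m => F m 0%N 0 1) N.+1 1
                  - expsum (fun l => F 0%N l 1 0) N.+1 1|
  <= M / \prod_(1 <= i < N.+1) (p + i%:R) ^+ 2.
Proof.
move=> p0 dFa dFb F0 HM.
set P := \prod_(1 <= i < N.+1) (p + i%:R).
have I1 : 0 <= (1 : R) <= 1 by rewrite ler01 lexx.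
have I0 : 0 <= (0 : R) <= 1 by rewrite ler01 lexx.
have inner a : 0 <= a <= 1 ->
    `|F N 0%N a 1 - F N 0%N 0 1 - expsum (fun l => F N l a 0) N.+1 1| <= M / P * a `^ p.
  move=> a01.
  pose W j (b : R) := F N j a b - F N j 0 b - expsum (fun m => F N (m + j)%N a 0) (N.+1 - j) b.
  have -> : F N 0%N a 1 - F N 0%N 0 1 - expsum (fun l => F N l a 0) N.+1 1 = W 0%N 1.
    rewrite /W subn0; congr (_ - expsum _ _ _).
    by apply/funext => m; rewrite addn0.
  have := @taylor_remainder_le R N W (M * a `^ p) p 1 p0 _ _ _ 1 I1.
  rewrite powR1 mulr1 => H.
  have -> : M / P * a `^ p = M * a `^ p / P by rewrite mulrAC.
  apply: H.
  - move=> j b jN b01; apply: is_deriveB.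
      by apply: is_deriveB; apply: dFb.
    exact: (is_derive_expsum_shift (fun m => F N m a 0)).
  - move=> j jN; rewrite /W expsum0 ?subn_gt0 ?ltnS 1?ltnW // add0n F0 ?(ltnW jN) //.
    by rewrite subr0 subrr.
  - move=> b b01; rewrite /W subSnn /expsum big_nat1 fact0 invr1 mul1r expr0 mulr1 add0n.
    exact: HM.
pose V i (a : R) := F i 0%N a 1 - expsum (fun m => F (m + i)%N 0%N 0 1) (N.+1 - i) a -
  \sum_(l < N.+1) (l`!%:R)^-1 * F i l a 0.
have expsum1 (c : nat -> R) : expsum c N.+1 1 = \sum_(l < N.+1) (l`!%:R)^-1 * c l.
  by rewrite /expsum big_mkord; apply: eq_bigr => l _; rewrite expr1n mulr1.
have -> : F 0%N 0%N 1 1 - expsum (fun m => F m 0%N 0 1) N.+1 1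
                  - expsum (fun l => F 0%N l 1 0) N.+1 1 = V 0%N 1.
  rewrite /V subn0 expsum1 [in RHS]expsum1; congr (_ - _ - _); last by rewrite expsum1.
  by apply: eq_bigr => l _; rewrite addn0.
have := @taylor_remainder_le R N V (M / P) p 1 p0 _ _ _ 1 I1.
rewrite powR1 mulr1 => H.
have -> : M / \prod_(1 <= i < N.+1) (p + i%:R) ^+ 2 = M / P / P.
  by rewrite prodrXl -/P expr2 invfM mulrA.
apply: H.
- move=> i a iN a01; apply: is_deriveB.
    apply: is_deriveB; first exact: dFa.
    exact: (is_derive_expsum_shift (fun m => F m 0%N 0 1)).
  apply: is_derive_sumr => l; apply: is_derive_cMr; apply: dFa => //.
  by rewrite -ltnS.
- move=> i iN; rewrite /V expsum0 ?subn_gt0 ?ltnS 1?ltnW // add0n subrr sub0r.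
  rewrite big1 ?oppr0 // => l _; rewrite F0 ?mulr0 ?(ltnW iN) //.
  by rewrite -ltnS.
- move=> a a01; rewrite /V subSnn {1}/expsum big_nat1 fact0 invr1 mul1r expr0 mulr1 add0n.
  by rewrite -(expsum1 (fun l => F N l a 0)); exact: inner.
Qed.

Section MixedTay.
Variables (R : realType) (d : nat).
Implicit Types (c : seq 'I_d -> R) (u v w : 'rV[R]_d) (G : seq 'I_d -> 'rV[R]_d -> R).

Lemma tay_swap l m c u w : (forall s s', perm_eq s s' -> c s = c s') ->
  tay l (fun s1 => tay m (fun s2 => c (s1 ++ s2)) w) u =
  tay m (fun s2 => tay l (fun s1 => c (s2 ++ s1)) u) w.
Proof.
elim: l c => [|l IH] c pc /=; first by apply: eq_tay => s _; rewrite cats0.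
transitivity (\sum_i u 0 i * tay m (fun s2 => tay l (fun s1 => c (i :: s2 ++ s1)) u) w).
  apply: eq_bigr => i _; congr (_ * _); apply: (IH (fun s => c (i :: s))) => s s' ss'.
  by apply: pc; rewrite perm_cons.
rewrite -tay_sum; apply: eq_tay => s2 _; apply: eq_bigr => i _; congr (_ * _).
apply: eq_tay => s1 _; apply: pc.
by rewrite perm_sym; apply/permPl; exact: (perm_catCA s2 [:: i] s1).
Qed.

Lemma jet_tay r m G w : (m <= r)%N -> jet r G ->
  jet (r - m) (fun s1 p => tay m (fun s2 => G (s1 ++ s2) p) w).
Proof.
move=> mr jG; split=> [s s' ss'|s x v sr].
  apply/funext => p; apply: eq_tay => s2 _; congr (_ p); apply: jG.1.
  by rewrite perm_cat2r.
rewrite -tay_sum; apply: is_derive_tay => s2 s2m.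
by have := jG.2 (s ++ s2) x v; rewrite size_cat s2m; apply; rewrite addnC -ltn_subRL.
Qed.

Definition mixed G l m u w p :=
  tay l (fun s1 => tay m (fun s2 => G (s1 ++ s2) p) w) u.

Lemma mixed_swap r G l m u w p : jet r G -> mixed G l m u w p = mixed G m l w u p.
Proof.
by move=> jG; apply: (@tay_swap l m (fun s => G s p)) => s s' ss'; rewrite (jG.1 _ _ ss').
Qed.

Lemma is_derive_mixed r G l m u w x (t : R) : jet r G -> (l + m < r)%N ->
  is_derive t 1 (fun t => mixed G l m u w (t *: u + x))
                (mixed G l.+1 m u w (t *: u + x)).
Proof.
move=> jG lmr; have mr : (m <= r)%N by lia.
apply: (is_derive_tay_line x u t (jet_tay w mr jG)); lia.
Qed.

Definition norm1 u := \sum_i `|u 0 i|.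

Lemma norm1_ge0 u : 0 <= norm1 u.
Proof. exact: sumr_ge0. Qed.

Lemma norm1_le u : norm1 u <= Num.sqrt d%:R * enorm u.
Proof.
rewrite -[norm1 u]ger0_norm ?norm1_ge0 // -sqrtr_sqr /enorm -sqrtrM ?ler0n //.
apply: ler_wsqrtr.
have -> : norm1 u ^+ 2 = \sum_i \sum_j `|u 0 i| * `|u 0 j|.
  by rewrite expr2 mulr_suml; apply: eq_bigr => i _; rewrite mulr_sumr.
have -> : d%:R * \sum_i u 0 i ^+ 2 =
    \sum_(i < d) \sum_(j < d) 2^-1 * (u 0 i ^+ 2 + u 0 j ^+ 2).
  transitivity (\sum_(i < d) 2^-1 * (d%:R * u 0 i ^+ 2 + \sum_(j < d) u 0 j ^+ 2)).
    rewrite -mulr_sumr big_split /= -mulr_sumr sumr_const card_ord.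
    by set S := \sum_(j < d) _; rewrite -(mulr_natl S d); field.
  apply: eq_bigr => i _; rewrite -mulr_sumr big_split /= sumr_const card_ord.
  by rewrite mulr_natl.
apply: ler_sum => i _; apply: ler_sum => j _.
rewrite -(real_normK (num_real (u 0 i))) -(real_normK (num_real (u 0 j))).
have := sqr_ge0 (`|u 0 i| - `|u 0 j|); lra.
Qed.

End MixedTay.

Lemma enormZ (R : realType) d (a : R) (x : 'rV[R]_d) : enorm (a *: x) = `|a| * enorm x.
Proof.
rewrite -sqrtr_sqr /enorm -sqrtrM ?sqr_ge0 //; congr Num.sqrt.
by rewrite mulr_sumr; apply: eq_bigr => i _; rewrite mxE exprMn.
Qed.

Lemma sqr_powR_half (R : realType) (x g : R) : 0 <= x -> 0 < g ->
  (x `^ ((1 + g) / 2)) ^+ 2 = x * x `^ g.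
Proof.
move=> x0 g0; have [->|xn] := eqVneq x 0.
  by rewrite powR0 ?mul0r ?expr0n // gt_eqF // divr_gt0 // addr_gt0.
rewrite -powR_mulrn ?powR_ge0 // -powRrM divfK ?pnatr_eq0 //.
by rewrite powRD ?xn ?implybT // powRr1.
Qed.

Section TpsRemainder.
Variables (R : realType) (d n : nat) (G : seq 'I_d -> 'rV[R]_d -> R).
Hypotheses (n0 : (0 < n)%N) (tG : tps_jet n G).
Variables (g H : R) (Om : set 'rV[R]_d).
Hypotheses (g0 : 0 < g) (g1 : g < 1) (H0 : 0 <= H).
Hypothesis holder : forall s p q, size s = (2 * n - 1)%N -> Om p -> Om q ->
  `|G s p - G s q| <= H * enorm (p - q) `^ g.
Let N := n.-1.
Implicit Types u v w : 'rV[R]_d.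

Let jG : jet (2 * n - 1) G. Proof. by case: tG. Qed.

Lemma mixed0 l m u w : (l <= N)%N -> (m <= N)%N -> mixed G l m u w 0 = 0.
Proof.
move=> lN mN; have [_ _ G0] := tG; rewrite /mixed tay_eq0 // => s1 s1l.
by rewrite tay_eq0 // => s2 s2m; rewrite G0 // size_cat s1l s2m; move: lN mN; rewrite /N; lia.
Qed.

(** Differentiating in a makes the middle term disappear and turns the other two into an increment,
    over the vector b w, of partials of order 2n - 1, to which the Hölder condition applies. The
    mean value bound starts from a = 0, where the second difference is zero. *)
Lemma mixed_second_diff_le u w (a b : R) :
  (forall a b : R, 0 <= a <= 1 -> 0 <= b <= 1 -> Om (a *: u + b *: w)) ->
  0 <= a <= 1 -> 0 <= b <= 1 ->
  `|mixed G N N u w (a *: u + b *: w) - mixed G N N u w (b *: w)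
    - mixed G N N u w (a *: u)| <=
  a * (norm1 u ^+ N.+1 * norm1 w ^+ N * (H * (b * enorm w) `^ g)).
Proof.
move=> hOm a01 b01; set M := norm1 u ^+ _ * _ * _.
pose f a := mixed G N N u w (a *: u + b *: w) - mixed G N N u w (b *: w)
    - mixed G N N u w (a *: u).
pose f' a := mixed G N.+1 N u w (a *: u + b *: w) - mixed G N.+1 N u w (a *: u).
have NN : (N + N < 2 * n - 1)%N by rewrite /N; lia.
have := @norm_le_powR_of_derive R f f' M 0 1 (lexx _).
rewrite add0r divr1 => /(_ _ _ _ a a01).
rewrite powRr1 ?(andP a01).1 // [M * a]mulrC; apply.
- move=> t t01; rewrite /f' -[X in X - _]subr0; apply: is_deriveB.
    by apply: is_deriveB; exact: is_derive_mixed jG NN.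
  have := is_derive_mixed u w 0 t jG NN; rewrite addr0; congr is_derive.
  by apply/funext => r; rewrite addr0.
- by rewrite /f scale0r add0r subrr sub0r mixed0 ?leqnn // oppr0.
- move=> t /andP[t0 t1]; rewrite powRr0 mulr1 /f' /mixed.
  have t01 : 0 <= t <= 1 by rewrite (ltW t0).
  rewrite -tayB /M -mulrA; apply: tay_norm_le => s1 s1N.
  rewrite -tayB; apply: tay_norm_le => s2 s2N.
  have -> : b * enorm w = enorm ((t *: u + b *: w) - t *: u).
    by rewrite addrC addKr enormZ ger0_norm ?(andP b01).1.
  apply: holder; first by rewrite size_cat s1N s2N /N; lia.
    exact: hOm.
  by have := hOm t 0 t01; rewrite scale0r addr0 lexx ler01; apply.
Qed.

(* (1 - T_x) (1 - T_y) applied to tps n (x - y), where T is the Taylor polynomial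
   of degree n - 1 at z, u = x - z and v = y - z; the term T_x T_y is absent
   because the partial derivatives of order at most 2n - 2 vanish at 0. *)
Definition tps_remainder u v : R :=
  tps n (u - v) - expsum (fun m => tay m (G^~ (- v)) u) n 1
                - expsum (fun l => tay l (G^~ u) (- v)) n 1.

Lemma tps_remainder_le u v :
  (forall a b : R, 0 <= a <= 1 -> 0 <= b <= 1 -> Om (a *: u - b *: v)) ->
  `|tps_remainder u v| <= tps_const d n g * H *
    (enorm u `^ (n%:R - (1 - g) / 2) * enorm v `^ (n%:R - (1 - g) / 2)).
Proof.
(* Moving in the direction - v makes derivatives in b free of alternating signs. *)
move=> hOm; pose w := - v; have vE : enorm v = enorm w by rewrite enormN.
have hOm' (a b : R) : 0 <= a <= 1 -> 0 <= b <= 1 -> Om (a *: u + b *: w).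
  by move=> a01 b01; rewrite /w scalerN; exact: hOm.
pose p : R := (1 + g) / 2; have p0 : 0 < p by rewrite divr_gt0 // addr_gt0.
pose mu : R := n%:R - (1 - g) / 2.
(* The exponent counts N integrations on top of the exponent p of the geometric mean. *)
have muE : mu = N%:R + p.
  by rewrite /mu /N -{1}(prednK n0) -natr1 /p; field.
pose F l m (a b : R) := mixed G l m u w (a *: u + b *: w).
pose sd : R := Num.sqrt d%:R.
(* Of the 2N + 1 = 2n - 1 directions contracted with top order partials, N + 1 are along one vector
   and N along the other; each costs a factor sqrt d. *)
pose M : R := sd ^+ (2 * N + 1) * H * (enorm u `^ mu * enorm w `^ mu).
have E1 : tps_const d n g * H * (enorm u `^ (n%:R - (1 - g) / 2) *
    enorm v `^ (n%:R - (1 - g) / 2)) =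
    M / \prod_(1 <= i < N.+1) (p + i%:R) ^+ 2.
  rewrite vE /tps_const /N prednK // -/p -/mu /M.
  have -> : d%:R `^ ((2 * n - 1)%:R / 2) = sd ^+ (2 * N + 1).
    rewrite mulrC powRrM powR12_sqrt ?ler0n // powR_mulrn ?sqrtr_ge0 //.
    by congr (_ ^+ _); rewrite /N; lia.
  by set Q := (\prod_(_ <= _ < _) _)^-1; ring.
have -> : tps_remainder u v = F 0%N 0%N 1 1
   - expsum (fun m => F m 0%N 0 1) N.+1 1 - expsum (fun l => F 0%N l 1 0) N.+1 1.
  have [_ G1 _] := tG.
  rewrite /tps_remainder /N prednK // /F /mixed /=; congr (_ - _ - _).
  - by rewrite G1 !scale1r.
  - congr (expsum _ _ _); apply/funext => m; apply: eq_tay => s _.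
    by rewrite cats0 scale0r scale1r add0r.
  - by congr (expsum _ _ _); apply/funext => m; rewrite scale0r scale1r addr0.
rewrite E1; apply: (@double_taylor_le R N F M p (ltW p0)).
- move=> l m a b lN mN; apply: is_derive_mixed jG _; move: lN mN; rewrite /N; lia.
- move=> l m a b lN mN.
  have lm : (m + l < 2 * n - 1)%N by move: lN mN; rewrite /N; lia.
  have := is_derive_mixed w u (a *: u) b jG lm.
  rewrite -(mixed_swap _ _ _ _ _ jG) addrC; congr is_derive.
  by apply/funext => t; rewrite -(mixed_swap _ _ _ _ _ jG) addrC.
- by move=> l m lN mN; rewrite /F !scale0r addr0; exact: mixed0.
move=> a b a01 b01; have [a0 _] := andP a01; have [b0 _] := andP b01.
set z := `| _ |.
have zX : z <= a * (norm1 u ^+ N.+1 * norm1 w ^+ N * (H * (b * enorm w) `^ g)).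
  have := mixed_second_diff_le hOm' a01 b01.
  by rewrite /z /F !scale0r addr0 add0r.
(* The same estimate with the two arguments exchanged, by the symmetry of mixed derivatives. *)
have zY : z <= b * (norm1 w ^+ N.+1 * norm1 u ^+ N * (H * (a * enorm u) `^ g)).
  have hOm'' (a' b' : R) : 0 <= a' <= 1 -> 0 <= b' <= 1 -> Om (a' *: w + b' *: u).
    by move=> ? ?; rewrite addrC; exact: hOm'.
  have := mixed_second_diff_le hOm'' b01 a01.
  rewrite -!(mixed_swap _ _ u w _ jG) [b *: w + _]addrC.
  by rewrite /z /F !scale0r addr0 add0r addrAC.
have U0 := enorm_ge0 u; have W0 := enorm_ge0 w.
have sd0 : 0 <= sd by exact: sqrtr_ge0.
pose U := enorm u; pose W := enorm w.
have nu : norm1 u <= sd * U by exact: norm1_le.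
have nw : norm1 w <= sd * W by exact: norm1_le.
have zX' : z <= a * ((sd * U) ^+ N.+1 * (sd * W) ^+ N * (H * (b * W) `^ g)).
  apply: le_trans zX _; apply: ler_wpM2l => //.
  apply: ler_wpM2r; first by rewrite mulr_ge0 // powR_ge0.
  by apply: ler_pM; rewrite ?exprn_ge0 ?norm1_ge0 // lerXn2r // ?nnegrE ?norm1_ge0 // mulr_ge0.
have zY' : z <= b * ((sd * W) ^+ N.+1 * (sd * U) ^+ N * (H * (a * U) `^ g)).
  apply: le_trans zY _; apply: ler_wpM2l => //.
  apply: ler_wpM2r; first by rewrite mulr_ge0 // powR_ge0.
  by apply: ler_pM; rewrite ?exprn_ge0 ?norm1_ge0 // lerXn2r // ?nnegrE ?norm1_ge0 // mulr_ge0.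
have M0 : 0 <= M by rewrite !mulr_ge0 ?exprn_ge0 ?powR_ge0.
have R0 : 0 <= M * a `^ p * b `^ p.
  by apply: mulr_ge0; [apply: mulr_ge0 => //|]; exact: powR_ge0.
(* the geometric mean of the two bounds on z *)
rewrite -(@ler_pXn2r _ 2) ?nnegrE ?normr_ge0 ?R0 //.
apply: le_trans (_ : _ <= (a * ((sd * U) ^+ N.+1 * (sd * W) ^+ N * (H * (b * W) `^ g))) *
   (b * ((sd * W) ^+ N.+1 * (sd * U) ^+ N * (H * (a * U) `^ g)))) _.
  by rewrite expr2 ler_pM ?normr_ge0.
rewrite /M -/U -/W muE.
have powmu x : 0 <= x -> x `^ (N%:R + p) = x ^+ N * x `^ p.
  move=> x0; rewrite powRD ?powR_mulrn //.
  by apply/implyP; rewrite gt_eqF // ltr_wpDl.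
rewrite !powmu // !powRM // !exprMn !sqr_powR_half //.
rewrite le_eqVlt; apply/orP; left; apply/eqP.
rewrite addn1 mul2n -addnn !exprS !exprD; ring.
Qed.

End TpsRemainder.

(** * Linear programming duality *)

Section HahnBanach.
Variables (R : realType) (N : nat) (q : 'rV[R]_N -> R).
Hypothesis qD : forall u v, q (u + v) <= q u + q v.
Hypothesis qZ : forall (c : R) v, 0 < c -> q (c *: v) <= c * q v.

Definition dotc (v : 'rV[R]_N) (w : 'cV[R]_N) : R := (v *m w) 0 0.

Lemma dotcDl u v w : dotc (u + v) w = dotc u w + dotc v w.
Proof. by rewrite /dotc mulmxDl mxE. Qed.

Lemma dotcZl c v w : dotc (c *: v) w = c * dotc v w.
Proof. by rewrite /dotc -scalemxAl mxE. Qed.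

Lemma dotcDr v w w' : dotc v (w + w') = dotc v w + dotc v w'.
Proof. by rewrite /dotc mulmxDr mxE. Qed.

Lemma dotcZr c v w : dotc v (c *: w) = c * dotc v w.
Proof. by rewrite /dotc -scalemxAr mxE. Qed.

Lemma dotcE v w : dotc v w = \sum_j v 0 j * w j 0.
Proof. by rewrite /dotc mxE. Qed.

(** The extension goes one dimension at a time, by induction on the codimension of V. A functional
    is a column vector, and extending it means changing the column without changing its values on
    V. *)
Lemma hahn_banach_rV (V : 'M[R]_N) (w0 : 'cV[R]_N) :
  (forall v, (v <= V)%MS -> dotc v w0 <= q v) ->
  exists w, (forall v, (v <= V)%MS -> dotc v w = dotc v w0) /\
            (forall v, dotc v w <= q v).
Proof.
have [k] := ubnP (N - \rank V)%N; elim: k V w0 => // k IH V w0 rk Hw.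
have [full|nfull] := boolP (row_full V).
  by exists w0; split=> // v; apply: Hw; exact: submx_full.
have /row_subPn [i0 ei0] : ~~ (1%:M <= V)%MS by rewrite sub1mx.
set e := row i0 1%:M in ei0.
(* Adding a multiple of [u], a rescaled column of [cokermx V], changes the value at [e] and none on
   V. *)
have [u [uV ue]] : exists u : 'cV[R]_N, (forall v, (v <= V)%MS -> dotc v u = 0) /\ dotc e u = 1.
  have : e *m cokermx V != 0 by rewrite -submxE.
  move=> /rV0Pn [l el]; exists (((e *m cokermx V) 0 l)^-1 *: col l (cokermx V)).
  have cE v : dotc v (col l (cokermx V)) = (v *m cokermx V) 0 l.
    by rewrite /dotc !mxE; apply: eq_bigr => j _; rewrite mxE.
  split=> [v|]; last by rewrite dotcZr cE mulVf.
  by rewrite submxE => /eqP vV; rewrite dotcZr cE vV [X in _ * X]mxE mulr0.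
(* The new value c at [e] must be an upper bound of [S] and stay below every q (v + e) - v.w0;
   subadditivity makes these requirements compatible, and c is taken to be the supremum of [S]. *)
pose S := [set r | exists2 v, (v <= V)%MS & r = dotc v w0 - q (v - e)].
have ub v' : (v' <= V)%MS -> ubound S (q (v' + e) - dotc v' w0).
  move=> v'V _ [v vV ->]; rewrite lerBlDr addrAC lerBrDr -dotcDl.
  apply: le_trans (Hw _ (addmx_sub vV v'V)) _.
  by apply: le_trans (qD _ _); rewrite addrACA subrr addr0 addrC.
have S0 : S !=set0 by exists (dotc 0 w0 - q (0 - e)), 0; rewrite ?sub0mx.
pose c := sup S.
have cl v : (v <= V)%MS -> dotc v w0 - q (v - e) <= c.
  move=> vV; apply: ub_le_sup; last by exists v.
  by exists (q (0 + e) - dotc 0 w0); apply: ub; exact: sub0mx.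
have cu v : (v <= V)%MS -> c <= q (v + e) - dotc v w0.
  by move=> vV; apply: ge_sup => //; exact: ub.
pose w' := w0 + (c - dotc e w0) *: u.
have w'E v t : (v <= V)%MS -> dotc (v + t *: e) w' = dotc v w0 + t * c.
  move=> vV; rewrite /w' dotcDl !dotcDr !dotcZl !dotcZr uV // ue; ring.
have rk' : (N - \rank (V + e)%MS < k)%N.
  have : (\rank V < \rank (V + e)%MS)%N.
    rewrite ltn_neqAle mxrankS ?addsmxSl // andbT; apply: contra ei0 => /eqP rE.
    have := mxrank_leqif_sup (addsmxSl V e); rewrite rE => /leqifP.
    case: ifP => [|_]; last by rewrite ltnn.
    by rewrite addsmx_sub => /andP[].
  have := rank_leq_col (V + e)%MS; lia.
have Hw' v : (v <= V + e)%MS -> dotc v w' <= q v.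
  case/sub_addsmxP => -[v1 t1] /= ->; set v0 := v1 *m V.
  have v0V : (v0 <= V)%MS by exact: submxMl.
  have -> : t1 *m e = t1 0 0 *: e by rewrite [t1 in LHS]mx11_scalar mul_scalar_mx.
  set t := t1 0 0; rewrite w'E //.
  have [t0|t0|->] := ltgtP t 0; last by rewrite mul0r scale0r !addr0; exact: Hw.
    pose r := - t; have r0 : 0 < r by rewrite oppr_gt0.
    have rn : r != 0 by rewrite gt_eqF.
    have rV : 0 < r^-1 by rewrite invr_gt0.
    have := cl (r^-1 *: v0) (scalemx_sub _ v0V).
    have := qZ (v0 + t *: e) rV; rewrite scalerDr scalerA.
    have -> : r^-1 * t = -1 by rewrite -[t]opprK mulrN mulVf.
    rewrite scaleN1r dotcZl => h1 h2.
    have : r^-1 * dotc v0 w0 - c <= r^-1 * q (v0 + t *: e) by lra.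
    rewrite -(ler_pM2l r0) mulrBr !mulVKf // /r mulNr opprK; lra.
  have tn : t != 0 by rewrite gt_eqF.
  have tV : 0 < t^-1 by rewrite invr_gt0.
  have := cu (t^-1 *: v0) (scalemx_sub _ v0V).
  have := qZ (v0 + t *: e) tV; rewrite scalerDr scalerA mulVf // scale1r dotcZl => h1 h2.
  have : t^-1 * dotc v0 w0 + c <= t^-1 * q (v0 + t *: e) by lra.
  by rewrite -(ler_pM2l t0) mulrDr !mulVKf.
have [w [wV wq]] := IH (V + e)%MS w' rk' Hw'.
exists w; split=> // v vV; rewrite wV; last exact: submx_trans vV (addsmxSl _ _).
by have := @w'E v 0 vV; rewrite scale0r mul0r !addr0.
Qed.

End HahnBanach.

(** The maximum of a functional over the box |v_j| <= th_j equals the least weighted l1 norm of a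
    column representing it; Hahn-Banach for the gauge of the box yields such a column. At most one
    threshold may vanish, as happens when a node coincides with z. *)
Lemma lp_duality (R : realType) (N : nat) (V : 'M[R]_N) (w0 : 'cV[R]_N)
    (th : 'I_N -> R) (r : R) :
  0 <= r -> (forall j, 0 <= th j) ->
  (forall i j, th i = 0 -> th j = 0 -> i = j) ->
  (forall v : 'rV[R]_N, (v <= V)%MS -> (forall j, `|v 0 j| <= th j) -> dotc v w0 <= r) ->
  exists w : 'cV[R]_N, (forall v : 'rV_N, (v <= V)%MS -> dotc v w = dotc v w0) /\
    \sum_j `|w j 0| * th j <= r.
Proof.
move=> r0 th0 th_uniq Hv.
(* The gauge of the box leaves out the coordinate with zero threshold; that this coordinate is 0 is
   imposed by passing to the subspace [V0]. *)
pose mx (v : 'rV[R]_N) : R := \big[Num.max/0]_(j | th j != 0) (`|v 0 j| / th j).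
have le_mx (v : 'rV_N) j : th j != 0 -> `|v 0 j| / th j <= mx v.
  by move=> tj; exact: le_bigmax_cond.
have mx_le (v : 'rV_N) (b : R) : 0 <= b -> (forall j, th j != 0 -> `|v 0 j| / th j <= b) -> mx v <= b.
  by move=> b0 H; exact: bigmax_le.
have mx0 v : 0 <= mx v by exact: bigmax_ge_id.
have thp j : th j != 0 -> 0 < th j by rewrite lt_neqAle eq_sym th0 => ->.
pose q (v : 'rV[R]_N) := r * mx v.
have qD (u v : 'rV_N) : q (u + v) <= q u + q v.
  rewrite /q -mulrDr ler_wpM2l //; apply: mx_le => [|j tj]; first by rewrite addr_ge0.
  apply: le_trans (lerD (le_mx u j tj) (le_mx v j tj)).
  by rewrite -mulrDl ler_wpM2r ?invr_ge0 // mxE ler_normD.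
have qZ (c : R) (v : 'rV_N) : 0 < c -> q (c *: v) <= c * q v.
  move=> c0; rewrite /q mulrCA ler_wpM2l //; apply: mx_le => [|j tj].
    by rewrite mulr_ge0 // ltW.
  by rewrite mxE normrM (gtr0_norm c0) -mulrA ler_wpM2l ?le_mx // ltW.
pose B : 'cV[R]_N := \col_j (th j == 0)%:R.
have BE (v : 'rV_N) j : th j = 0 -> dotc v B = v 0 j.
  move=> tj; rewrite dotcE (bigD1 j) //= mxE tj eqxx mulr1 big1 ?addr0 // => i ij.
  rewrite mxE; case: eqP => [ti|_]; last by rewrite mulr0.
  by move: ij; rewrite (th_uniq i j ti tj) eqxx.
pose V0 := (V :&: kermx B)%MS.
have V0P (v : 'rV_N) : (v <= V)%MS -> dotc v B = 0 -> (v <= V0)%MS.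
  move=> vV vB; rewrite sub_capmx vV; apply/sub_kermxP/matrixP => i j.
  by rewrite !ord1 [RHS]mxE.
have V0B (v : 'rV_N) : (v <= V0)%MS -> (v <= V)%MS /\ dotc v B = 0.
  by rewrite sub_capmx => /andP[-> /sub_kermxP vB]; rewrite /dotc vB mxE.
have [|w1 [w1V w1q]] := @hahn_banach_rV R N q qD qZ V0 w0.
  move=> v /V0B[vV vB].
  have v0 j : th j = 0 -> v 0 j = 0 by move=> tj; rewrite -(BE v j tj).
  have := mx0 v; rewrite le_eqVlt => /predU1P[m0|m0].
    have -> : v = 0.
      apply/rowP => j; rewrite mxE; have [tj|tj] := eqVneq (th j) 0; first exact: v0.
      have := le_mx v j tj; rewrite -m0 pmulr_lle0 ?invr_gt0 ?thp // normr_le0.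
      by move=> /eqP.
    by rewrite dotcE big1 ?mulr_ge0 // => j _; rewrite mxE mul0r.
  have := Hv ((mx v)^-1 *: v) (scalemx_sub _ vV).
  rewrite dotcZl mulrC ler_pdivrMr //; apply => j.
  rewrite mxE normrM ger0_norm ?invr_ge0 // mulrC ler_pdivrMr //.
  have [tj|tj] := eqVneq (th j) 0; first by rewrite v0 // normr0 mulr_ge0.
  by rewrite mulrC -ler_pdivrMr ?thp //; exact: le_mx.
have sum_w1 : \sum_j `|w1 j 0| * th j <= r.
  (* This corner of the box attains the weighted l1 norm. *)
  pose v : 'rV[R]_N := \row_j (Num.sg (w1 j 0) * th j).
  have <- : dotc v w1 = \sum_j `|w1 j 0| * th j.
    rewrite dotcE; apply: eq_bigr => j _; rewrite mxE [in RHS]normrEsg; ring.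
  apply: le_trans (w1q v) _; rewrite /q ler_piMr //.
  apply: mx_le => // j tj; rewrite ler_pdivrMr ?thp // mul1r mxE normrM.
  rewrite (ger0_norm (th0 j)) ler_piMl // normr_sg; by case: eqP.
(* If some v1 in V has a nonzero entry at zero threshold, a multiple of [B] corrects the value at v1
   at no cost in the weighted sum. Otherwise [V0] is all of V. *)
have [[v1 [v1V v1B]]|no] := pselect (exists v1 : 'rV_N, (v1 <= V)%MS /\ dotc v1 B <> 0).
  have b0 : dotc v1 B != 0 by apply/eqP.
  pose c := (dotc v1 w0 - dotc v1 w1) / dotc v1 B.
  exists (w1 + c *: B); split=> [v vV|]; last first.
    apply: le_trans sum_w1; apply: ler_sum => j _; rewrite !mxE.
    by case: eqP => [->|_]; rewrite ?mulr0 // addr0.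
  pose v' := v - (dotc v B / dotc v1 B) *: v1.
  have v'V0 : (v' <= V0)%MS.
    apply: V0P; first by rewrite addmx_sub // eqmx_opp scalemx_sub.
    by rewrite /v' -scaleNr dotcDl dotcZl mulNr divfK // subrr.
  have := w1V _ v'V0; rewrite /v' -scaleNr !dotcDl !dotcZl dotcDr dotcZr /c => E.
  have -> : dotc v w1 = dotc v w0 - dotc v B / dotc v1 B * dotc v1 w0
     + dotc v B / dotc v1 B * dotc v1 w1.
    by move: E; rewrite !mulNr => <-; ring.
  by field.
exists w1; split=> // v vV; apply: w1V; apply: V0P => //.
by apply: contra_notP no => vB; exists v.
Qed.

(** * Derivatives of functions of the native space *)

Lemma norm_diff_le_of_derive (R : realType) (f f' : R -> R) (M dl t : R) :
  (forall u : R, `|u| < dl -> is_derive u 1 f (f' u)) ->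
  (forall u : R, `|u| < dl -> `|f' u| <= M) -> `|t| < dl ->
  `|f t - f 0| <= M * `|t|.
Proof.
move=> df f'M tdl; have [t0|t0|->] := ltgtP t 0; last first.
- by rewrite subrr normr0 mulr0.
- have [u /andP[u0 ut]|c /andP[c0 ct] ->] := @MVT_cc R f f' 0 t t0.
    by apply: df; rewrite ger0_norm // (le_lt_trans ut) // -(gtr0_norm t0).
  rewrite subr0 normrM ler_wpM2r //; apply: f'M.
  by rewrite gtr0_norm // (lt_trans ct) // -(gtr0_norm t0).
- have t0n : `|t| = - t by rewrite ltr0_norm.
  have [u /andP[tu u0]|c /andP[tc c0] E] := @MVT_cc R f f' t 0 t0.
    by apply: df; rewrite ler0_norm // (le_lt_trans _ tdl) // t0n lerN2.
  rewrite distrC E sub0r normrM normrN ler_wpM2r //; apply: f'M.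
  by rewrite ltr0_norm // (lt_trans _ tdl) // t0n ltrN2.
Qed.

Lemma is_derive_lim (R : realType) (phi psi : nat -> R -> R) (f : R -> R) (L dl : R) :
  0 < dl ->
  (forall m (t : R), `|t| < dl -> is_derive t 1 (phi m) (psi m t)) ->
  (forall t : R, `|t| < dl -> phi m t @[m --> \oo] --> f t) ->
  (forall e : R, 0 < e -> exists m0 : nat, forall m l, (m0 <= m)%N -> (m0 <= l)%N ->
     forall t : R, `|t| < dl -> `|psi m t - psi l t| <= e) ->
  psi m 0 @[m --> \oo] --> L ->
  is_derive (0 : R) 1 f L.
Proof.
move=> dl0 dphi phif psiC psiL.
have H : h^-1 *: ((f \o shift 0) (h *: (1 : R)) - f 0) @[h --> 0^'] --> L.
  apply/cvgrPdist_le => e e0; have e3 : 0 < e / 3 by rewrite divr_gt0.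
  have [m0 Hm0] := psiC _ e3.
  have z0 : `|0 : R| < dl by rewrite normr0.
  have psi0L : `|psi m0 0 - L| <= e / 3.
    have : `|psi m0 0 - psi l 0| @[l --> \oo] --> `|psi m0 0 - L|.
      by apply: cvg_norm; apply: cvgB => //; exact: cvg_cst.
    move=> C; rewrite -subr_ge0.
    have C' : e / 3 - `|psi m0 0 - psi l 0| @[l --> \oo] --> e / 3 - `|psi m0 0 - L|.
      by apply: cvgB => //; exact: cvg_cst.
    apply: cvg_ge0 C'.
    by exists m0 => // l /= m0l; rewrite subr_ge0; exact: Hm0.
  (* The mean value bound on phi l - phi m0 is uniform in l, so it survives the limit in l and
     compares the increments of [f] with those of a single phi m0. *)
  have part1 t : `|t| < dl ->
      `|(f t - f 0) - (phi m0 t - phi m0 0)| <= e / 3 * `|t|.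
    move=> tdl.
    have : `|(phi l t - phi l 0) - (phi m0 t - phi m0 0)| @[l --> \oo] -->
       `|(f t - f 0) - (phi m0 t - phi m0 0)|.
      apply: cvg_norm; apply: cvgB; last exact: cvg_cst.
      by apply: cvgB; apply: phif.
    move=> C; rewrite -subr_ge0.
    have C' : e / 3 * `|t| - `|(phi l t - phi l 0) - (phi m0 t - phi m0 0)| @[l --> \oo]
       --> e / 3 * `|t| - `|(f t - f 0) - (phi m0 t - phi m0 0)|.
      by apply: cvgB => //; exact: cvg_cst.
    apply: cvg_ge0 C'.
    exists m0 => // l /= m0l; rewrite subr_ge0.
    have := @norm_diff_le_of_derive R (phi l \- phi m0)
      (fun u => psi l u - psi m0 u) (e / 3) dl t.
    rewrite /= [X in `|X| <= _](_ : _ = phi l t - phi l 0 - (phi m0 t - phi m0 0)); last by ring.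
    apply => //; last by move=> u udl; exact: Hm0.
    by move=> u udl; apply: is_deriveB; exact: dphi.
  have D : h^-1 *: ((phi m0 \o shift 0) (h *: (1 : R)) - phi m0 0) @[h --> 0^']
      --> psi m0 0.
    have [dm <-] := dphi m0 0 z0.
    exact: dm.
  move/cvgrPdist_le : D => /(_ _ e3) D.
  near=> h; rewrite /= addr0 [h *: 1]mulr1.
  have h0 : h != 0 by near: h; exact: nbhs_dnbhs_neq.
  have hp : 0 < `|h| by rewrite normr_gt0.
  have hdl : `|h| < dl.
    near: h; apply: nbhs_dnbhs; exists dl => [|u] /=; first exact: dl0.
    by rewrite sub0r normrN.
  have p2 : `|psi m0 0 - h^-1 *: ((phi m0 \o shift 0) (h *: (1 : R)) - phi m0 0)| <= e / 3.
    by near: h.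
  rewrite /= addr0 [h *: 1]mulr1 in p2.
  have p1 := part1 h hdl.
  have p1' : `|h^-1 *: (f h - f 0) - h^-1 *: (phi m0 h - phi m0 0)| <= e / 3.
    by rewrite -scalerBr normrM normfV mulrC ler_pdivrMr.
  have -> : L - h^-1 *: (f h - f 0) = - (psi m0 0 - L) +
    (psi m0 0 - h^-1 *: (phi m0 h - phi m0 0)) -
    (h^-1 *: (f h - f 0) - h^-1 *: (phi m0 h - phi m0 0)) by ring.
  have -> : e = e / 3 + e / 3 + e / 3 by field.
  apply: le_trans (ler_normB _ _) _; apply: lerD => //.
  by apply: le_trans (ler_normD _ _) _; rewrite normrN lerD.
split; first by apply/cvg_ex; exists L.
exact: cvg_lim H.
Unshelve. all: by end_near. Qed.

Lemma uniform_cauchy_cvg (R : realType) (u : nat -> R) :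
  (forall e : R, 0 < e -> exists m0 : nat, forall m l, (m0 <= m)%N -> (m0 <= l)%N ->
     `|u m - u l| <= e) -> cvg (u m @[m --> \oo]).
Proof.
move=> uC; apply: cauchy_cvg; apply: cauchy_exP => e e0.
have [m0 Hm0] := uC (e / 2) ltac:(by rewrite divr_gt0).
exists (u m0); exists m0 => // m /= m0m; rewrite /ball /=.
by apply: le_lt_trans (Hm0 _ _ (leqnn _) m0m) _; rewrite ltr_pdivrMr // ltr_pMr // ltr1n.
Qed.

Section NativeSpace.
Variables (R : realType) (d n s : nat) (G : seq 'I_d -> 'rV[R]_d -> R).
Hypotheses (n0 : (0 < n)%N) (ns : (n < s)%N) (tG : tps_jet n G).
Local Notation K := (@tps_kernel R d n).
Implicit Types (h : 'rV[R]_d -> R) (l : seq 'I_d).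

Lemma pre_native_jet h c : pre_native s K h c ->
  exists2 H, jet (2 * n - 1) H & H [::] = h.
Proof.
move=> [m [b [y [p [_ _ -> _]]]]]; have [jG G1 _] := tG.
exists (fun l x => \sum_i b i * G l (x - y i) + peval (mds l p) x).
  exact: jetD (jet_sum (index_enum 'I_m) b (fun i => jet_shift (y i) jG))
              (jet_peval (2 * n - 1) p).
by apply/funext => x /=; rewrite G1.
Qed.

Lemma pre_native_functional_le (k : nat) (J : finType) (a : J -> R)
    (sq : J -> seq 'I_d) (z : 'rV[R]_d) (I : finType) (w : I -> R)
    (x : I -> 'rV[R]_d) h c : (k < n)%N -> (forall j, (size (sq j) <= k)%N) ->
  (forall p, Pi s p ->
    \sum_i w i * peval p (x i) = \sum_j a j * peval (mds (sq j) p) z) ->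
  pre_native s K h c ->
  `|\sum_j a j * ds (sq j) h z - \sum_i w i * h (x i)| <=
  c * Num.sqrt (jet_form n G a sq z w x).
Proof.
move=> kn sqk wex [m [b [y [p [ps hb -> ->]]]]].
have := @jet_functional_sqr_le R d n k s G kn ns tG J a sq z sqk I w x wex _ b y p ps hb.
pose form := \sum_i \sum_j b i * b j * tps n (y i - y j).
rewrite -/form => H; rewrite -[X in _ <= X * _]/(Num.sqrt form).
have f0 : 0 <= form by apply: tps_cond_psd => // q qn; apply: hb; exact: Pi_leq ns qn.
rewrite -sqrtrM // -sqrtr_sqr; apply: ler_wsqrtr; exact: H.
Qed.

(** The semi-norm does not control polynomials. Subtracting the derivative of the grid interpolant
    yields a functional that annihilates [Pi s], so the semi-norm together with the values on one
    fixed grid controls every derivative. *)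
Lemma pre_native_ds_le l (x : 'rV[R]_d) h c : (size l < n)%N -> pre_native s K h c ->
  `|ds l h x - \sum_(g : {ffun 'I_d -> 'I_s}) peval (mds l (grid_poly R g)) x * h (grid_pt R g)| <=
  c * Num.sqrt (jet_form n G (fun _ : 'I_1 => 1) (fun=> l) x
    (fun g : {ffun 'I_d -> 'I_s} => peval (mds l (grid_poly R g)) x)
    (fun g => grid_pt R g)).
Proof.
move=> ln hc.
have := @pre_native_functional_le (size l) 'I_1 (fun=> 1) (fun=> l) x
  {ffun 'I_d -> 'I_s} (fun g => peval (mds l (grid_poly R g)) x)
  (fun g => grid_pt R g) h c ln (fun=> leqnn _) _ hc.
rewrite big_ord1 mul1r; apply => p ps; rewrite big_ord1 mul1r (grid_exact_mds _ _ ps).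
by apply: eq_bigr => g _; rewrite mulrC.
Qed.

Lemma near0_bounded (phi : R -> R) : {for 0, continuous phi} ->
  exists C, 0 <= C /\ \forall t \near (0 : R), `|phi t| <= C.
Proof.
move=> /cvgrPdist_le /(_ 1 ltr01) H; exists (`|phi 0| + 1); split.
  by rewrite addr_ge0.
near=> t; have : `|phi 0 - phi t| <= 1 by near: t.
rewrite distrC => P.
have -> : phi t = phi 0 + (phi t - phi 0) by rewrite addrC subrK.
by apply: le_trans (ler_normD _ _) _; rewrite lerD2l.
Unshelve. all: by end_near. Qed.

(** The interpolation weights and the dual norm depend continuously on the point, so near t = 0 one
    constant serves all functions at once. *)
Lemma pre_native_ds_line_le l (x v : 'rV[R]_d) : (size l < n)%N ->
  exists C dl : R, [/\ 0 <= C, 0 < dl & forall h c t, pre_native s K h c ->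
    `|t| < dl -> `|ds l h (t *: v + x)| <=
       C * (\sum_(g : {ffun 'I_d -> 'I_s}) `|h (grid_pt R g)| + c)].
Proof.
move=> ln; pose wt (g : {ffun 'I_d -> 'I_s}) (t : R) :=
  peval (mds l (grid_poly R g)) (t *: v + x).
pose JF t := jet_form n G (fun _ : 'I_1 => 1) (fun=> l) (t *: v + x)
    (fun g => wt g t) (fun g => grid_pt R g).
have [jG G1 _] := tG.
have wtc g : {for 0, continuous (wt g)}.
  exact: (@jet_continuous R d (size l).+1 (fun l => peval (mds l (grid_poly R g)))
            l x v 0 (jet_peval _ _) (ltnSn _)).
have JFc : {for 0, continuous JF}.
  apply: cvgD.
    apply: cvg_cMr; apply: cvg_sumr => g; apply: cvgM; first exact: wtc.
    apply: cvg_sumr => j; apply: cvg_cMr.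
    have lr : (size l < 2 * n - 1)%N by lia.
    exact: (@jet_continuous R d _ _ l x v 0 (jet_shift (grid_pt R g) jG) lr).
  apply: cvg_sumr => g; apply: cvg_sumr => g'.
  by apply: cvgM; [apply: cvgM; exact: wtc | exact: cvg_cst].
have [C1 [C10 HC1]] := near0_bounded JFc.
have [C2 [C20 HC2]] : exists C, 0 <= C /\ \forall t \near (0 : R), forall g, `|wt g t| <= C.
  have W g := near0_bounded (wtc g).
  have [Cg HCg] := choice W.
  exists (\sum_g Cg g); split; first by apply: sumr_ge0 => g _; have [] := HCg g.
  apply: (@filter_forall _ {ffun 'I_d -> 'I_s}
    (fun g => [set t | `|wt g t| <= \sum_g0 Cg g0]) (nbhs (0 : R))) => g.
  have [Cg0 HC] := HCg g.
  near=> t; apply: (@le_trans _ _ (Cg g)); first by near: t.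
  by rewrite (bigD1 g) //= lerDl sumr_ge0 // => g' _; have [] := HCg g'.
have : \forall t \near (0 : R), `|JF t| <= C1 /\ forall g, `|wt g t| <= C2.
  by near=> t; split; near: t.
move=> [dl /= dl0 Hdl].
exists (C2 + Num.sqrt C1), dl; split=> //; first by rewrite addr_ge0 ?sqrtr_ge0.
move=> h c t hc tdl.
have [JFt wtt] := Hdl t ltac:(by rewrite /= sub0r normrN).
have c0 : 0 <= c by have [m [b [y [p [_ _ _ ->]]]]] := hc; exact: sqrtr_ge0.
have := pre_native_ds_le (t *: v + x) ln hc; rewrite -/(JF t) => H.
rewrite -(subrK (\sum_g wt g t * h (grid_pt R g)) (ds l h _)).
apply: le_trans (ler_normD _ _) _.
rewrite mulrDl addrC mulrDr -addrA; apply: lerD.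
  rewrite mulr_sumr; apply: le_trans (ler_norm_sum _ _ _) _; apply: ler_sum => g _.
  by rewrite normrM ler_wpM2r.
apply: le_trans H _; apply: (@le_trans _ _ (Num.sqrt C1 * c)).
  rewrite mulrC ler_wpM2r //; apply: ler_wsqrtr; exact: le_trans (ler_norm _) JFt.
rewrite mulrDr addrA lerDr addr_ge0 ?mulr_ge0 ?sqrtr_ge0 // sumr_ge0 //.
Unshelve. all: by end_near. Qed.

Section Limit.
Variables (h : nat -> 'rV[R]_d -> R) (e : nat -> R) (f : 'rV[R]_d -> R).
Hypothesis he : forall m, pre_native s K (h m) (e m).
Hypothesis hC : forall eps : R, 0 < eps -> exists m0 : nat, forall m l : nat,
  (m0 <= m)%N -> (m0 <= l)%N ->
  exists2 t, pre_native s K (fun x => h m x - h l x) t & t < eps.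
Hypothesis hf : forall x, (fun m => h m x) @ \oo --> f x.

Lemma ds_pre_nativeB m m' l : (size l <= 2 * n - 1)%N ->
  ds l (fun x => h m x - h m' x) = (fun x => ds l (h m) x - ds l (h m') x).
Proof.
move=> lr; have [H1 j1 <-] := pre_native_jet (he m).
have [H2 j2 <-] := pre_native_jet (he m').
rewrite (jet_ds j1 lr) (jet_ds j2 lr).
(* A sum over the singleton [[:: tt]] with coefficient -1 encodes the opposite of a jet. *)
have j3 := jetD j1 (jet_sum [:: tt] (fun=> -1) (fun=> j2)).
have := jet_ds j3 lr => /=.
have -> : (fun x => H1 [::] x + \sum_(i <- [:: tt]) -1 * H2 [::] x) =
          (fun x => H1 [::] x - H2 [::] x).
  by apply/funext => x; rewrite big_seq1 mulN1r.
by move=> ->; apply/funext => x; rewrite big_seq1 mulN1r.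
Qed.

Lemma ds_native_uniform_cauchy l (x v : 'rV[R]_d) : (size l < n)%N ->
  exists2 dl : R, 0 < dl & forall eps : R, 0 < eps -> exists m0 : nat,
    forall m m', (m0 <= m)%N -> (m0 <= m')%N -> forall t : R, `|t| < dl ->
    `|ds l (h m) (t *: v + x) - ds l (h m') (t *: v + x)| <= eps.
Proof.
move=> ln; have [C [dl [C0 dl0 HC]]] := pre_native_ds_line_le x v ln.
exists dl => // eps eps0.
have C1 : 0 < C + 1 by rewrite ltr_wpDl.
(* There are three contributions: the distances on the grid from each of the two functions to the
   limit, and the semi-norm of their difference. *)
pose ep := eps / (3 * (C + 1)).
have ep0 : 0 < ep by rewrite divr_gt0 // mulr_gt0.
have [m1 Hm1] := hC ep0.
have S : \sum_(g : {ffun 'I_d -> 'I_s}) `|h m (grid_pt R g) - f (grid_pt R g)|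
     @[m --> \oo] --> \sum_(g : {ffun 'I_d -> 'I_s}) (0 : R).
  apply: cvg_sumr => g; rewrite -[X in _ --> X](normr0 R).
  rewrite -[in X in _ --> X](subrr (f (grid_pt R g))).
  by apply: cvg_norm; apply: cvgB; [exact: hf|exact: cvg_cst].
rewrite big1_eq in S; move/cvgrPdist_le : S => /(_ _ ep0) [m2 _ Hm2].
exists (maxn m1 m2) => m m'; rewrite !geq_max => /andP[m1m m2m] /andP[m1m' m2m'] t tdl.
have [c hc cep] := Hm1 m m' m1m m1m'.
have lr : (size l <= 2 * n - 1)%N by lia.
have := HC _ c t hc tdl; rewrite ds_pre_nativeB // => H.
apply: le_trans H _.
have Sm (m3 : nat) : (m2 <= m3)%N ->
    \sum_(g : {ffun 'I_d -> 'I_s}) `|h m3 (grid_pt R g) - f (grid_pt R g)| <= ep.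
  by move=> /Hm2 /=; rewrite sub0r normrN; apply: le_trans (ler_norm _).
have Smm : \sum_(g : {ffun 'I_d -> 'I_s}) `|h m (grid_pt R g) - h m' (grid_pt R g)| <= ep + ep.
  apply: le_trans (lerD (Sm m m2m) (Sm m' m2m')); rewrite -big_split /=.
  apply: ler_sum => g _; rewrite [X in _ <= _ + X]distrC.
  by apply: le_trans (ler_normD _ _); rewrite addrA subrK.
apply: (@le_trans _ _ ((C + 1) * (ep + ep + ep))).
  apply: ler_pM => //.
  - by rewrite addr_ge0 ?sumr_ge0 //; have [? [? [? [? [_ _ _ ->]]]]] := hc; exact: sqrtr_ge0.
  - by rewrite lerDl.
  - by apply: lerD => //; exact: ltW.
rewrite /ep le_eqVlt; apply/orP; left; apply/eqP; field.
by rewrite gt_eqF.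
Qed.

(** Differentiability of [f] comes out of the induction: the derivatives of the previous order
    converge to those of [f], and the next ones are uniformly Cauchy along a coordinate line. *)
Lemma ds_native_cvg l (x : 'rV[R]_d) : (size l < n)%N ->
  ds l (h m) x @[m --> \oo] --> ds l f x.
Proof.
elim: l x => [|i l IH] x ln; first exact: hf.
pose v : 'rV[R]_d := delta_mx 0 i.
have [dl dl0 HC] := ds_native_uniform_cauchy x v ln.
have L : cvg (ds (i :: l) (h m) x @[m --> \oo]).
  apply: uniform_cauchy_cvg => eps /HC[m0 Hm0]; exists m0 => m m' mm mm'.
  by have := Hm0 m m' mm mm' 0; rewrite normr0 scale0r add0r; apply.
have dv : forall m (t : R), `|t| < dl ->
    is_derive t 1 (fun t => ds l (h m) (t *: v + x)) (ds (i :: l) (h m) (t *: v + x)).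
  move=> m t _; have [H jH <-] := pre_native_jet (he m).
  have lr : (size l < 2 * n - 1)%N by move: ln => /=; lia.
  rewrite (@jet_ds _ _ _ _ (i :: l) jH lr) (@jet_ds _ _ _ _ l jH (ltnW lr)).
  have := is_derive_jet x v t jH lr; congr is_derive.
  rewrite (bigD1 i) //= mxE !eqxx mul1r big1 ?addr0 // => j /negbTE ji.
  by rewrite mxE eqxx ji mul0r.
have E0 : (fun m => ds (i :: l) (h m) (0 *: v + x)) = (fun m => ds (i :: l) (h m) x).
  by apply/funext => m; rewrite scale0r add0r.
have L0 := L; rewrite -E0 in L0.
have D := @is_derive_lim R (fun m t => ds l (h m) (t *: v + x))
  (fun m t => ds (i :: l) (h m) (t *: v + x)) (fun t => ds l f (t *: v + x))
  _ dl dl0 dv (fun t _ => IH _ (ltnW ln)) HC L0.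
have E : ds (i :: l) f x = lim (ds (i :: l) (h m) (0 *: v + x) @[m --> \oo]).
  exact: derive_line D.
by rewrite E E0; exact: L.
Qed.

End Limit.
End NativeSpace.

(** * The error functional on the kernel *)

Section KernelForm.
Variables (R : realType) (d n k s : nat) (G : seq 'I_d -> 'rV[R]_d -> R).
Hypotheses (n0 : (0 < n)%N) (kn : (k < n)%N) (ns : (n < s)%N) (tG : tps_jet n G).

Let jG : jet (2 * n - 1) G. Proof. by case: tG. Qed.

(** Phi is even and each derivative changes the parity. This reconciles the Taylor polynomials in
    the two arguments of K. *)
Lemma tps_jetN l (x : 'rV[R]_d) : (size l <= 2 * n - 1)%N ->
  G l (- x) = (-1) ^+ size l * G l x.
Proof.
have [_ G1 _] := tG.
elim: l x => [|i l IH] x lr; first by rewrite G1 tpsN mul1r.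
pose e : 'rV[R]_d := delta_mx 0 i.
have sumE (c : R) y : \sum_j (c *: e) 0 j * G (j :: l) y = c * G (i :: l) y.
  rewrite (bigD1 i) //= !mxE !eqxx mulr1 big1 ?addr0 // => j /negbTE ji.
  by rewrite !mxE ji andbF mulr0 mul0r.
have d1 := jG.2 l (- x) (1 *: e) lr.
have d2 := is_derive_cMr ((-1) ^+ size l) (jG.2 l x (-1 *: e) lr).
rewrite !sumE in d1 d2.
have E : (fun t : R => G l (t *: (1 *: e) - x)) =
         (fun t : R => (-1) ^+ size l * G l (t *: (-1 *: e) + x)).
  apply/funext => t; rewrite -IH; last exact: ltnW.
  by rewrite opprD scale1r scaleN1r scalerN opprK.
rewrite E in d1; have := @derive_val _ _ _ _ _ _ _ d1.
rewrite (@derive_val _ _ _ _ _ _ _ d2) mul1r => <-.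
by rewrite [size _]/= exprS; ring.
Qed.

Variables (J : finType) (a : J -> R) (sq : J -> seq 'I_d) (z : 'rV[R]_d).
Hypothesis sqk : forall j, (size (sq j) <= k)%N.
Variables (I : finType) (x : I -> 'rV[R]_d).

(** Let e = w1 - w, which annihilates [Pi s]. By the kernel equations D'K minus the kernel
    combination of [w] is a polynomial on the nodes, so e kills it; the cross terms cancel and the
    forms differ by exactly the form of e, which is nonnegative. *)
Lemma jet_form_min (w w1 : I -> R) (r : 'rV[R]_d -> R) :
  (forall p, Pi s p -> \sum_i w i * peval p (x i) = \sum_i w1 i * peval p (x i)) ->
  (exists2 p, Pi s p & forall i, r (x i) = peval p (x i)) ->
  (forall i, \sum_j w j * tps n (x i - x j) + r (x i) =
             \sum_j a j * G (sq j) (z - x i)) ->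
  jet_form n G a sq z w x <= jet_form n G a sq z w1 x.
Proof.
move=> ww1 [p ps rp] hw.
pose e i := w1 i - w i.
have ep q : Pi s q -> \sum_i e i * peval q (x i) = 0.
  move=> qs; under eq_bigr do rewrite mulrBl; rewrite sumrB -(ww1 q qs) subrr //.
have ee : 0 <= \sum_i \sum_j e i * e j * tps n (x i - x j).
  by apply: tps_cond_psd => // q qn; apply: ep; exact: Pi_leq ns qn.
rewrite -subr_ge0; move: ee; apply: ge0_eq.
pose DK i := \sum_j a j * G (sq j) (z - x i).
pose T w2 w3 := \sum_i \sum_j w2 i * w3 j * tps n (x i - x j) : R.
have symm u v : tps n (u - v) = tps n (v - u) :> R by rewrite -tpsN opprB.
have TC w2 w3 : T w2 w3 = T w3 w2.
  rewrite /T exchange_big; apply: eq_bigr => i _; apply: eq_bigr => j _.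
  by rewrite symm [w2 _ * _]mulrC.
have TD w2 w3 w4 : T (fun i => w2 i - w3 i) w4 = T w2 w4 - T w3 w4.
  rewrite /T -sumrB; apply: eq_bigr => i _; rewrite -sumrB.
  by apply: eq_bigr => j _; ring.
have TeDK : T e w = \sum_i e i * DK i.
  transitivity (\sum_i e i * (DK i - r (x i))).
    rewrite /T; apply: eq_bigr => i _; rewrite -/(DK i) /DK -hw addrK mulr_sumr.
    by apply: eq_bigr => j _; ring.
  under eq_bigr do rewrite mulrBr rp; rewrite sumrB (ep p ps) subr0 //.
have sDK : \sum_i e i * DK i = \sum_i w1 i * DK i - \sum_i w i * DK i.
  by rewrite -sumrB; apply: eq_bigr => i _; rewrite mulrBl.
rewrite /jet_form -/(T w1 w1) -/(T w w) -/(T e e).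
have -> : \sum_i w1 i * \sum_j a j * G (sq j) (z - x i) = \sum_i w1 i * DK i by [].
have -> : \sum_i w i * \sum_j a j * G (sq j) (z - x i) = \sum_i w i * DK i by [].
have TDr w2 w3 w4 : T w4 (fun i => w2 i - w3 i) = T w4 w2 - T w4 w3.
  by rewrite TC TD (TC w2) (TC w3).
have e1 : T e e = T e w1 - T e w by exact: TDr.
have e2 : T e w1 = T w1 w1 - T w w1 by exact: TD.
have e3 : T e w = T w1 w - T w w by exact: TD.
move: sDK; rewrite -TeDK => sDK; have := TC w w1; lra.
Qed.

(** The Taylor polynomials have degree n - 1, below s, so [w] is exact on them, and as k < n their
    derivatives at z are those of the kernel. Each of the two Taylor sums thus contributes - sum_i
    w_i D'K(z, x_i), which makes up the coefficient -2 of [jet_form]. *)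
Lemma jet_form_remainder (w : I -> R) :
  (forall p, Pi s p ->
    \sum_i w i * peval p (x i) = \sum_j a j * peval (mds (sq j) p) z) ->
  jet_form n G a sq z w x =
  \sum_i \sum_j w i * w j * tps_remainder n G (x i - z) (x j - z).
Proof.
move=> wex; pose DK i := \sum_j a j * G (sq j) (z - x i).
have tayE j : \sum_i w i * expsum (fun m => tay m (G^~ (- (x j - z))) (x i - z)) n 1 = DK j.
  transitivity (\sum_i w i * peval (taylor n (G^~ (- (x j - z))) z) (x i)).
    apply: eq_bigr => i _.
    by have := peval_taylor n (G^~ (- (x j - z))) z (x i - z) 1; rewrite scale1r subrK => ->.
  rewrite wex; last by apply: Pi_leq (Pi_taylor _ _ _); exact: ltnW.
  apply: eq_bigr => l _; rewrite peval_mds_taylor ?opprB //.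
    by move=> s1 s2 s12; rewrite (jG.1 _ _ s12).
  exact: leq_ltn_trans (sqk l) kn.
have tayE' i j : expsum (fun l => tay l (G^~ (x i - z)) (- (x j - z))) n 1 =
    expsum (fun l => tay l (G^~ (- (x i - z))) (x j - z)) n 1.
  rewrite /expsum !big_nat; apply: eq_bigr => l /andP[_ ln]; congr (_ * _ * _).
  rewrite -[in LHS](scaleN1r (x j - z)) tayZ.
  transitivity (tay l (fun s' => \sum_(u <- [:: tt]) (-1) ^+ l * G s' (x i - z)) (x j - z)).
    by rewrite tay_sum big_seq1.
  apply: eq_tay => s' sl; rewrite big_seq1 -{1}sl tps_jetN //; lia.
pose E i j := expsum (fun m => tay m (G^~ (- (x j - z))) (x i - z)) n 1.
have S1 : \sum_i \sum_j w i * w j * E j i = \sum_i w i * DK i.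
  apply: eq_bigr => i _; rewrite -tayE mulr_sumr.
  by apply: eq_bigr => j _; rewrite mulrA.
have S2 : \sum_i \sum_j w i * w j * E i j = \sum_i w i * DK i.
  rewrite exchange_big -S1; apply: eq_bigr => i _; apply: eq_bigr => j _ /=.
  by rewrite [w j * w i]mulrC.
have -> : \sum_i \sum_j w i * w j * tps_remainder n G (x i - z) (x j - z) =
  \sum_i \sum_j w i * w j * tps n (x i - x j) -
  \sum_i \sum_j w i * w j * E i j - \sum_i \sum_j w i * w j * E j i.
  rewrite -!sumrB; apply: eq_bigr => i _; rewrite -!sumrB.
  apply: eq_bigr => j _; rewrite /tps_remainder tayE' /E.
  by rewrite opprB addrA subrK; ring.
by rewrite S1 S2 /jet_form -/(DK _); ring.
Qed.

(** At a node equal to z the remainder is exactly zero. This settles the degenerate case of the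
    bound, where the Hölder semi-norm might be infinite and no estimate is available. *)
Lemma tps_remainder0l v : tps_remainder n G 0 v = 0.
Proof.
clear kn ns; have [_ G1 G0] := tG; rewrite /tps_remainder sub0r.
have -> : expsum (fun m => tay m (G^~ (- v)) 0) n 1 = tps n (- v).
  rewrite /expsum -{1}(prednK n0) big_nat_recl // fact0 invr1 mul1r mulr1 /= G1.
  by rewrite big1 ?addr0 // => i _; rewrite big1 ?mulr0 ?mul0r // => j _; rewrite mxE mul0r.
have -> : expsum (fun l => tay l (G^~ 0) (- v)) n 1 = 0.
  rewrite /expsum big_nat big1 // => l /andP[_ ln].
  by rewrite tay_eq0 ?mulr0 ?mul0r // => s' sl; rewrite G0 // sl; lia.
by rewrite subrr subr0.
Qed.

End KernelForm.

(** * The Hölder semi-norm and the differences of points of the star *)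

Section HolderLink.
Variables (R : realType) (d : nat).

Lemma mnm_seq_count (l : seq 'I_d) :
  perm_eq (mnm_seq (mpoly.Multinom [tuple count_mem i l | i < d])) l.
Proof.
apply/allP => i _ /=; apply/eqP.
rewrite /mnm_seq count_flatten -map_comp sumnE big_map big_enum /= (bigD1 i) //=.
rewrite count_nseq /= eqxx mul1n big1 ?addn0 => [|j /negbTE ji]; last first.
  by rewrite count_nseq /= ji.
by rewrite mpoly.multinomE tnth_mktuple.
Qed.

Lemma holder_seminorm_le n G g (Om : set 'rV[R]_d) (H : R) : tps_jet n G ->
  holder_seminorm (2 * n - 1) g Om (@tps R d n) = H%:E ->
  forall s p q, size s = (2 * n - 1)%N -> Om p -> Om q ->
  `|G s p - G s q| <= H * enorm (p - q) `^ g.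
Proof.
move=> tG HE s p q sn Op Oq; have [jG G1 _] := tG.
pose al := mpoly.Multinom [tuple count_mem i s | i < d].
have pal : perm_eq (mnm_seq al) s by exact: mnm_seq_count.
have dal : mpoly.mdeg al = (2 * n - 1)%N by rewrite -size_mnm_seq (perm_size pal).
have bal : (mpoly.mdeg al < (2 * n - 1).+1)%N by rewrite dal.
pose be := mpoly.BMultinom bal.
have Gs : G s = mpartial al (@tps R d n).
  by rewrite mpartialE -G1 (jet_ds jG) ?size_mnm_seq ?dal // (jG.1 _ _ pal).
(* The quotient in the semi-norm is taken over distinct points only. *)
have [->|pq] := eqVneq p q.
  have H0 : 0 <= H.
    rewrite -lee_fin -HE; exact: bigmax_ge_id.
  by rewrite subrr normr0 mulr_ge0 // powR_ge0.
have en0 : 0 < enorm (p - q).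
  rewrite lt_neqAle enorm_ge0 andbT eq_sym; apply: contra pq => /eqP /enorm_eq0.
  by move=> /eqP; rewrite subr_eq0.
have : (holder0_seminorm g Om (mpartial al (@tps R d n)) <= H%:E)%E.
  rewrite -HE; apply: (@le_bigmax_cond _ _ _ _ be (fun be => mpoly.mdeg be == (2 * n - 1)%N)
    (fun be : mpoly.bmultinom d (2 * n - 1).+1 => holder0_seminorm g Om (mpartial be (@tps R d n)))).
  by rewrite /= dal.
move=> h0; rewrite -ler_pdivrMr ?powR_gt0 // -lee_fin; apply: le_trans h0.
by apply: ereal_sup_ubound; exists p, q; rewrite Gs.
Qed.

Lemma enorm_le_norm1 (u : 'rV[R]_d) : enorm u <= norm1 u.
Proof.
rewrite -[norm1 u]ger0_norm ?norm1_ge0 // -sqrtr_sqr; apply: ler_wsqrtr.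
rewrite expr2 mulr_suml; apply: ler_sum => i _; rewrite -(real_normK (num_real _)) expr2.
by rewrite ler_wpM2l // /norm1 (bigD1 i) //= lerDl sumr_ge0.
Qed.

Lemma norm1D (u v : 'rV[R]_d) : norm1 (u + v) <= norm1 u + norm1 v.
Proof.
rewrite -big_split; apply: ler_sum => i _; rewrite mxE; exact: ler_normD.
Qed.

Lemma norm1Z (c : R) (u : 'rV[R]_d) : norm1 (c *: u) = `|c| * norm1 u.
Proof. by rewrite /norm1 mulr_sumr; apply: eq_bigr => i _; rewrite mxE normrM. Qed.

Lemma star_ball_diff N (z : 'rV[R]_d) (x : 'I_N -> 'rV[R]_d) i j (a b : R) :
  0 <= a <= 1 -> 0 <= b <= 1 ->
  star_ball z x (a *: (x i - z) - b *: (x j - z)).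
Proof.
move=> a01 b01.
have st l (c : R) : 0 <= c <= 1 -> star z x (c *: (x l - z) + z).
  by move=> c01; exists l, c; split=> //; rewrite scalerBr scalerBl scale1r addrC addrA addrAC.
have -> : a *: (x i - z) - b *: (x j - z) =
  (a *: (x i - z) + z) - (b *: (x j - z) + z) by rewrite opprD addrACA subrr addr0.
rewrite /star_ball /= /diameter; apply: ub_le_sup; last first.
  by exists (a *: (x i - z) + z); [exact: st|exists (b *: (x j - z) + z); [exact: st|]].
(* A supremum dominates its elements only if the set is bounded above; 2S bounds the distances
   between points of the star. *)
pose S := \sum_l norm1 (x l - z).
exists (S + S) => _ [u [l1 [t1 [t1b ->]]] [v [l2 [t2 [t2b ->]]] <-]].
have -> : (1 - t1) *: z + t1 *: x l1 - ((1 - t2) *: z + t2 *: x l2) =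
   t1 *: (x l1 - z) + (- t2) *: (x l2 - z).
  by apply/rowP => c; rewrite !mxE; ring.
apply: le_trans (enorm_le_norm1 _) _; apply: le_trans (norm1D _ _) _.
rewrite !norm1Z normrN; apply: lerD.
  have [t10 t11] := andP t1b; rewrite ger0_norm //.
  apply: le_trans (_ : norm1 (x l1 - z) <= _); first by rewrite ler_piMl ?norm1_ge0.
  by rewrite /S (bigD1 l1) //= lerDl sumr_ge0 // => ? _; exact: norm1_ge0.
have [t20 t21] := andP t2b; rewrite ger0_norm //.
apply: le_trans (_ : norm1 (x l2 - z) <= _); first by rewrite ler_piMl ?norm1_ge0.
by rewrite /S (bigD1 l2) //= lerDl sumr_ge0 // => ? _; exact: norm1_ge0.
Qed.

End HolderLink.

(** * The error bound *)

Section Growth.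
Variables (R : realType) (d k s N : nat) (a : mpoly.bmultinom d k.+1 -> 'rV[R]_d -> R)
  (z : 'rV[R]_d) (x : 'I_N -> 'rV[R]_d).

Lemma diffopE f : diffop a f z = \sum_al a al z * ds (mnm_seq al) f z.
Proof. by apply: eq_bigr => al _; rewrite mpartialE. Qed.

Lemma diffop_peval p : diffop a (peval p) z = \sum_al a al z * peval (mds (mnm_seq al) p) z.
Proof. by rewrite diffopE; apply: eq_bigr => al _; rewrite ds_peval. Qed.

Lemma diffop_peval_sum (M : nat) (c : 'I_M -> R) (p : 'I_M -> mpoly.mpoly d R) :
  diffop a (peval (\sum_i c i *: p i)) z = \sum_i c i * diffop a (peval (p i)) z.
Proof.
rewrite diffop_peval; under [RHS]eq_bigr do rewrite diffop_peval mulr_sumr.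
rewrite exchange_big; apply: eq_bigr => al _ /=; rewrite mds_sum peval_sum mulr_sumr.
by apply: eq_bigr => i _; rewrite mdsZ pevalZ mulrCA.
Qed.

Lemma Pi_basis_exact (M : nat) (p : 'I_M -> mpoly.mpoly d R) (w : 'I_N -> R) :
  is_Pi_basis s p ->
  (forall i, \sum_j w j * peval (p i) (x j) = diffop a (peval (p i)) z) ->
  forall q, Pi s q -> \sum_j w j * peval q (x j) = diffop a (peval q) z.
Proof.
move=> [_ hp] hw q /hp [c [-> _]]; rewrite diffop_peval_sum.
under eq_bigr do rewrite peval_sum mulr_sumr; rewrite exchange_big /=.
apply: eq_bigr => i _; rewrite -hw mulr_sumr; apply: eq_bigr => j _.
by rewrite pevalZ mulrCA.
Qed.

(** An exact formula [w0] makes the growth function finite and turns p |-> Dp(z) into a functional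
    of the values of p at the nodes. The growth function is then its maximum over a box in the row
    space of the evaluation matrix, to which the duality applies. *)
Lemma growth_duality (M : nat) (p : 'I_M -> mpoly.mpoly d R) (mu : R) (w0 : 'I_N -> R) :
  mu != 0 -> injective x -> is_Pi_basis s p ->
  (forall q, Pi s q -> \sum_j w0 j * peval q (x j) = diffop a (peval q) z) ->
  exists r : R, [/\ 0 <= r, growth s a z x mu = r%:E &
    exists w : 'I_N -> R,
      (forall q, Pi s q -> \sum_j w j * peval q (x j) = diffop a (peval q) z) /\
      \sum_j `|w j| * enorm (x j - z) `^ mu <= r].
Proof.
move=> mu0 injx hp hw0; pose th j := enorm (x j - z) `^ mu.
have th0 j : 0 <= th j by exact: powR_ge0.
pose adm q := Pi s q /\ forall j, `|peval q (x j)| <= th j.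
have adm0 : adm 0.
  split; first by rewrite /Pi /= mpoly.msize0.
  by move=> j; rewrite /peval mpoly.meval0 normr0.
have D0 : diffop a (peval 0) z = 0.
  rewrite -hw0; last by case: adm0.
  by rewrite big1 // => j _; rewrite /peval mpoly.meval0 mulr0.
pose B := \sum_j `|w0 j| * th j.
have admB q : adm q -> diffop a (peval q) z <= B.
  move=> [qs qt]; rewrite -hw0 //; apply: ler_sum => j _.
  apply: le_trans (ler_norm _) _; rewrite normrM ler_wpM2l //.
have gB : (growth s a z x mu <= B%:E)%E.
  by apply: ge_ereal_sup => _ [q qadm <-]; rewrite lee_fin; exact: admB.
have g0 : (0%:E <= growth s a z x mu)%E.
  by apply: ereal_sup_ubound; exists 0 => //; rewrite D0.
have [r rE] : exists r, growth s a z x mu = r%:E.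
  by move: gB g0; case: (growth _ _ _ _ _) => [r| |] //; exists r.
have r0 : 0 <= r by rewrite -lee_fin -rE.
exists r; split=> //.
have adm_le q : adm q -> diffop a (peval q) z <= r.
  by move=> qadm; rewrite -lee_fin -rE; apply: ereal_sup_ubound; exists q.
pose A : 'M[R]_(M, N) := \matrix_(i, j) peval (p i) (x j).
pose W0 : 'cV[R]_N := \col_j w0 j.
have row_le q : Pi s q -> ((\row_j peval q (x j) : 'rV[R]_N) <= <<A>>)%MS.
  move=> qs; have [c [qE _]] := hp.2 q qs; rewrite genmxE; apply/submxP.
  exists (\row_i c i); apply/rowP => j; rewrite !mxE qE peval_sum.
  by apply: eq_bigr => i _; rewrite pevalZ !mxE.
have row_peval (v : 'rV[R]_N) : (v <= <<A>>)%MS ->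
    exists2 q, Pi s q & forall j, v 0 j = peval q (x j).
  rewrite genmxE => /submxP [c ->]; exists (\sum_i c 0 i *: p i).
    by apply: Pi_sum => i _; apply: PiZ; exact: hp.1.
  by move=> j; rewrite mxE peval_sum; apply: eq_bigr => i _; rewrite pevalZ mxE.
have dotW0 (v : 'rV[R]_N) q : Pi s q -> (forall j, v 0 j = peval q (x j)) ->
    dotc v W0 = diffop a (peval q) z.
  move=> qs vq; rewrite dotcE -hw0 //; apply: eq_bigr => j _.
  by rewrite vq mxE mulrC.
(* The threshold vanishes only at a node equal to z, since [mu] is nonzero; the nodes being
   distinct, there is at most one. *)
have th_uniq i j : th i = 0 -> th j = 0 -> i = j.
  have thz l : th l = 0 -> x l = z.
    move=> /eqP; rewrite powR_eq0 mu0 andbT => /eqP/enorm_eq0/eqP.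
    by rewrite subr_eq0 => /eqP.
  by move=> /thz xi /thz xj; apply: injx; rewrite xi xj.
have [|w [wV wr]] := @lp_duality R N <<A>>%MS W0 th r r0 th0 th_uniq.
  move=> v /row_peval[q qs vq] vth; rewrite (dotW0 v q qs vq); apply: adm_le; split=> // j.
  by rewrite -vq.
exists (fun j => w j 0); split=> // q qs.
have := wV _ (row_le q qs); rewrite (dotW0 _ q qs) => [<-|j]; last by rewrite mxE.
by rewrite dotcE; apply: eq_bigr => j _; rewrite mxE mulrC.
Qed.

End Growth.

Theorem corollary4 (R : realType) (d k n s N : nat)
  (hd : (0 < d)%N) (hn : (k + 1 <= n)%N) (hs : (n + 1 <= s)%N)
  (a : mpoly.bmultinom d k.+1 -> 'rV[R]_d -> R)
  (z : 'rV[R]_d) (x : 'I_N -> 'rV[R]_d) (hx : injective x)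
  (hcons : exists w : 'I_N -> R, forall p : mpoly.mpoly d R, Pi s p ->
     \sum_(j < N) w j * peval p (x j) = diffop a (peval p) z)
  (p : 'I_('C(d + s - 1, d)) -> mpoly.mpoly d R) (hp : is_Pi_basis s p)
  (w : 'I_N -> R)
  (hw : is_kernel_weight a (@tps_kernel R d n) p z x w)
  (f : 'rV[R]_d -> R) (hf : native_space s (@tps_kernel R d n) f)
  (g : R) (hg0 : 0 < g) (hg1 : g < 1) :
  (`|diffop a f z - \sum_(j < N) w j * f (x j)|%:E <=
     growth s a z x (n%:R - (1 - g) / 2)
     * (Num.sqrt (tps_const d n g))%:E
     * sqrte (holder_seminorm (2 * n - 1) g (star_ball z x) (@tps R d n))
     * (native_seminorm s (@tps_kernel R d n) f)%:E)%E.
Proof.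
have kn : (k < n)%N by rewrite -addn1.
have ns : (n < s)%N by rewrite -addn1.
have n0 : (0 < n)%N by exact: leq_ltn_trans kn.
pose G := @tps_partial R d n; have tG : tps_jet n G by exact: tps_partialP.
have [jG G1 G0] := tG.
pose mu : R := n%:R - (1 - g) / 2.
have mu0 : mu != 0.
  rewrite gt_eqF // /mu; have : 1 <= (n%:R : R) by rewrite ler1n.
  lra.
pose A al := a al z.
pose sq (al : mpoly.bmultinom d k.+1) := mnm_seq al.
have sqk al : (size (sq al) <= k)%N by rewrite size_mnm_seq -ltnS; exact: mpoly.bmdeg.
have exactE (w' : 'I_N -> R) :
    (forall q, Pi s q -> \sum_j w' j * peval q (x j) = diffop a (peval q) z) ->
    forall q, Pi s q -> \sum_j w' j * peval q (x j) = \sum_al A al * peval (mds (sq al) q) z.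
  by move=> H q qs; rewrite H // diffop_peval.
have [w0 hw0] := hcons.
have [r [r0 -> [w1 [w1ex w1r]]]] := growth_duality mu0 hx hp hw0.
have [v [hv1 hv2]] := hw.
have wex := Pi_basis_exact hp hv2.
pose JF w' := jet_form n G A sq z w' x.
have JFle : JF w <= JF w1.
  (* The polynomial part of the kernel system supplies the correction term in the minimality
     argument. *)
  pose P := \sum_i v i *: p i.
  apply: (jet_form_min n0 ns (r := peval P)).
  - by move=> q qs; rewrite wex // w1ex.
  - by exists P => //; apply: Pi_sum => i _; apply: PiZ; exact: hp.1.
  - move=> i; have := hv1 i; rewrite diffopE => E.
    transitivity (\sum_al a al z * ds (mnm_seq al) (tps_kernel n ^~ (x i)) z).
      by rewrite -E peval_sum; congr (_ + _); apply: eq_bigr => j _; rewrite pevalZ.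
    apply: eq_bigr => al _; congr (_ * _).
    have sr : (size (sq al) <= 2 * n - 1)%N by apply: leq_trans (sqk al) _; lia.
    have := jet_ds (jet_shift (x i) jG) sr; rewrite G1.
    by move=> /(congr1 (fun F => F z)).
set H := holder_seminorm _ _ _ _.
set C := tps_const d n g.
have C0 : 0 < C.
  rewrite /C /tps_const divr_gt0 ?powR_gt0 ?ltr0n //.
  rewrite big_seq; apply: prodr_gt0 => i _; rewrite exprn_gt0 // ltr_wpDr // divr_gt0 //.
  by rewrite addr_gt0.
pose sg := \sum_j `|w1 j| * enorm (x j - z) `^ mu.
have sg0 : 0 <= sg by apply: sumr_ge0 => j _; rewrite mulr_ge0 // powR_ge0.
have JFE : JF w1 = \sum_i \sum_j w1 i * w1 j * tps_remainder n G (x i - z) (x j - z).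
  exact: (jet_form_remainder n0 kn ns tG sqk (exactE _ w1ex)).
have H0 : (0 <= H)%E by exact: bigmax_ge_id.
have JFH (h : R) : H = h%:E -> JF w1 <= C * h * sg ^+ 2.
  move=> HE; have h0 : 0 <= h by rewrite -lee_fin -HE.
  have hol := holder_seminorm_le tG HE.
  have -> : C * h * sg ^+ 2 = \sum_i \sum_j (`|w1 i| * `|w1 j|) * (C * h *
     (enorm (x i - z) `^ mu * enorm (x j - z) `^ mu)).
    rewrite expr2 /sg mulr_suml mulr_sumr; apply: eq_bigr => i _.
    by rewrite !mulr_sumr; apply: eq_bigr => j _; ring.
  rewrite JFE; apply: ler_sum => i _; apply: ler_sum => j _.
  apply: le_trans (ler_norm _) _; rewrite !normrM ler_wpM2l ?mulr_ge0 //.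
  apply: (tps_remainder_le n0 tG hg0 hg1 h0 hol) => b c b01 c01.
  exact: star_ball_diff.
have JF0 : sg = 0 -> JF w1 = 0.
  move=> /eqP; rewrite psumr_eq0 => [/allP sgz|j _]; last by rewrite mulr_ge0 // powR_ge0.
  rewrite JFE big1 // => i _; rewrite big1 // => j _.
  have := sgz i; rewrite mem_index_enum => /(_ isT).
  rewrite mulf_eq0 normr_eq0 powR_eq0 mu0 andbT => /orP[/eqP->|/eqP/enorm_eq0 ->].
    by rewrite !mul0r.
  by rewrite (tps_remainder0l n0 tG) mulr0.
set c := native_seminorm _ _ _.
(* Membership in the native space ensures that [xget] returns a value satisfying the relation and
   not its default. *)
have [h [e [he hC hlim ec]]] : native_seminorm_is s (@tps_kernel R d n) f c.
  exact: (xgetPex 0 hf).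
have c0 : 0 <= c.
  apply: cvg_ge0 ec; apply: nearW => m.
  by have [? [? [? [? [_ _ _ ->]]]]] := he m; exact: sqrtr_ge0.
have main : `|diffop a f z - \sum_j w j * f (x j)| <= c * Num.sqrt (JF w).
  have L : `|diffop a (h m) z - \sum_j w j * h m (x j)| @[m --> \oo] -->
           `|diffop a f z - \sum_j w j * f (x j)|.
    apply: cvg_norm; rewrite diffopE; under eq_fun do rewrite diffopE.
    apply: cvgB.
      apply: cvg_sumr => al; apply: cvg_cMr.
      apply: (ds_native_cvg n0 ns tG he hC hlim).
      exact: leq_ltn_trans (sqk al) kn.
    by apply: cvg_sumr => j; apply: cvg_cMr; exact: hlim.
  have L2 : e m * Num.sqrt (JF w) - `|diffop a (h m) z - \sum_j w j * h m (x j)|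
    @[m --> \oo] --> c * Num.sqrt (JF w) - `|diffop a f z - \sum_j w j * f (x j)|.
    by apply: cvgB => //; apply: cvgM => //; exact: cvg_cst.
  rewrite -subr_ge0; apply: cvg_ge0 L2; apply: nearW => m; rewrite subr_ge0 diffopE.
  exact: (pre_native_functional_le n0 ns tG kn sqk (exactE _ wex) (he m)).
have main1 : `|diffop a f z - \sum_j w j * f (x j)| <= c * Num.sqrt (JF w1).
  by apply: le_trans main _; rewrite ler_wpM2l // ler_wsqrtr.
(* In the extended reals 0 * +oo = 0, so a vanishing factor could meet an infinite Hölder semi-norm;
   the cases c = 0 and sg = 0 are settled on their own, where the left-hand side is 0. *)
have [c00|cn0] := eqVneq c 0.
  by move: main1; rewrite c00 mule0 mul0r lee_fin.
have [sgz|sgn] := eqVneq sg 0.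
  apply: (@le_trans _ _ 0%:E).
    by rewrite lee_fin (le_trans main1) // JF0 // sqrtr0 mulr0.
  by rewrite !mule_ge0 ?lee_fin ?sqrtr_ge0 ?sqrte_ge0.
have sgp : 0 < sg by rewrite lt_neqAle eq_sym sgn.
have rp : 0 < r by exact: lt_le_trans w1r.
have cp : 0 < c by rewrite lt_neqAle eq_sym cn0.
have sCp : 0 < Num.sqrt C by rewrite sqrtr_gt0.
(* All other factors are positive by now, so an infinite semi-norm makes the right-hand side
   infinite. *)
move: H0 JFH; case: H => [hh| |] // H0 JFH.
  have hh0 : 0 <= hh by rewrite -lee_fin.
  rewrite [sqrte _]/= -!EFinM lee_fin; apply: le_trans main1 _.
  rewrite mulrC ler_wpM2r //; apply: (@le_trans _ _ (Num.sqrt (C * hh * sg ^+ 2))).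
    by apply: ler_wsqrtr; exact: JFH.
  have -> : Num.sqrt (C * hh * sg ^+ 2) = sg * (Num.sqrt C * Num.sqrt hh).
    rewrite sqrtrM; last by rewrite mulr_ge0 // ltW.
    by rewrite sqrtr_sqr (ger0_norm sg0) sqrtrM ?(ltW C0) // mulrC.
  by rewrite -mulrA ler_wpM2r ?mulr_ge0 ?sqrtr_ge0.
rewrite [sqrte _]/= -EFinM gt0_muley ?lte_fin ?mulr_gt0 // gt0_mulye ?lte_fin //.
exact: leey.
Qed.
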